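(* A finite simple graph $G$ belongs to $FP$ if and only if every 3-connected component of $G$ is, up to isomorphism, of one of the following types: (0) a cycle $C_n$ or an $n$-fold multiedge (two vertices joined by $n$ parallel edges), $n>2$, where any of the edges may be virtual; (1) the wheel $W_3$ (that is, $K_4$), where only spoke edges (the three edges at one fixed vertex chosen as the hub) may be virtual; (2) a wheel $W_k$, $k>2$, where only rim edges may be virtual; (3) the prism $\overline{C_6}$, where only edges not belonging to a triangle may be virtual.
   Context: $FP = N_{\circ}(K_5^-,K_{3,3}^-)$ is the class of finite simple graphs having neither $K_5^-$ nor $K_{3,3}^-$ as a minor, where $K_5^-$ and $K_{3,3}^-$ are $K_5$ and $K_{3,3}$ with one edge deleted, and a minor of $G$ is a graph obtained from $G$ by vertex deletions, edge deletions and edge contractions. $W_k$ is the wheel with $k$ spokes: a cycle of length $k$ (its edges are the rim edges) together with a hub vertex joined to each cycle vertex by a spoke edge. $\overline{C_6}$, the complement of the 6-cycle, is the triangular prism: two disjoint triangles joined by a perfect matching. The 3-connected components of a graph are the Tutte (triconnected) components of its blocks with at least three vertices: such a block is decomposed along its 2-vertex separations, in the canonical way, into cycles of length at least 3, multiedges with at least 3 parallel edges, and 3-connected simple graphs with at least 4 vertices; these components are in general multigraphs. At each splitting along a vertex pair $\{a,b\}$ a new edge $ab$ is added to both parts; these added edges are called virtual edges, the other edges of the components being edges of $G$. *)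

(* Defs.v *)
From HB Require Import structures.
From mathcomp Require Import all_boot finmap.

Set Implicit Arguments.
Unset Strict Implicit.
Unset Printing Implicit Defensive.

Record sgraph := SGraph {
  svertex :> finType;
  adj : rel svertex;
  adj_sym : symmetric adj;
  adj_irrefl : irreflexive adj }.

Definition edge_set (G : sgraph) : {set {set G}} :=
  [set [set p.1; p.2] | p in [set p : G * G | adj p.1 p.2]].

Definition sgraph_iso (G H : sgraph) : Prop :=
  exists2 f : G -> H, bijective f & forall x y, adj (f x) (f y) = adj x y.

Section Operations.
Variable G : sgraph.

Definition del_vertex_adj (v : G) : rel {x : G | x != v} :=
  fun x y => adj (val x) (val y).

Fact del_vertex_sym v : symmetric (@del_vertex_adj v).
Proof. by move=> x y; apply: adj_sym. Qed.

Fact del_vertex_irrefl v : irreflexive (@del_vertex_adj v).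
Proof. by move=> x; apply: adj_irrefl. Qed.

Definition del_vertex (v : G) : sgraph :=
  SGraph (@del_vertex_sym v) (@del_vertex_irrefl v).

Definition del_edge_adj (u v : G) : rel G :=
  fun x y => adj x y && ([set x; y] != [set u; v]).

Fact del_edge_sym u v : symmetric (del_edge_adj u v).
Proof. by move=> x y; rewrite /del_edge_adj adj_sym setUC. Qed.

Fact del_edge_irrefl u v : irreflexive (del_edge_adj u v).
Proof. by move=> x; rewrite /del_edge_adj adj_irrefl. Qed.

Definition del_edge (u v : G) : sgraph :=
  SGraph (@del_edge_sym u v) (@del_edge_irrefl u v).

(* Contracting uv merges v into u; the loop and the parallel edges that this
   may create are dropped, so that the result is again simple. *)
Definition contract_adj (u v : G) : rel {x : G | x != v} :=
  fun x y => (x != y) &&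
    [|| adj (val x) (val y),
        (val x == u) && adj v (val y) |
        (val y == u) && adj v (val x)].

Fact contract_sym u v : symmetric (@contract_adj u v).
Proof.
move=> x y; rewrite /contract_adj eq_sym adj_sym.
by congr (_ && (_ || _)); rewrite orbC.
Qed.

Fact contract_irrefl u v : irreflexive (@contract_adj u v).
Proof. by move=> x; rewrite /contract_adj eqxx. Qed.

Definition contract (u v : G) : sgraph :=
  SGraph (@contract_sym u v) (@contract_irrefl u v).

End Operations.

(* [minor H G] : H is isomorphic to a minor of G. *)
Inductive minor (H : sgraph) : sgraph -> Prop :=
| minor_iso (G : sgraph) : sgraph_iso H G -> minor H G
| minor_del_vertex (G : sgraph) (v : G) :
    minor H (del_vertex v) -> minor H G
| minor_del_edge (G : sgraph) (u v : G) :
    adj u v -> minor H (del_edge u v) -> minor H G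
| minor_contract (G : sgraph) (u v : G) :
    adj u v -> minor H (contract u v) -> minor H G.

Definition complete_adj n : rel 'I_n := fun x y => x != y.

Fact complete_sym n : symmetric (@complete_adj n).
Proof. by move=> x y; apply: (congr1 negb (eq_sym x y)). Qed.

Fact complete_irrefl n : irreflexive (@complete_adj n).
Proof. by move=> x; rewrite /complete_adj eqxx. Qed.

Definition complete n := SGraph (@complete_sym n) (@complete_irrefl n).

Definition bicomplete_adj n : rel (bool * 'I_n)%type :=
  fun x y => x.1 != y.1.

Fact bicomplete_sym n : symmetric (@bicomplete_adj n).
Proof. by move=> x y; apply: (congr1 negb (eq_sym x.1 y.1)). Qed.

Fact bicomplete_irrefl n : irreflexive (@bicomplete_adj n).
Proof. by move=> x; rewrite /bicomplete_adj eqxx. Qed.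

(* K_{n,n} *)
Definition bicomplete n := SGraph (@bicomplete_sym n) (@bicomplete_irrefl n).

Definition K5_minus : sgraph :=
  @del_edge (complete 5) ord0 ord_max.

Definition K33_minus : sgraph :=
  @del_edge (bicomplete 3) (false, ord0) (true, ord0).

Definition FP (G : sgraph) : Prop :=
  ~ minor K5_minus G /\ ~ minor K33_minus G.

(* The subgraph induced by S is connected (the empty graph counts as
   connected). *)
Definition connected_on (V : finType) (r : rel V) (S : {set V}) : bool :=
  [forall x in S, forall y in S,
     connect (fun u v => [&& u \in S, v \in S & r u v]) x y].

Definition nonseparable (G : sgraph) (S : {set G}) : bool :=
  [&& S != set0, connected_on (@adj G) S &
      [forall v in S, connected_on (@adj G) (S :\ v)]].

Definition block (G : sgraph) (S : {set G}) : bool :=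
  maxset (@nonseparable G) S.

(* Loopless multigraphs: [ends e] is the set of the two ends of e. *)
Record mgraph := MGraph {
  mvertex : finType;
  medge : finType;
  ends : medge -> {set mvertex} }.

(* [copy_of M H virt ok] : M is isomorphic to H, by an isomorphism sending the
   edges selected by virt to edges selected by ok. *)
Definition copy_of (M H : mgraph) (virt : pred (medge M)) (ok : pred (medge H))
  : Prop :=
  exists (f : mvertex M -> mvertex H) (g : medge M -> medge H),
    [/\ bijective f, bijective g,
        forall e, ends (g e) = f @: ends e &
        forall e, virt e -> ok (g e)].

Definition mgraph_iso (M H : mgraph) : Prop :=
  @copy_of M H xpredT xpredT.

Definition cycle_mgraph n : mgraph :=
  @MGraph 'I_n 'I_n (fun i => [set i; ordS i]).

Definition multiedge n : mgraph :=
  @MGraph bool 'I_n (fun _ => [set: bool]).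

(* The hub is None; inl i is a rim edge and inr i a spoke. *)
Definition wheel_ends k (e : 'I_k + 'I_k) : {set option 'I_k} :=
  match e with
  | inl i => [set Some i; Some (ordS i)]
  | inr i => [set None; Some i]
  end.

Definition wheel k : mgraph := MGraph (@wheel_ends k).

Definition is_rim k (e : medge (wheel k)) : bool := is_inl e.

Definition is_spoke k (e : medge (wheel k)) : bool := ~~ is_inl e.

Definition mgraph_of (G : sgraph) : mgraph :=
  @MGraph G {A : {set G} | A \in edge_set G} val.

Definition in_triangle (G : sgraph) (e : medge (mgraph_of G)) : bool :=
  [exists z : G, [forall x in val e, adj x z]].

Definition co_cycle_adj n : rel 'I_n :=
  fun x y => [&& x != y, y != ordS x & x != ordS y].

Fact co_cycle_sym n : symmetric (@co_cycle_adj n).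
Proof.
by move=> x y; rewrite /co_cycle_adj eq_sym [X in _ && X]andbC.
Qed.

Fact co_cycle_irrefl n : irreflexive (@co_cycle_adj n).
Proof. by move=> x; rewrite /co_cycle_adj eqxx. Qed.

(* The complement of the cycle C_n *)
Definition co_cycle n := SGraph (@co_cycle_sym n) (@co_cycle_irrefl n).

Definition prism : mgraph := mgraph_of (co_cycle 6).

Definition madj (M : mgraph) : rel (mvertex M) :=
  fun x y => (x != y) && [exists e, ends e == [set x; y]].

Definition is_cycle (M : mgraph) : Prop :=
  exists2 n, 2 < n & mgraph_iso M (cycle_mgraph n).

Definition is_multiedge (M : mgraph) : Prop :=
  exists2 n, 2 < n & mgraph_iso M (multiedge n).

Definition simple_3connected (M : mgraph) : Prop :=
  [/\ injective (@ends M), 3 < #|mvertex M| &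
      forall S : {set mvertex M}, #|S| < 3 -> connected_on (@madj M) (~: S)].

Local Open Scope fset_scope.

Section Tutte.
Variable G : sgraph.

(* (A, None) is the edge of G with set of ends A; (A, Some k) is a virtual
   edge with set of ends A, k being a label identifying the splitting that
   created it. *)
Definition tedge : Type := ({set G} * option nat)%type.

(* A multigraph on vertices of G without isolated vertices, given by its
   edges *)
Definition piece : Type := {fset tedge}.

Definition piece_support (P : piece) : {set G} :=
  \bigcup_(e : P) (val e).1.

Definition piece_ends (P : piece) (e : P) :
  {set {x : G | x \in piece_support P}} :=
  [set x | val x \in (val e).1].

Definition piece_mgraph (P : piece) : mgraph := MGraph (@piece_ends P).

Definition virtual (P : piece) (e : medge (piece_mgraph P)) : bool :=
  (val e).2 != None.

Definition induced_piece (S : {set G}) : piece :=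
  [fset ((A, None) : tedge) | A in [set A in edge_set G | A \subset S]].

Definition fresh (D : {fset piece}) (k : nat) : Prop :=
  forall (P : piece) (e : tedge), P \in D -> e \in P -> e.2 != Some k.

(* The sets of pieces obtained from B by successive splittings along vertex
   pairs {a,b}; both parts of a splitting receive the same new virtual edge. *)
Inductive splitting (B : piece) : {fset piece} -> Prop :=
| splitting_start : splitting B [fset B]
| splitting_step (D : {fset piece}) (P E1 E2 : piece) (a b : G) (k : nat) :
    splitting B D -> P \in D ->
    E1 `|` E2 = P -> E1 `&` E2 = fset0 ->
    1 < #|` E1| -> 1 < #|` E2| ->
    a != b -> piece_support E1 :&: piece_support E2 = [set a; b] ->
    fresh D k ->
    let e : tedge := ([set a; b], Some k) in
    splitting B ((D `\ P) `|` [fset (e |` E1 : piece); (e |` E2 : piece)]).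

(* The canonical decomposition is the one in which no two cycles, and no two
   multiedges, have a virtual edge in common. *)
Definition tutte_decomposition (B : piece) (D : {fset piece}) : Prop :=
  [/\ splitting B D,
      forall P : piece, P \in D ->
        [\/ is_cycle (piece_mgraph P), is_multiedge (piece_mgraph P)
          | simple_3connected (piece_mgraph P)] &
      forall (P Q : piece) (e : tedge),
        P \in D -> Q \in D -> P != Q -> e \in P -> e \in Q ->
        ~ (is_cycle (piece_mgraph P) /\ is_cycle (piece_mgraph Q)) /\
        ~ (is_multiedge (piece_mgraph P) /\ is_multiedge (piece_mgraph Q))].

Definition component_3connected (C : piece) : Prop :=
  exists (S : {set G}) (D : {fset piece}),
    [/\ block S, 2 < #|S|, tutte_decomposition (induced_piece S) D & C \in D].

Definition type0 (C : piece) : Prop :=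
  exists2 n, 2 < n &
    @copy_of (piece_mgraph C) (cycle_mgraph n) (@virtual C) xpredT \/
    @copy_of (piece_mgraph C) (multiedge n) (@virtual C) xpredT.

Definition type1 (C : piece) : Prop :=
  @copy_of (piece_mgraph C) (wheel 3) (@virtual C) (@is_spoke 3).

Definition type2 (C : piece) : Prop :=
  exists2 k, 2 < k &
    @copy_of (piece_mgraph C) (wheel k) (@virtual C) (@is_rim k).

Definition type3 (C : piece) : Prop :=
  @copy_of (piece_mgraph C) prism (@virtual C)
    (fun e => ~~ in_triangle e).

End Tutte.

(* Main.v *)
(* Let H be K_5^- or K_{3,3}^-. A virtual edge of a piece stands for a path
   through the rest of its block, so a piece with its virtual edges subdivided
   is a minor of G. Conversely H has no 2-separation except the trivial ones at
   a vertex of degree 2, and such a vertex fits on the subdivision of a virtual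
   edge, so a minor H of a subdivided piece survives in one of the two sides of
   every splitting. Hence G is in FP iff no subdivided component has H as a
   minor.

   The components of types (0)-(3) have no such minor by counting degrees:
   taking minors never raises the sum of the excesses deg - 2, K_{3,3}^- is
   triangle-free, so that an edge of a triangle of the host may be dropped, and
   H minus any vertex has a vertex of degree 3, whereas a wheel minus its hub
   has none.

   For the converse, a 3-connected component without minor H has an induced
   nonseparating cycle c, of length at least 4 if there are more than 4
   vertices. If more than one vertex lies outside c, these vertices split into
   two connected sets with at least two neighbours on c each; avoiding K_{3,3}^-
   makes c a 4-cycle on which the two sets attach to opposite edges, and the
   induced nonseparating cycles through these edges show the graph to be a
   prism or a wheel. Otherwise it is a wheel. The virtual edges are located by
   exhibiting K_{3,3}^- with a branch set at the subdivision vertex of each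
   forbidden one. *)

Require Import Defs.
From mathcomp Require Import all_boot finmap.
From mathcomp Require Import zify.
From Stdlib Require Import Classical.

Set Implicit Arguments.
Unset Strict Implicit.
Unset Printing Implicit Defensive.

(** * Connected sets *)

(** Deletions and contractions change the vertex type, so minors are handled through branch sets
    ([rminor]), and the inductive [minor] is translated only in the final proof. A piece is studied
    through [hat] on [G + 'I_N], where the label of a virtual edge is its subdividing vertex; one
    bound [N] for all labels of a decomposition puts all its pieces on the same vertices.

    If all components are of the four types, a forbidden minor of G has to be traced into some
    component, so a canonical decomposition must be shown to exist. It arises by splitting as long
    as possible and then merging cycles, or multiedges, that share a virtual edge. As [splitting]
    admits no merging, each merge must be shown reachable by splittings alone; this works because a
    merge commutes with every splitting step except the one that it undoes.

    The subdividing vertices make the position of the virtual edges visible: K4 is too small to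
    contain a forbidden graph, but subdividing two disjoint edges turns it into [K33_minus]. *)

Section Connected.
Variables (T : finType) (r : rel T).

(** Connectivity as the absence of a cut: this form restricts, enlarges and passes to branch sets
    without surgery on paths, and nearly every later proof enters and leaves [connected_on] through
    it. *)
Lemma connP (S : {set T}) :
  reflect (forall (A : {set T}) x y,
             x \in S -> y \in S -> x \in A -> y \notin A ->
           exists u v, [/\ u \in S, v \in S, u \in A, v \notin A & r u v])
          (connected_on r S).
Proof.
apply: (iffP idP) => [cS A x y Sx Sy Ax Ay|cut].
  have /forall_inP/(_ y Sy) := forall_inP cS x Sx.
  move=> /connectP[p]; elim: p x Ax {Sx} => [|z p IHp] x Ax /=.
    by move=> _ Dy; rewrite Dy Ax in Ay.
  case/andP=> /and3P[Sx Sz rxz] pP Dy.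
  by have [Az|Az] := boolP (z \in A); [apply: IHp pP Dy | exists x, z].
apply/forall_inP=> x Sx; apply/forall_inP=> y Sy.
set e := (fun u v => _); pose A := [set z | connect e x z].
case: (boolP (y \in A)) => [|Ay]; first by rewrite inE.
have Ax : x \in A by rewrite inE.
have [u [v [Su Sv]]] := cut A x y Sx Sy Ax Ay.
rewrite !inE => xu xv ruv; case/negP: xv; apply: connect_trans xu _.
by apply: connect1; rewrite /e Su Sv.
Qed.

Lemma conn0 : connected_on r set0.
Proof. by apply/connP=> A x y; rewrite inE. Qed.

Lemma conn1 x : connected_on r [set x].
Proof. by apply/connP=> A y z /set1P-> /set1P-> ->. Qed.

Hypothesis r_sym : symmetric r.

Lemma connU (S S' : {set T}) u v :
  connected_on r S -> connected_on r S' -> u \in S -> v \in S' ->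
  (u == v) || r u v -> connected_on r (S :|: S').
Proof.
move=> /connP cS /connP cS' Su Sv uv; apply/connP=> A x y.
move=> Sx Sy Ax Ay.
case: (boolP [exists z in S, z \in A]) => [/exists_inP[z Sz Az]|nS].
  case: (boolP [exists z in S, z \notin A]) => [/exists_inP[z' Sz' Az']|nS'].
    have [s [t [? ? ? ? ?]]] := cS A z z' Sz Sz' Az Az'.
    by exists s, t; split; rewrite // inE ?H ?H0 //; apply/orP; left.
  have Au : u \in A.
    by apply: contraR nS' => nAu; apply/exists_inP; exists u.
  have Sy' : y \in S'.
    case/setUP: Sy => // Sy; case/negP: nS'; apply/exists_inP.
    by exists y.
  have [Av|Av] := boolP (v \in A).
    have [s [t [? ? ? ? ?]]] := cS' A v y Sv Sy' Av Ay.
    by exists s, t; split; rewrite // inE; apply/orP; right.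
  exists u, v; split; rewrite ?inE ?Su ?Sv ?orbT //.
  by case/orP: uv => // /eqP Duv; rewrite -Duv Au in Av.
have Sx' : x \in S'.
  by case/setUP: Sx => // Sx; case/negP: nS; apply/exists_inP; exists x.
have nAu : u \notin A.
  by apply: contra nS => nAu; apply/exists_inP; exists u.
have [Av|Av] := boolP (v \in A).
  exists v, u; split; rewrite ?inE ?Su ?Sv ?orbT //.
  by case/orP: uv; [move=> /eqP Duv; rewrite Duv Av in nAu | rewrite r_sym].
have [s [t [? ? ? ? ?]]] := cS' A x v Sx' Sv Ax Av.
by exists s, t; split; rewrite // inE; apply/orP; right.
Qed.

Lemma conn_path x p : path r x p -> connected_on r [set z in x :: p].
Proof.
elim: p x => [|y p IHp] x /=.
  by move=> _; have -> : [set z in [:: x]] = [set x]; [apply/setP=> z; rewrite !inE | apply: conn1].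
case/andP=> rxy /IHp cp.
have -> : [set z in x :: y :: p] = [set x] :|: [set z in y :: p].
  by apply/setP=> z; rewrite !inE.
apply: (connU (conn1 x) cp (set11 x) _ (v := y)); rewrite ?rxy ?orbT //.
by rewrite !inE eqxx.
Qed.

Lemma component (S : {set T}) x : x \in S ->
  exists K : {set T}, [/\ x \in K, K \subset S, connected_on r K &
    forall y z, y \in K -> z \in S -> r y z -> z \in K].
Proof.
move=> Sx; pose e u v := [&& u \in S, v \in S & r u v].
have e_sym : symmetric e by move=> u v; rewrite /e r_sym andbCA.
exists [set y | connect e x y]; split; rewrite ?inE //.
- apply/subsetP=> y; rewrite inE => /connectP[p].
  elim/last_ind: p y => [|p z _] y /=; first by move=> _ ->.
  by rewrite rcons_path last_rcons => /andP[_ /and3P[_ Sz _]] ->.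
- apply/connP=> A y z; rewrite !inE => xy xz Ay Az.
  have: connect e y z by rewrite (connect_trans _ xz) // (sym_connect_sym e_sym).
  case/connectP=> p; elim: p y xy Ay => [|t p IHp] y xy Ay /=.
    by move=> _ Dz; rewrite Dz Ay in Az.
  case/andP=> eyt pP Dz; have xt := connect_trans xy (connect1 eyt).
  have [At|At] := boolP (t \in A); first exact: IHp pP Dz.
  by exists y, t; split; rewrite ?inE //; case/and3P: eyt.
move=> y z; rewrite !inE => xy Sz ryz; apply: (connect_trans xy); apply: connect1.
rewrite /e Sz ryz !andbT.
case/connectP: xy => p; elim/last_ind: p => [|p t _] /=; first by move=> _ ->.
by rewrite rcons_path last_rcons => /andP[_ /and3P[_ Sz' _]] ->.
Qed.

(** By symmetry of [r] a cut may be replaced by its complement, so only the cuts that leave the root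
    [a] outside have to be crossed. *)
Lemma conn_root (S : {set T}) a : a \in S ->
  (forall (A : {set T}) x, x \in S -> x \in A -> a \notin A ->
     exists u v, [/\ u \in S, v \in S, u \in A, v \notin A & r u v]) ->
  connected_on r S.
Proof.
move=> Sa cut; apply/connP=> A x y Sx Sy Ax Ay.
have [Aa|Aa] := boolP (a \in A); last exact: cut Ax Aa.
have [||u [w [Su Sw]]] := cut (~: A) y Sy; rewrite ?inE ?negbK //.
by move=> nAu Aw ruw; exists w, u; split; rewrite // r_sym.
Qed.

(* Removing a component of S :\ v keeps S connected, as every other component
   hangs on v. *)
Lemma conn_setD_component (S K : {set T}) v :
  connected_on r S -> v \in S -> v \notin K -> K \subset S ->
  (forall y z, y \in K -> z \in S :\ v -> r y z -> z \in K) ->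
  connected_on r (S :\: K).
Proof.
move=> cS Sv Kv KS clK; apply: (@conn_root _ v); first by rewrite inE Kv.
move=> A x; rewrite inE => /andP[Kx Sx] Ax Av.
have /connP/(_ (A :\: K) x v Sx Sv) := cS; rewrite !inE Kx Ax (negbTE Av) andbF.
case=> // u [w [Su Sw]]; rewrite !inE => /andP[Ku Au] nKAw ruw.
have Kw : w \notin K.
  apply: contra Ku => Kw; apply: clK Kw _ _; last by rewrite r_sym.
  by rewrite !inE Su andbT; apply: contraTneq Au => ->.
by exists u, w; split; rewrite ?inE ?Ku ?Kw //; rewrite Kw in nKAw.
Qed.

End Connected.

Lemma eq_conn (T : finType) (r r' : rel T) (S : {set T}) :
  {in S &, r =2 r'} -> connected_on r S = connected_on r' S.
Proof.
move=> err'; apply/connP/connP=> cS A x y Sx Sy Ax Ay;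
  have [u [v [Su Sv Au Av ruv]]] := cS A x y Sx Sy Ax Ay; exists u, v; split=> //.
  by rewrite -err'.
by rewrite err'.
Qed.

Lemma sub_conn (T : finType) (r r' : rel T) (S : {set T}) :
  {in S &, subrel r r'} -> connected_on r S -> connected_on r' S.
Proof.
move=> err' /connP cS; apply/connP=> A x y Sx Sy Ax Ay.
by have [u [v [Su Sv Au Av ruv]]] := cS A x y Sx Sy Ax Ay; exists u, v; split; auto.
Qed.

(** * Branch sets *)

(* Minors of relations by branch sets: [g z = Some x] puts z in the branch set
   of x. Branch sets may be empty, which is harmless for an h without isolated
   vertices. *)
Definition rminor (T T' : finType) (h : rel T) (r : rel T') : Prop :=
  exists g : T' -> option T,
    (forall x, connected_on r [set z | g z == Some x]) /\
    (forall x y, h x y ->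
       exists z w, [/\ g z = Some x, g w = Some y & r z w]).

Lemma rminor_trans (T1 T2 T3 : finType) (r1 : rel T1) (r2 : rel T2) (r3 : rel T3) :
  rminor r1 r2 -> rminor r2 r3 -> rminor r1 r3.
Proof.
move=> [g [cg ag]] [f [cf af]]; exists (fun z => obind g (f z)); split; last first.
  move=> x y /ag[z [w [gz gw /af[z' [w' [fz fw ?]]]]]].
  by exists z', w'; split; rewrite ?fz ?fw.
move=> t; apply/connP=> A x y; rewrite !inE => tx ty Ax Ay.
have split_fiber u a b : g u = Some t -> f a = Some u -> f b = Some u ->
    a \in A -> b \notin A ->
    exists a' b', [/\ a' \in [set z | obind g (f z) == Some t],
      b' \in [set z | obind g (f z) == Some t], a' \in A, b' \notin A & r3 a' b'].
  move=> gu fa fb Aa Ab; have /connP/(_ A a b) := cf u.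
  rewrite !inE fa fb eqxx => -[] // a' [b' []].
  by rewrite !inE => /eqP fa' /eqP fb' *; exists a', b'; rewrite !inE fa' fb' /= gu eqxx.
case Dx: (f x) tx => [x'|//] /= /eqP gx; case Dy: (f y) ty => [y'|//] /= /eqP gy.
(* [B] collects the middle vertices whose bag meets [A]. Either some bag is itself cut by [A], and
   its connectivity gives the edge, or an edge of the middle graph leaves [B], and the edge that
   realises it leaves [A]. *)
pose B := [set u | [exists z in A, f z == Some u]].
have inB u z : g u = Some t -> f z = Some u -> z \notin A -> u \notin B \/
    exists a' b', [/\ a' \in [set z | obind g (f z) == Some t],
      b' \in [set z | obind g (f z) == Some t], a' \in A, b' \notin A & r3 a' b'].
  move=> gu fz Az; have [Bu|] := boolP (u \in B); last by left.
  right; move: Bu; rewrite inE => /exists_inP[a Aa /eqP fa].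
  exact: split_fiber gu fa fz Aa Az.
case: (inB y' y gy Dy Ay) => // By.
have Bx : x' \in B by rewrite inE; apply/exists_inP; exists x; rewrite ?Dx.
have /connP/(_ B x' y') := cg t; rewrite !inE gx gy eqxx.
rewrite !inE in Bx By; case=> // u [v []]; rewrite !inE => /eqP gu /eqP gv Bu Bv.
case/af=> z [w [fz fw rzw]].
have Aw : w \notin A.
  by apply: contra Bv => Aw; apply/exists_inP; exists w; rewrite ?fw.
have [Az|Az] := boolP (z \in A).
  by exists z, w; rewrite !inE fz fw /= gu gv eqxx.
by case: (inB u z gu fz Az) => //; rewrite inE Bu.
Qed.

Lemma sub_rminor (T T' : finType) (h h' : rel T) (r r' : rel T') :
  subrel h' h -> subrel r r' -> rminor h r -> rminor h' r'.
Proof.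
move=> hh rr [g [cg ag]]; exists g; split=> [x|x y /hh/ag].
  by apply: sub_conn (cg x) => ? ? _ _; apply: rr.
by case=> z [w [? ? /rr]]; exists z, w.
Qed.

Lemma inj_rminor (T T' : finType) (h : rel T) (r : rel T') (f : T -> T') :
  injective f -> (forall x y, h x y -> r (f x) (f y)) -> rminor h r.
Proof.
move=> inj_f hr; exists (fun z => [pick x | f x == z]).
have pickf x : [pick y | f y == f x] = Some x.
  by case: pickP => [y /eqP/inj_f->|/(_ x)/eqP].
split=> [x|x y /hr rxy]; last by exists (f x), (f y); rewrite !pickf.
suff -> : [set z | [pick y | f y == z] == Some x] = [set f x] by apply: conn1.
apply/setP=> z; rewrite !inE; apply/eqP/eqP=> [|->//].
by case: pickP => // y /eqP<- [->].
Qed.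

Lemma rminor_refl (T : finType) (r : rel T) : rminor r r.
Proof. by apply: (@inj_rminor _ _ _ _ id). Qed.

(** The bag of [u] is the pair [u], [v]; all other bags are singletons. *)
Lemma contract_rminor (G : sgraph) (u v : G) :
  adj u v -> rminor (@adj (contract u v)) (@adj G).
Proof.
move=> auv; have nuv : u != v by apply: contraTneq auv => ->; rewrite adj_irrefl.
pose f z : {x : G | x != v} := insubd (Sub u nuv) z.
have fK x : f (val x) = x by rewrite /f valKd.
have fv : f v = Sub u nuv by rewrite /f /insubd insubF // eqxx.
have val_f z : val (f z) = if z == v then u else z.
  by rewrite /f val_insubd; case: eqVneq.
exists (fun z => Some (f z)); split=> [x|x y].
  apply/connP=> A a b; rewrite !inE => /eqP[fa] /eqP[fb] Aa Ab.
  have nab : a != b by apply: contraTneq Aa => ->.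
  move: (congr1 val fa) (congr1 val fb); rewrite !val_f.
  case: eqP => [Da|_]; case: eqP => [Db|_] Ex Ey.
  - by rewrite Da Db eqxx in nab.
  - by exists a, b; rewrite !inE fa fb eqxx; split=> //; rewrite Da Ey -Ex adj_sym.
  - by exists a, b; rewrite !inE fa fb eqxx; split=> //; rewrite Db Ex -Ey.
  - by rewrite Ex Ey eqxx in nab.
case/andP=> _ /or3P[axy|/andP[/eqP Dx avy]|/andP[/eqP Dy avx]].
- by exists (val x), (val y); rewrite !fK.
- exists v, (val y); rewrite fv !fK; split=> //; congr Some.
  by apply: val_inj; rewrite Dx.
- exists (val x), v; rewrite fv !fK adj_sym; split=> //; congr Some.
  by apply: val_inj; rewrite Dy.
Qed.

Lemma minor_rminor (H G : sgraph) : minor H G -> rminor (@adj H) (@adj G).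
Proof.
elim=> {G} [G [f bij_f fE]|G v _|G u v _ _|G u v auv _].
- by apply: inj_rminor (bij_inj bij_f) _ => x y; rewrite fE.
- move/rminor_trans; apply; apply: (@inj_rminor _ _ _ _ val) => //.
  exact: val_inj.
- by apply: sub_rminor => // x y /andP[].
- by move/rminor_trans; apply; apply: contract_rminor.
Qed.

Lemma rminor_minor (H G : sgraph) :
  (forall x : H, exists y, adj x y) ->
  rminor (@adj H) (@adj G) -> minor H G.
Proof.
move=> noiso; have [n] := ubnP #|G|; elim: n G => // n IHn G.
have [m] := ubnP #|[set p : G * G | adj p.1 p.2]|.
elim: m G => // m IHm G leGm; rewrite ltnS => leGn [g [cg ag]].
have card_sub v : (#|{: {x : G | x != v}}| < n)%N.
  rewrite card_sig; apply: leq_trans leGn.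
  have -> : #|[pred x | x != v]| = #|predC1 v| by apply: eq_card.
  by rewrite cardC1 prednK //; apply/card_gt0P; exists v.
case: (pickP (fun v => g v == None)) => [v /eqP gv|gT].
  apply: (@minor_del_vertex _ _ v); apply: IHn; first exact: card_sub.
  have val_sub z : g z != None -> {y : {x : G | x != v} | val y = z}.
    move=> gz; have nz : z != v by apply: contraNneq gz => ->; rewrite gv.
    by exists (Sub z nz).
  exists (fun z => g (val z)); split=> [x|x y /ag[z [w [gz gw azw]]]].
    apply/connP=> A a b; rewrite !inE => ga gb Aa Ab.
    have /connP/(_ (val @: A) (val a) (val b)) := cg x.
    rewrite !inE ga gb mem_imset; last exact: val_inj.
    rewrite mem_imset; last exact: val_inj.
    case=> // a' [b' []]; rewrite !inE => ga' gb' /imsetP[a'' Aa'' Da'] Ab' ab'.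
    have [|b'' Db'] := val_sub b'; first by rewrite (eqP gb').
    exists a'', b''; rewrite !inE -Da' Db' ga' gb'; split=> //.
      by apply: contra Ab' => Ab''; rewrite -Db' imset_f.
    by rewrite /adj /= /del_vertex_adj -Da' Db'.
  have [|z' Dz] := val_sub z; first by rewrite gz.
  have [|w' Dw] := val_sub w; first by rewrite gw.
  by exists z', w'; rewrite Dz Dw; split=> //; rewrite /adj /= /del_vertex_adj Dz Dw.
case: (pickP (fun p : G * G => (p.1 != p.2) && (g p.1 == g p.2))) => [[u v]|inj_g].
  rewrite /= => /andP[nuv /eqP guv].
  case Du: (g u) guv => [x|] guv; last by have:= gT u; rewrite Du.
  (* The vertices [u] and [v] of one bag need not be adjacent; the cut [[set u]] of the bag provides
     a neighbour [w] of [u] in it, and [uw] is contracted. *)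
  have /connP/(_ [set u] u v) := cg x; rewrite !inE Du -guv !eqxx [v == u]eq_sym nuv.
  case=> // a [w [_]]; rewrite inE => /eqP Dw /set1P Da nwu; rewrite {a}Da => auw.
  have {}nwu : w != u by apply: contra nwu => /eqP->; apply: set11.
  apply: (@minor_contract _ _ u w) => //; apply: IHn; first exact: card_sub.
  have nuw : u != w by rewrite eq_sym.
  pose f z : {x : G | x != w} := insubd (Sub u nuw) z.
  have val_f z : val (f z) = if z == w then u else z.
    by rewrite /f val_insubd; case: eqVneq.
  have fK z : f (val z) = z by rewrite /f valKd.
  have gf z : g (val (f z)) = g z.
    by rewrite val_f; case: eqP => // ->; rewrite Du Dw.
  have adj_f a b : f a != f b -> adj a b -> contract_adj u (f a) (f b).
    move=> nab ab; rewrite /contract_adj nab !val_f.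
    case: (eqVneq a w) ab => [->|na]; case: (eqVneq b w) => [->|nb] ab.
    - by rewrite adj_irrefl in ab.
    - by rewrite eqxx ab orbT.
    - by rewrite eqxx [adj w a]adj_sym ab !orbT.
    - by rewrite ab.
  exists (fun z => g (val z)); split=> [y|y z hyz].
    apply/connP=> A a b; rewrite !inE => ga gb Aa Ab.
    have /connP/(_ [set z | f z \in A] (val a) (val b)) := cg y.
    rewrite !inE !fK ga gb Aa Ab; case=> // a' [b' []]; rewrite !inE => ga' gb' Aa' Ab' ab'.
    exists (f a'), (f b'); rewrite !inE !gf ga' gb'; split=> //.
    by apply: adj_f => //; apply: contraTneq Aa' => ->.
  have [a [b [ga gb ab]]] := ag y z hyz.
  exists (f a), (f b); rewrite !gf; split=> //; apply: adj_f => //.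
  apply: contraTneq hyz => fab; move: (gf a); rewrite fab gf ga gb => -[->].
  by rewrite adj_irrefl.
have {}inj_g : injective g.
  move=> u v guv; apply/eqP; apply: contraFT (inj_g (u, v)) => /= ->.
  by rewrite guv eqxx.
have /fin_all_exists[f gf] (x : H) : exists z, g z = Some x.
  by have [y /ag[z [_ [gz _ _]]]] := noiso x; exists z.
have inj_f : injective f by move=> x y fxy; have := gf x; rewrite fxy gf => -[].
have surj_f z : exists x, f x = z.
  case Dz: (g z) => [x|]; last by have := gT z; rewrite Dz.
  by exists x; apply: inj_g; rewrite gf Dz.
have adj_f x y : adj x y -> adj (f x) (f y).
  by case/ag=> z [w [gz gw]]; rewrite -gf in gz; rewrite -gf in gw; rewrite (inj_g _ _ gz) (inj_g _ _ gw).
case: (pickP (fun p : H * H => adj (f p.1) (f p.2) && ~~ adj p.1 p.2)) => [[x y]|adjE].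
  rewrite /= => /andP[fxy nxy]; apply: (@minor_del_edge _ _ (f x) (f y)) => //.
  have sub_adj : subrel (del_edge_adj (f x) (f y)) (@adj G) by move=> ? ? /andP[].
  apply: IHm => //.
    rewrite ltnS in leGm; apply: leq_trans leGm; apply: proper_card; apply/properP.
    split; first by apply/subsetP=> p; rewrite !inE => /sub_adj.
    by exists (f x, f y); rewrite !inE //= /adj /= /del_edge_adj eqxx andbF.
  apply: (@inj_rminor _ _ _ _ f) => // a b hab.
  rewrite /adj /= /del_edge_adj adj_f //=; apply: contra nxy => /eqP.
  move=> /setP E; have := E (f a); have := E (f b).
  rewrite !inE !eqxx orbT /= !(inj_eq inj_f) => /esym/orP[]/eqP Db /esym/orP[]/eqP Da.
  - by move: hab; rewrite Da Db adj_irrefl.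
  - by rewrite -Da -Db adj_sym.
  - by rewrite -Da -Db.
  - by move: hab; rewrite Da Db adj_irrefl.
have [f' f'K] := fin_all_exists surj_f.
apply: minor_iso; exists f.
  by exists f' => // x; apply: inj_f.
move=> x y; apply/idP/idP=> [fxy|]; last exact: adj_f.
by have:= adjE (x, y); rewrite /= fxy => /negbFE.
Qed.

(** * The two forbidden graphs *)

Lemma set2_eq (T : finType) (x y u v : T) :
  ([set x; y] == [set u; v]) = ((x == u) && (y == v) || (x == v) && (y == u)).
Proof.
apply/eqP/idP=> [/setP E|/orP[]/andP[/eqP-> /eqP->] //]; last by rewrite setUC.
move: (E x) (E y) (E u) (E v); rewrite !inE !eqxx ?orbT /=.
rewrite [u == x]eq_sym [u == y]eq_sym [v == x]eq_sym [v == y]eq_sym.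
by case: (x == u) (x == v) (y == u) (y == v) => [] [] [] [].
Qed.

(** The deleted edge joins 0 and 4, so 1, 2, 3 are the vertices adjacent to all others. *)
Lemma K5_adjE (x y : K5_minus) :
  adj x y = (x != y) && ((0 < x < 4) || (0 < y < 4))%N.
Proof.
rewrite /adj /= /del_edge_adj /adj /= /complete_adj set2_eq -!val_eqE /=.
by have := ltn_ord x; have := ltn_ord y; lia.
Qed.

(** The deleted edge joins the two vertices of index 0. *)
Lemma K33_adjE (x y : K33_minus) :
  adj x y = (x.1 != y.1) && ((0 < x.2) || (0 < y.2))%N.
Proof.
rewrite /adj /= /del_edge_adj /adj /= /bicomplete_adj set2_eq.
by case: x y => [[] [[|x] ?]] [[] [[|y] ?]].
Qed.

(** The graph induced off [Z] is connected, in the form in which this is applied: [P x] will say on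
    which side of a separation the branch set of [x] lies. *)
Definition conn_off (H : sgraph) (Z : pred H) : Prop :=
  forall P : pred H,
    (forall x y, ~~ Z x -> ~~ Z y -> adj x y -> P x = P y) ->
    forall x y, ~~ Z x -> ~~ Z y -> P x = P y.

(* Deleting two vertices disconnects K33_minus only if they are the two
   neighbours of a vertex of degree 2, and does not disconnect K5_minus. *)
Definition nearly_3connected (H : sgraph) : Prop :=
  (forall x : H, exists y, adj x y) /\
  forall s t : option H,
    conn_off (fun x => (Some x == s) || (Some x == t)) \/
    exists s' t' c,
      [/\ s = Some s', t = Some t', s' != t', ~~ adj s' t' &
       [/\ c \notin [:: s'; t'], forall x, adj c x -> x \in [:: s'; t'] &
           conn_off (fun x => x \in [:: s'; t'; c])]].

Lemma K5_nearly_3connected : nearly_3connected K5_minus.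
Proof.
pose i1 : 'I_5 := Ordinal (isT : 1 < 5)%N.
pose i2 : 'I_5 := Ordinal (isT : 2 < 5)%N.
pose i3 : 'I_5 := Ordinal (isT : 3 < 5)%N.
split=> [x|s t].
  case: (eqVneq x i1) => [->|nx]; first by exists i2; rewrite K5_adjE.
  by exists i1; rewrite K5_adjE nx orbT.
left; set Z := (fun x => _).
(* Two deleted vertices cannot cover 1, 2, 3, and a survivor [i] is adjacent to all other
   vertices. *)
have [i Zi /andP[i0 i4]] : exists2 i : K5_minus, ~~ Z i & (0 < i < 4)%N.
  have dist (i j : 'I_5) : i != j -> ~~ ((Some i == s) && (Some j == s)).
    by apply: contra => /andP[/eqP<- /eqP[->]].
  have dist' (i j : 'I_5) : i != j -> ~~ ((Some i == t) && (Some j == t)).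
    by apply: contra => /andP[/eqP<- /eqP[->]].
  have := dist i1 i2 isT; have := dist i1 i3 isT; have := dist i2 i3 isT.
  have := dist' i1 i2 isT; have := dist' i1 i3 isT; have := dist' i2 i3 isT.
  case Z1: (Z i1); last by exists i1; rewrite ?Z1.
  case Z2: (Z i2); last by exists i2; rewrite ?Z2.
  case Z3: (Z i3); last by exists i3; rewrite ?Z3.
  move: Z1 Z2 Z3; rewrite /Z.
  by do 3!case: (Some _ == s); do 3!case: (Some _ == t).
move=> P PE.
suff Pi x : ~~ Z x -> P x = P i by move=> x y /Pi-> /Pi->.
move=> Zx; have [->//|nxi] := eqVneq x i.
by apply: PE => //; rewrite K5_adjE nxi i0 i4 orbT.
Qed.

Lemma K33_nearly_3connected : nearly_3connected K33_minus.
Proof.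
pose nd (b : bool) (i : nat) : K33_minus := (b, inord i : 'I_3).
have adj_core b i (x : K33_minus) : (0 < i < 3)%N -> x.1 != b -> adj x (nd b i).
  by case/andP=> i0 i3 nx; rewrite K33_adjE /= nx inordK // i0 orbT.
split=> [[b i]|s t]; first by exists (nd (~~ b) 1); apply: adj_core => //; case: b.
set Z := (fun x => _).
case: (boolP [forall b, exists i : 'I_3, (0 < i)%N && ~~ Z (b, i)]) => [/forallP core|].
  left=> P PE.
  have [i1 /andP[i1_gt Zi1]] := existsP (core true).
  have [i0 /andP[i0_gt Zi0]] := existsP (core false).
  have P01 : P (true, i1) = P (false, i0).
    by apply: PE => //; rewrite K33_adjE /= i1_gt.
  suff Pi x : ~~ Z x -> P x = P (true, i1) by move=> x y /Pi-> /Pi->.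
  case: x => [[] i] Zx.
    by rewrite P01; apply: PE => //; rewrite K33_adjE /= i0_gt orbT.
  by apply: PE => //; rewrite K33_adjE /= i1_gt orbT.
(* Otherwise the deleted vertices are those of index 1 and 2 on the side [b], and they are the only
   neighbours of the vertex of index 0 on the other side. *)
rewrite negb_forall => /existsP[b]; rewrite negb_exists => /forallP noB.
have Z1 : Z (nd b 1) by have := noB (inord 1); rewrite inordK //= negbK.
have Z2 : Z (nd b 2) by have := noB (inord 2); rewrite inordK //= negbK.
have n12 : nd b 1 != nd b 2 by rewrite xpair_eqE eqxx -val_eqE /= !inordK.
have main s1 t1 : (s1 = nd b 1 /\ t1 = nd b 2) \/ (s1 = nd b 2 /\ t1 = nd b 1) ->
    [/\ s1 != t1, ~~ adj s1 t1, nd (~~ b) 0 \notin [:: s1; t1],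
        forall x, adj (nd (~~ b) 0) x -> x \in [:: s1; t1] &
        conn_off (fun x => x \in [:: s1; t1; nd (~~ b) 0])].
  move=> D; have mem x : (x \in [:: s1; t1]) = (x \in [:: nd b 1; nd b 2]).
    by case: D => -[-> ->]; rewrite !inE // orbC.
  have memc x : (x \in [:: s1; t1; nd (~~ b) 0]) = (x \in [:: nd b 1; nd b 2; nd (~~ b) 0]).
    by case: D => -[-> ->]; rewrite !inE // orbCA.
  split.
  - by case: D => -[-> ->]; rewrite // eq_sym.
  - by case: D => -[-> ->]; rewrite K33_adjE eqxx.
  - by rewrite mem !inE !xpair_eqE; case: (b).
  - case=> b' i; rewrite mem K33_adjE !inE !xpair_eqE -!val_eqE /= !inordK //=.
    by have:= ltn_ord i; case: b' (b) => [] [] //=; lia.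
  move=> P PE; suff P0 x : x \notin [:: s1; t1; nd (~~ b) 0] -> P x = P (nd b 0).
    by move=> x y /P0-> /P0->.
  rewrite memc => Nx; have [->//|nx0] := eqVneq x (nd b 0).
  apply: PE; rewrite ?memc //; first by rewrite !inE !xpair_eqE -!val_eqE /= !inordK //=; case: (b).
  move: Nx nx0; case: x => b' i; rewrite K33_adjE !inE !xpair_eqE -!val_eqE /= !inordK //=.
  by have:= ltn_ord i; case: b' (b) => [] [] //=; lia.
right.
case/orP: Z1 => /eqP Z1; case/orP: Z2 => /eqP Z2.
- by move: n12; rewrite -(inj_eq (@Some_inj _)) Z1 Z2 eqxx.
- have [|? ? ? ? ?] := main (nd b 1) (nd b 2); first by left.
  by exists (nd b 1), (nd b 2), (nd (~~ b) 0).
- have [|? ? ? ? ?] := main (nd b 2) (nd b 1); first by right.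
  by exists (nd b 2), (nd b 1), (nd (~~ b) 0).
- by move: n12; rewrite -(inj_eq (@Some_inj _)) Z1 Z2 eqxx.
Qed.

(** * 2-separations *)

Definition restrict (T : finType) (r : rel T) (S : {set T}) : rel T :=
  fun x y => [&& x \in S, y \in S & r x y].

Section Separations.
Variables (H : sgraph) (T : finType).
Hypothesis H3 : nearly_3connected H.
Implicit Types (r : rel T) (g : T -> option H) (A V X S : {set T}).

Let bag g x := [set z | g z == Some x].

Lemma bag_nonempty r g :
  (forall x y, adj x y -> exists z w, [/\ g z = Some x, g w = Some y & r z w]) ->
  forall x, exists z, g z = Some x.
Proof. by move=> ag x; have [y /ag[z [w []]]] := H3.1 x; exists z. Qed.

(** Every bag is cut down to [S]. Only the bag of [v] may stick out, and the parts of it outside [S]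
    hang on [v], so what remains is connected. No edge between two bags is lost outside [S], because
    all vertices in bags there belong to that one bag. *)
Lemma restrict_rminor r (v : option T) S g :
  symmetric r -> (forall u, v = Some u -> u \in S) ->
  (forall x y, x \in S -> y \notin S -> r x y -> Some x = v) ->
  (forall x, connected_on r (bag g x)) ->
  (forall x y, adj x y -> exists z w, [/\ g z = Some x, g w = Some y & r z w]) ->
  (forall x, Some x != obind g v -> bag g x \subset S) ->
  rminor (@adj H) (restrict r S).
Proof.
move=> r_sym vS bdS cg ag allS.
have bagN z x : g z = Some x -> z \notin S -> Some x = obind g v.
  move=> gz Sz; apply/eqP; apply: contraNT Sz => /allS/subsetP; apply.
  by rewrite inE gz.
have cross x y z w : adj x y -> g z = Some x -> g w = Some y -> r z w ->
    z \in S -> w \notin S -> False.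
  move=> xy gz gw rzw Sz Sw; have Dz := bdS _ _ Sz Sw rzw.
  have := bagN w y gw Sw; rewrite -Dz /= gz => -[Dy].
  by rewrite Dy adj_irrefl in xy.
exists (fun z => if z \in S then g z else None); split=> [x|x y xy]; last first.
  have [z [w [gz gw rzw]]] := ag x y xy; exists z, w; rewrite /restrict.
  case: (boolP (z \in S)) => Sz; case: (boolP (w \in S)) => Sw //=.
  - by case: (cross x y z w).
  - by case: (cross y x w z); rewrite // 1?(@adj_sym H) 1?r_sym.
  have := bagN _ _ gz Sz; rewrite -(bagN _ _ gw Sw) => -[Dx].
  by rewrite Dx adj_irrefl in xy.
have -> : [set z | (if z \in S then g z else None) == Some x] = bag g x :\: (bag g x :\: S).
  by apply/setP=> z; rewrite !inE; case: (z \in S); case: (g z == Some x).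
rewrite (@eq_conn _ _ r); last first.
  by move=> y z; rewrite !inE /restrict; case: (y \in S); case: (z \in S); case: (g y == _); case: (g z == _).
have [Dx|nxs] := eqVneq (Some x) (obind g v); last first.
  have -> : bag g x :\: S = set0 by apply/eqP; rewrite setD_eq0 allS.
  by rewrite setD0.
case: v => [a|//] in vS bdS Dx bagN allS *; have Sa := vS a erefl.
apply: (@conn_setD_component _ r r_sym _ _ a); rewrite ?cg ?subsetDl ?inE ?Sa //.
  by rewrite Dx /=.
move=> y z; rewrite !inE => /andP[Sy gy] /andP[nza gz] ryz; rewrite gz andbT.
apply: contra nza => Sz; rewrite r_sym in ryz.
by have [->] := bdS z y Sz Sy ryz.
Qed.

(** Once the bag of [v] is set aside, no bag straddles [X] and its complement, and since [H] minus
    one vertex is connected all these bags lie on the same side. The case [v = None] is that of no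
    edge between [X] and the rest. *)
Lemma cutvertex_rminor r (v : option T) X :
  symmetric r -> (forall u, v = Some u -> u \notin X) ->
  (forall x y, x \in X -> y \notin X -> r x y -> Some y = v) ->
  rminor (@adj H) r ->
  rminor (@adj H) (restrict r [set x | (x \in X) || (Some x == v)]) \/
  rminor (@adj H) (restrict r (~: X)).
Proof.
move=> r_sym vX clX [g [cg ag]]; pose s := obind g v.
pose P x := bag g x \subset X.
have side x : Some x != s -> P x \/ bag g x \subset ~: X.
  move=> nxs; have [z gz] := bag_nonempty ag x.
  have vx u : u \in bag g x -> Some u != v.
    by rewrite inE => /eqP gu; apply: contraNneq nxs => Dv; rewrite /s -Dv /= gu.
  have cross u w : u \in bag g x -> w \in bag g x -> u \in X -> w \notin X -> False.
    move=> Bu Bw Xu Xw; have /connP/(_ X u w Bu Bw Xu Xw)[u' [w' [_ Bw' Xu' Xw' ruw]]] := cg x.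
    by have /eqP := clX _ _ Xu' Xw' ruw; apply/negP/vx.
  have Bz : z \in bag g x by rewrite inE gz.
  have [Xz|Xz] := boolP (z \in X); [left | right]; apply/subsetP=> w Bw.
    by apply: contraT => /(cross z w Bz Bw Xz).
  by rewrite inE; apply/negP=> Xw; apply: (cross w z).
have sideN x : Some x != s -> ~~ P x -> bag g x \subset ~: X.
  by move=> /side[->|].
have PE x y : ~~ ((Some x == s) || (Some x == s)) -> ~~ ((Some y == s) || (Some y == s)) -> P x = P y.
  (* With equal deleted vertices only the connected alternative of [nearly_3connected] remains. *)
  case: (H3.2 s s) => [|[s' [t' [c [-> [->]]]]]]; last by rewrite eqxx.
  move=> cH; apply: cH => {}x {}y; rewrite !orbb => nx ny xy.
  have [z [w [gz gw rzw]]] := ag x y xy.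
  have Bz : z \in bag g x by rewrite inE gz.
  have Bw : w \in bag g y by rewrite inE gw.
  have vN u t : g u = Some t -> Some t != s -> Some u != v.
    by move=> gu; apply: contra => /eqP Dv; rewrite /s -Dv /= gu.
  apply/idP/idP=> Pxy; apply/negPn/negP=> nP.
    have := subsetP (sideN _ ny nP) _ Bw; rewrite inE => Xw.
    have /eqP := clX z w (subsetP Pxy _ Bz) Xw rzw.
    by apply/negP/(vN _ _ gw).
  have := subsetP (sideN _ nx nP) _ Bz; rewrite inE => Xz.
  rewrite r_sym in rzw; have /eqP := clX w z (subsetP Pxy _ Bw) Xz rzw.
  by apply/negP/(vN _ _ gz).
case: (pickP (fun x => (Some x != s) && ~~ P x)) => [y /andP[ny Py]|allP].
  right; apply: (restrict_rminor (v := v)) cg ag _ => //.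
  - by move=> u Du; rewrite inE vX.
  - by move=> x z; rewrite !inE negbK => Xx Xz rxz; rewrite (clX z x) // r_sym.
  by move=> x nx; apply: sideN => //; rewrite (PE x y) // orbb.
left; apply: (restrict_rminor (v := v)) cg ag _ => //.
- by move=> u ->; rewrite inE eqxx orbT.
- move=> x y; rewrite !inE negb_or => /orP[Xx|/eqP//] /andP[Xy /eqP nyv] rxy.
  by case: nyv; apply: clX Xx Xy rxy.
move=> x nx; apply/subsetP=> z Bz; rewrite inE; have := allP x; rewrite /= nx.
by move/negbFE/subsetP->.
Qed.

Section TwoSeparation.
Variables (a b k : T) (V : {set T}) (r r' : rel T).
Hypotheses (r_sym : symmetric r) (r'_sym : symmetric r').
Hypotheses (kV : k \notin V) (ka : k != a) (kb : k != b).
Hypothesis clV : forall x y, x \in V -> r x y -> (y \in V) || (y \in [:: a; b]).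
Hypothesis r'V : forall x y, x \in V -> r x y -> r' x y.
Hypotheses (r'a : r' k a) (r'b : r' k b).

(** Inside the bag, [V] can be left only through [a], since [b] is not in the bag. *)
Lemma conn_side1 (B : {set T}) :
  connected_on r B -> a \in B -> b \notin B ->
  connected_on r' (B :&: (V :|: [set a])).
Proof.
move=> /connP cB Ba Bb; apply: (@conn_root _ _ r'_sym _ a); first by rewrite !inE Ba eqxx orbT.
move=> A x; rewrite !inE => /andP[Bx Vx] Ax Aa.
have {}Vx : x \in V by case/orP: Vx => // /eqP Dx; rewrite -Dx Ax in Aa.
have := cB (A :&: V) x a Bx Ba; rewrite !inE Ax Vx (negbTE Aa).
case=> // u [w [Bu Bw]]; rewrite !inE => /andP[Au Vu] nw ruw.
exists u, w; rewrite !inE Bu Vu Bw Au /= r'V //.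
have := clV Vu ruw; rewrite !inE; case: (w =P b) => [Dw|_]; first by rewrite -Dw Bw in Bb.
rewrite orbF; case/orP=> [Vw|/eqP Dw]; last by rewrite Dw eqxx orbT.
by rewrite Vw andbT in nw *.
Qed.

(** If the bag contains both [a] and [b], it may have been connected only through the far side; [k]
    replaces that connection. *)
Lemma conn_side2 (B : {set T}) :
  connected_on r B -> a \in B ->
  connected_on r' (k |: (B :&: (V :|: [set a; b]))).
Proof.
move=> /connP cB Ba; apply: (@conn_root _ _ r'_sym _ k); first by rewrite !inE eqxx.
move=> A x Sx Ax Ak.
have [Aa|Aa] := boolP (a \in A).
  by exists a, k; rewrite !inE !eqxx Ba r'_sym r'a !orbT.
case: (boolP ((b \in A) && (b \in B))) => [/andP[Ab Bb]|nAb].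
  by exists b, k; rewrite !inE !eqxx Bb r'_sym r'b !orbT.
move: Sx; rewrite !inE; case/orP=> [/eqP Dx|/andP[Bx Vx]]; first by rewrite -Dx Ax in Ak.
have {}Vx : x \in V.
  case/or3P: Vx => // /eqP Dx; first by rewrite -Dx Ax in Aa.
  by rewrite -Dx Ax Bx in nAb.
have := cB (A :&: V) x a Bx Ba; rewrite !inE Ax Vx (negbTE Aa).
case=> // u [w [Bu Bw]]; rewrite !inE => /andP[Au Vu] nw ruw.
have := clV Vu ruw; rewrite !inE => Dw.
exists u, w; rewrite !inE Bu Vu Bw Au /= r'V // Dw !orbT; split=> //.
case/or3P: Dw => [Vw|/eqP->//|/eqP Dw]; first by rewrite Vw andbT in nw.
by rewrite -Dw Bw andbT in nAb.
Qed.
End TwoSeparation.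

Section Sides.
Variables (a b k : T) (V : {set T}) (r r' : rel T) (g : T -> option H).
Hypotheses (r_sym : symmetric r) (r'_sym : symmetric r').
Hypotheses (kV : k \notin V) (ka : k != a) (kb : k != b).
Hypothesis clV : forall x y, x \in V -> r x y -> (y \in V) || (y \in [:: a; b]).
Hypothesis r'V : forall x y, x \in V -> r x y -> r' x y.
Hypotheses (r'a : r' k a) (r'b : r' k b).
Hypothesis cg : forall x, connected_on r (bag g x).
Hypothesis ag :
  forall x y, adj x y -> exists z w, [/\ g z = Some x, g w = Some y & r z w].

Let clV' x y : x \in V -> r x y -> (y \in V) || (y \in [:: b; a]).
Proof. by move=> Vx /(clV Vx); rewrite !inE => /or3P[] ->; rewrite ?orbT. Qed.

Let conn_bag x : bag g x \subset V -> connected_on r' (bag g x).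
Proof.
move=> BV; apply: sub_conn (cg x) => y z By _; apply: r'V.
exact: (subsetP BV).
Qed.

(** The far side carries no bag of its own, so it matters only for connecting the bag of [a] and for
    joining it to the bag of [b]. Giving [k] to the bag of [a] serves both purposes. *)
Lemma side_rminor :
  (forall x, Some x != g a -> Some x != g b -> bag g x \subset V) ->
  rminor (@adj H) r'.
Proof.
move=> allV; pose S := V :|: [set a; b].
have kS : k \notin S by rewrite !inE (negbTE kV) (negbTE ka) (negbTE kb).
have g'E z : z \in S -> (if z \in S then g z else if z == k then g a else None) = g z.
  by move->.
exists (fun z => if z \in S then g z else if z == k then g a else None).
split=> [x|x y xy]; last first.
  have [z [w [gz gw rzw]]] := ag xy.
  have [Vz|Vz] := boolP (z \in V).
    exists z, w; rewrite !g'E ?r'V // !inE ?Vz //.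
    by have := clV Vz rzw; rewrite !inE.
  have [Vw|Vw] := boolP (w \in V).
    rewrite r_sym in rzw; exists z, w; rewrite !g'E; first by rewrite r'_sym r'V.
      by rewrite !inE Vw.
    by have := clV Vw rzw; rewrite !inE.
  have Nab u t : g u = Some t -> u \notin V -> (Some t == g a) || (Some t == g b).
    move=> gu; apply: contraR; rewrite negb_or => /andP[na nb].
    by apply: (subsetP (allV _ na nb)); rewrite inE gu.
  have nxy : x != y by apply: contraTneq xy => ->; rewrite adj_irrefl.
  have bS : b \in S by rewrite !inE eqxx !orbT.
  have gk : (if k \in S then g k else if k == k then g a else None) = g a.
    by rewrite (negbTE kS) eqxx.
  case/orP: (Nab _ _ gz Vz) => /eqP Dx; case/orP: (Nab _ _ gw Vw) => /eqP Dy.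
  - by rewrite -Dx in Dy; case: Dy nxy => ->; rewrite eqxx.
  - by exists k, b; rewrite gk g'E.
  - by exists b, k; rewrite gk g'E // r'_sym.
  - by rewrite -Dx in Dy; case: Dy nxy => ->; rewrite eqxx.
have [Dx|nxa] := eqVneq (Some x) (g a).
  have -> : [set z | (if z \in S then g z else if z == k then g a else None) == Some x] = k |: (bag g x :&: S).
    apply/setP=> z; rewrite [in LHS]inE [in RHS]in_setU1 in_setI [z \in bag _ _]inE.
    have [Sz|Sz] := boolP (z \in S); first by rewrite andbT; case: (z =P k) => // Dz; rewrite -Dz Sz in kS.
    by rewrite andbF orbF; case: (z == k); rewrite -?Dx ?eqxx.
  by apply: (conn_side2 (V := V) r'_sym clV); rewrite ?inE -?Dx.
have -> : [set z | (if z \in S then g z else if z == k then g a else None) == Some x] = bag g x :&: S.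
  apply/setP=> z; rewrite [in LHS]inE in_setI [z \in bag _ _]inE.
  have [Sz|Sz] := boolP (z \in S); first by rewrite andbT.
  by rewrite andbF; case: (z == k); rewrite // eq_sym; apply/negbTE.
have [Dx|nxb] := eqVneq (Some x) (g b).
  have -> : bag g x :&: S = bag g x :&: (V :|: [set b]).
    apply/setP=> z; rewrite !inE; case: (z =P a) => [->|_//].
    by rewrite eq_sym (negbTE nxa).
  by apply: (conn_side1 r'_sym clV'); rewrite ?inE ?Dx // eq_sym -Dx.
have BV := allV x nxa nxb.
by rewrite (setIidPl _) ?conn_bag // (subset_trans BV) // subsetUl.
Qed.

(** The exceptional 2-separation of [H]: the bag of the vertex [c] of degree at most 2 lies off [V],
    and the single vertex [k], adjacent to [a] and [b], takes its place. *)
Lemma side_rminor_degree2 (s t c : H) :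
  g a = Some s -> g b = Some t -> s != t -> ~~ adj s t -> c \notin [:: s; t] ->
  (forall x, adj c x -> x \in [:: s; t]) -> [disjoint bag g c & V] ->
  (forall x, x \notin [:: s; t; c] -> bag g x \subset V) ->
  rminor (@adj H) r'.
Proof.
move=> ga gb nst Nst; rewrite !inE negb_or => /andP[ncs nct] Nc cV allV.
pose S := V :|: [set a; b].
have kS : k \notin S by rewrite !inE (negbTE kV) (negbTE ka) (negbTE kb).
pose g' z := if z \in S then g z else if z == k then Some c else None.
have g'E z : z \in S -> g' z = g z by rewrite /g' => ->.
have gk : g' k = Some c by rewrite /g' (negbTE kS) eqxx.
have aS : a \in S by rewrite !inE eqxx orbT.
have bS : b \in S by rewrite !inE eqxx !orbT.
have cS z : z \in S -> g z != Some c.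
  rewrite !inE => /or3P[Vz|/eqP->|/eqP->]; rewrite ?ga ?gb.
  - by apply: contraL Vz => gz; rewrite (disjointFr cV) // inE.
  - by apply: contraNneq ncs => -[->].
  - by apply: contraNneq nct => -[->].
exists g'; split=> [x|x y xy]; last first.
  have [Dx|nxc] := eqVneq x c.
    exists k; rewrite gk Dx; rewrite Dx in xy.
    have := Nc _ xy; rewrite !inE => /orP[]/eqP->.
      by exists a; rewrite g'E.
    by exists b; rewrite g'E.
  have [Dy|nyc] := eqVneq y c.
    rewrite Dy adj_sym in xy; have := Nc _ xy; rewrite !inE => /orP[]/eqP->.
      by exists a, k; rewrite g'E // gk Dy r'_sym.
    by exists b, k; rewrite g'E // gk Dy r'_sym.
  have [z [w [gz gw rzw]]] := ag xy; exists z, w.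
  have [Vz|Vz] := boolP (z \in V).
    rewrite !g'E ?r'V // !inE ?Vz //.
    by have := clV Vz rzw; rewrite !inE.
  have [Vw|Vw] := boolP (w \in V).
    rewrite r_sym in rzw; rewrite !g'E; first by rewrite r'_sym r'V.
      by rewrite !inE Vw.
    by have := clV Vw rzw; rewrite !inE.
  have Nab u h : g u = Some h -> u \notin V -> h != c -> (h == s) || (h == t).
    move=> gu Vu nhc; apply: contraR Vu => nst'; apply: (subsetP (allV h _)).
      by rewrite !inE orbA negb_or nst'.
    by rewrite inE gu.
  have nxy : x != y by apply: contraTneq xy => ->; rewrite adj_irrefl.
  case/orP: (Nab _ _ gz Vz nxc) => /eqP Dx; case/orP: (Nab _ _ gw Vw nyc) => /eqP Dy.
  - by rewrite Dx Dy eqxx in nxy.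
  - by rewrite Dx Dy (negbTE Nst) in xy.
  - by rewrite Dx Dy adj_sym (negbTE Nst) in xy.
  - by rewrite Dx Dy eqxx in nxy.
have [->|nxc] := eqVneq x c.
  have -> : [set z | g' z == Some c] = [set k]; last exact: conn1.
  apply/setP=> z; rewrite !inE /g'; case: (boolP (z \in S)) => [Sz|Sz].
    by rewrite (negbTE (cS z Sz)); apply/esym/negbTE; apply: contraTneq Sz => ->.
  by case: (z == k); rewrite ?eqxx.
have -> : [set z | g' z == Some x] = bag g x :&: S.
  apply/setP=> z; rewrite [in LHS]inE in_setI [z \in bag _ _]inE /g'.
  have [Sz|Sz] := boolP (z \in S); first by rewrite andbT.
  by rewrite andbF; case: (z == k) => //; apply/eqP=> -[Dx]; rewrite Dx eqxx in nxc.
have [Dx|nxs] := eqVneq x s.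
  have -> : bag g x :&: S = bag g x :&: (V :|: [set a]).
    apply/setP=> z; rewrite !inE; case: (z =P b) => [->|_]; last by rewrite orbF.
    by rewrite gb Dx (inj_eq Some_inj) eq_sym (negbTE nst).
  apply: (conn_side1 r'_sym clV); rewrite ?inE ?Dx ?ga ?gb //.
  by rewrite (inj_eq Some_inj) eq_sym.
have [Dx|nxt] := eqVneq x t.
  have -> : bag g x :&: S = bag g x :&: (V :|: [set b]).
    apply/setP=> z; rewrite !inE; case: (z =P a) => [->|_//].
    by rewrite ga Dx (inj_eq Some_inj) (negbTE nst).
  by apply: (conn_side1 r'_sym clV'); rewrite ?inE ?Dx ?ga ?gb.
have BV : bag g x \subset V by apply: allV; rewrite !inE (negbTE nxs) (negbTE nxt).
by rewrite (setIidPl _) ?conn_bag // (subset_trans BV) // subsetUl.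
Qed.
End Sides.

Lemma two_separation_rminor (a b k : T) (V1 V2 : {set T}) (r r1 r2 : rel T) :
  symmetric r -> symmetric r1 -> symmetric r2 ->
  [disjoint V1 & V2] ->
  {in [:: a; b; k], forall x, x \notin V1 :|: V2} -> k \notin [:: a; b] ->
  (forall x y, r x y -> x \in V1 :|: V2 :|: [set a; b]) ->
  (forall x y, x \in V1 -> r x y -> y \in V1 :|: [set a; b] /\ r1 x y) ->
  (forall x y, x \in V2 -> r x y -> y \in V2 :|: [set a; b] /\ r2 x y) ->
  r1 k a -> r1 k b -> r2 k a -> r2 k b ->
  rminor (@adj H) r -> rminor (@adj H) r1 \/ rminor (@adj H) r2.
Proof.
move=> r_sym r1_sym r2_sym V12 abkV kab supp cl1 cl2 r1a r1b r2a r2b [g [cg ag]].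
have [[aV1 aV2] [bV1 bV2] [kV1 kV2]] : [/\ a \notin V1 /\ a \notin V2,
    b \notin V1 /\ b \notin V2 & k \notin V1 /\ k \notin V2].
  have := abkV a; have := abkV b; have := abkV k; rewrite !inE !eqxx !orbT /= !negb_or.
  by move=> /(_ isT)/andP[-> ->] /(_ isT)/andP[-> ->] /(_ isT)/andP[-> ->].
have {kab} [ka kb] : k != a /\ k != b by apply/andP; rewrite -negb_or; rewrite !inE in kab.
have cl1' x y : x \in V1 -> r x y -> (y \in V1) || (y \in [:: a; b]).
  by move=> Vx /(cl1 _ _ Vx)[]; rewrite !inE.
have cl2' x y : x \in V2 -> r x y -> (y \in V2) || (y \in [:: a; b]).
  by move=> Vx /(cl2 _ _ Vx)[]; rewrite !inE.
have r1V x y : x \in V1 -> r x y -> r1 x y by move=> Vx /(cl1 _ _ Vx)[].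
have r2V x y : x \in V2 -> r x y -> r2 x y by move=> Vx /(cl2 _ _ Vx)[].
have nab x z : Some x != g a -> Some x != g b -> g z = Some x -> (z != a) && (z != b).
  move=> na nb gz; apply/andP; split; first by apply: contraNneq na => <-; rewrite gz.
  by apply: contraNneq nb => <-; rewrite gz.
have side x : Some x != g a -> Some x != g b -> bag g x \subset V1 \/ bag g x \subset V2.
  move=> na nb; have [y xy] := H3.1 x; have [z [w [gz gw rzw]]] := ag x y xy.
  have /connP cx := cg x; have Bz : z \in bag g x by rewrite inE gz.
  have cross A u v : (forall x y, x \in A -> r x y -> (y \in A) || (y \in [:: a; b])) ->
      u \in bag g x -> v \in bag g x -> u \in A -> v \notin A -> False.
    move=> clA Bu Bv Au Av; have [u' [v' [_ Bv' Au' Av' ruv]]] := cx A u v Bu Bv Au Av.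
    have := clA _ _ Au' ruv; rewrite (negbTE Av') !inE /= => Dv'.
    rewrite inE in Bv'; have := nab x v' na nb (eqP Bv').
    by case/orP: Dv' => ->; rewrite ?andbF.
  have := supp _ _ rzw; rewrite !inE -orbA; have /andP[/negbTE-> /negbTE->] := nab x z na nb gz.
  rewrite !orbF => /orP[Vz|Vz]; [left | right]; apply/subsetP=> u Bu; apply: contraT => Vu.
    by case: (cross V1 z u).
  by case: (cross V2 z u).
(* [P] is constant along the edges of [H] that avoid the bags of [a] and [b], which is what
   [conn_off] asks for. *)
pose P x := bag g x \subset V1.
have sideN x : Some x != g a -> Some x != g b -> ~~ P x -> bag g x \subset V2.
  by move=> na nb; case: (side x na nb) => // BV; rewrite /P BV.
have PE x y : Some x != g a -> Some x != g b -> Some y != g a -> Some y != g b ->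
    adj x y -> P x = P y.
  move=> xa xb ya yb xy; have [z [w [gz gw rzw]]] := ag x y xy.
  have /andP[za zb] := nab x z xa xb gz; have /andP[wa wb] := nab y w ya yb gw.
  apply/idP/idP=> Pxy; apply/negPn/negP=> nP.
    have Vw : w \in V2 by apply: (subsetP (sideN y ya yb nP)); rewrite inE gw.
    have Vz : z \in V1 by apply: (subsetP Pxy); rewrite inE gz.
    have := cl1' z w Vz rzw; rewrite !inE (negbTE wa) (negbTE wb) !orbF => Vw'.
    by have := disjointFr V12 Vw'; rewrite Vw.
  have Vz : z \in V2 by apply: (subsetP (sideN x xa xb nP)); rewrite inE gz.
  have Vw : w \in V1 by apply: (subsetP Pxy); rewrite inE gw.
  rewrite r_sym in rzw.
  have := cl1' w z Vw rzw; rewrite !inE (negbTE za) (negbTE zb) !orbF => Vz'.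
  by have := disjointFr V12 Vz'; rewrite Vz.
have all1 : (forall x, Some x != g a -> Some x != g b -> P x) -> rminor (@adj H) r1.
  by move=> allV; apply: (@side_rminor a b k V1 r r1 g).
have all2 : (forall x, Some x != g a -> Some x != g b -> ~~ P x) -> rminor (@adj H) r2.
  move=> allV; apply: (@side_rminor a b k V2 r r2 g) => // x na nb.
  by apply: sideN => //; apply: allV.
have [cH|[s [t [c [ga gb nst Nst [cst Nc cH]]]]]] := H3.2 (g a) (g b).
  have {cH} PC x y : Some x != g a -> Some x != g b -> Some y != g a -> Some y != g b -> P x = P y.
    move=> xa xb ya yb; apply: cH; rewrite ?negb_or ?xa ?ya // => {xa xb ya yb}x {}y.
    by rewrite !negb_or => /andP[? ?] /andP[? ?]; apply: PE.
  case: (pickP (fun x => [&& Some x != g a, Some x != g b & P x])) => [x /and3P[xa xb Px]|nP].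
    by left; apply: all1 => y ya yb; rewrite (PC y x).
  by right; apply: all2 => x xa xb; have := nP x; rewrite /= xa xb /= => ->.
have Sne x : x \notin [:: s; t] -> Some x != g a /\ Some x != g b.
  by rewrite !inE negb_or ga gb !(inj_eq Some_inj) => /andP[].
have SneR x : Some x != g a -> Some x != g b -> x \notin [:: s; t].
  by rewrite !inE negb_or ga gb !(inj_eq Some_inj) => -> ->.
have Snec x : x \notin [:: s; t; c] -> x \notin [:: s; t].
  by rewrite !inE !negb_or => /and3P[-> ->].
have PC x y : x \notin [:: s; t; c] -> y \notin [:: s; t; c] -> P x = P y.
  move=> Nx Ny; apply: cH => // {Nx Ny}x {}y /Snec/Sne[? ?] /Snec/Sne[? ?].
  exact: PE.
have [ca cb] := Sne c cst.
have Ncs x : Some x != g a -> Some x != g b -> x != c -> x \notin [:: s; t; c].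
  move=> xa xb xc; have := SneR x xa xb.
  by rewrite !inE !negb_or xc andbT.
(* All bags other than those of [s], [t], [c] lie on one side. If the bag of [c] lies there too, the
   ordinary case applies; if it lies on the other side, [k] stands for it. *)
case: (pickP (fun x => (x \notin [:: s; t; c]) && P x)) => [x /andP[Nx Px]|nP].
  have allP y : y \notin [:: s; t; c] -> P y by move=> Ny; rewrite (PC y x).
  have [Pc|nPc] := boolP (P c).
    left; apply: all1 => y ya yb; have [->//|yc] := eqVneq y c.
    exact/allP/Ncs.
  left; apply: (side_rminor_degree2 r_sym r1_sym kV1 ka kb cl1' r1V r1a r1b cg ag ga gb nst Nst cst Nc) => //.
  rewrite disjoint_sym; apply: (disjointWr (sideN c ca cb nPc)).
  by [].
have allP y : y \notin [:: s; t; c] -> ~~ P y.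
  by move=> Ny; have := nP y; rewrite Ny /= => ->.
have [Pc|nPc] := boolP (P c).
  right; apply: (side_rminor_degree2 r_sym r2_sym kV2 ka kb cl2' r2V r2a r2b cg ag ga gb nst Nst cst Nc) => //.
    exact: disjointWl Pc V12.
  by move=> x Nx; have [? ?] := Sne x (Snec x Nx); apply: sideN => //; apply: allP.
right; apply: all2 => y ya yb; have [->//|yc] := eqVneq y c.
exact/allP/Ncs.
Qed.

End Separations.

Lemma disconnected_component (T : finType) (r : rel T) (S : {set T}) :
  symmetric r -> ~~ connected_on r S ->
  exists K : {set T}, [/\ K != set0, K \proper S, connected_on r K &
    forall y z, y \in K -> z \in S -> r y z -> z \in K].
Proof.
move=> r_sym nS; have [S0|[x Sx]] := set_0Vmem S; first by rewrite S0 conn0 in nS.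
have [K [Kx KS cK clK]] := component r_sym Sx; exists K; split=> //.
  by apply/set0Pn; exists x.
by rewrite properEneq KS andbT; apply: contraNneq nS => <-.
Qed.

(** * From a graph to one of its blocks *)

Section Blocks.
Variables (H G : sgraph).
Hypothesis H3 : nearly_3connected H.
Hypothesis H_gt2 : (2 < #|H|)%N.

Lemma restrict_rminor_card (T : finType) (r : rel T) (S : {set T}) :
  rminor (@adj H) (restrict r S) -> (#|H| <= #|S|)%N.
Proof.
move=> [g [_ ag]].
have /fin_all_exists[f fE] (x : H) : exists z, (g z == Some x) && (z \in S).
  have [y /ag[z [w [gz _ /and3P[Sz _ _]]]]] := H3.1 x.
  by exists z; rewrite gz eqxx.
have inj_f : injective f.
  move=> x y fxy; have /andP[/eqP gx _] := fE x; have /andP[/eqP gy _] := fE y.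
  by apply: Some_inj; rewrite -gx -gy fxy.
rewrite -cardsT -(card_imset _ inj_f); apply/subset_leq_card/subsetP=> _ /imsetP[x _ ->].
by have /andP[] := fE x.
Qed.

Lemma rminor_nonseparable (S : {set G}) :
  rminor (@adj H) (restrict (@adj G) S) ->
  exists2 S' : {set G}, nonseparable S' & rminor (@adj H) (restrict (@adj G) S').
Proof.
have [n] := ubnP #|S|; elim: n S => // n IHn S leSn HS.
(* [None] tests whether [S] itself is disconnected, [Some u] whether [u] is a cutvertex; in both
   cases the minor moves to a proper subset of [S]. *)
case: (pickP (fun v : option G => (if v is Some u then u \in S else true) &&
    ~~ connected_on (@adj G) [set x in S | Some x != v])) => [v|conS]; last first.
  exists S => //; apply/and3P; split.
  - by rewrite -card_gt0; have := restrict_rminor_card HS; lia.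
  - have := conS None; rewrite /= => /negbFE; congr connected_on.
    by apply/setP=> x; rewrite !inE andbT.
  - apply/forall_inP=> v Sv; have := conS (Some v); rewrite /= Sv => /negbFE.
    by congr connected_on; apply/setP=> x; rewrite !inE andbC.
move=> /andP[Sv /(disconnected_component (@adj_sym G))].
set W := [set x in S | _] => -[K [K0 /properP[/subsetP KW [w Ww Kw]] _ clK]].
have Sw : w \in S by move: Ww; rewrite inE => /andP[].
have KS x : x \in K -> x \in S by move/KW; rewrite inE => /andP[].
have vK u : v = Some u -> u \notin K.
  by move=> Dv; apply/negP=> /KW; rewrite inE Dv eqxx andbF.
have r_sym : symmetric (restrict (@adj G) S).
  by move=> x y; rewrite /restrict adj_sym andbCA.
have clKv x y : x \in K -> y \notin K -> restrict (@adj G) S x y -> Some y = v.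
  move=> Kx Ky /and3P[_ Sy xy]; apply/eqP; apply: contraR Ky => nyv.
  by apply: clK xy => //; rewrite inE Sy.
have [HX|HX] := cutvertex_rminor H3 r_sym vK clKv HS.
  apply: (IHn [set x | (x \in K) || (Some x == v)]); last first.
    apply: sub_rminor HX => // x y /and3P[Sx Sy /and3P[_ _ xy]].
    by rewrite /restrict Sx Sy.
  rewrite ltnS in leSn; apply: leq_trans leSn; apply/proper_card/properP; split.
    apply/subsetP=> x; rewrite inE => /orP[/KS//|/eqP Dv].
    by rewrite -Dv in Sv.
  exists w; rewrite // inE (negbTE Kw) /=.
  by move: Ww; rewrite inE => /andP[].
apply: (IHn (S :\: K)); last first.
  apply: sub_rminor HX => // x y /and3P[Sx Sy /and3P[Sx' Sy' xy]].
  by rewrite !inE in Sx Sy; rewrite /restrict !inE Sx Sy Sx' Sy'.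
rewrite ltnS in leSn; apply: leq_trans leSn; apply/proper_card/properP; split.
  exact: subsetDl.
by have [x Kx] := set0Pn _ K0; exists x; rewrite ?KS // inE Kx.
Qed.

Lemma rminor_block :
  rminor (@adj H) (@adj G) ->
  exists S : {set G}, [/\ block S, (2 < #|S|)%N & rminor (@adj H) (restrict (@adj G) S)].
Proof.
move=> HG; have [|S nsS HS] := @rminor_nonseparable setT.
  by apply: sub_rminor HG => // x y; rewrite /restrict !inE.
have [B maxB SB] := maxset_exists nsS; exists B.
have HB : rminor (@adj H) (restrict (@adj G) B).
  by apply: sub_rminor HS => // x y /and3P[/(subsetP SB) Bx /(subsetP SB) By xy]; apply/and3P.
by split=> //; apply: leq_trans H_gt2 (restrict_rminor_card HB).
Qed.

End Blocks.

(** * The sides of a 2-separation: nonseparability, and why they are minors *)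

Section TwoSum.
Variables (T : finType) (a b k : T) (V1 V2 : {set T}) (r r1 : rel T).
Hypotheses (r_sym : symmetric r) (r1_sym : symmetric r1).
Hypothesis V12 : [disjoint V1 & V2].
Hypothesis nab : a != b.
Hypothesis abkV : {in [:: a; b; k], forall x, x \notin V1 :|: V2}.
Hypothesis kab : k \notin [:: a; b].
Hypothesis cl1 : forall x y, x \in V1 -> r x y -> y \in V1 :|: [set a; b] /\ r1 x y.
Hypothesis cl2 : forall x y, x \in V2 -> r x y -> y \in V2 :|: [set a; b].
Hypotheses (r1a : r1 k a) (r1b : r1 k b).
Hypothesis V1_neq0 : V1 != set0.
Hypothesis V2_neq0 : V2 != set0.
Let S := V1 :|: V2 :|: [set a; b].
Hypothesis nsS : forall v, connected_on r (S :\ v).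

Let aV1 : a \notin V1.
Proof. by have := @abkV a; rewrite !inE eqxx negb_or => /(_ isT)/andP[]. Qed.
Let bV1 : b \notin V1.
Proof. by have := @abkV b; rewrite !inE eqxx !orbT negb_or => /(_ isT)/andP[]. Qed.
Let aV2 : a \notin V2.
Proof. by have := @abkV a; rewrite !inE eqxx negb_or => /(_ isT)/andP[]. Qed.
Let bV2 : b \notin V2.
Proof. by have := @abkV b; rewrite !inE eqxx !orbT negb_or => /(_ isT)/andP[]. Qed.
Let kV1 : k \notin V1.
Proof. by have := @abkV k; rewrite !inE eqxx !orbT negb_or => /(_ isT)/andP[]. Qed.
Let ka : k != a. Proof. by move: kab; rewrite !inE negb_or => /andP[]. Qed.
Let kb : k != b. Proof. by move: kab; rewrite !inE negb_or => /andP[]. Qed.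

(** A cut inside [V1], read in the whole graph minus [v]: the crossing edge starts in [V1], so [r1]
    has it as well. *)
Let cut1 (A : {set T}) v x y : x \in V1 -> x \in A -> x != v -> y \notin A :&: V1 ->
  y \in S -> y != v ->
  exists u w, [/\ u \in V1, u \in A, w \notin A :&: V1, u != v & w != v] /\
    [/\ (w \in V1) || (w \in [:: a; b]), r u w & r1 u w].
Proof.
move=> Vx Ax xv Ay Sy yv; have /connP/(_ (A :&: V1) x y) := nsS v.
rewrite in_setD1 xv in_setD1 yv Sy in_setI Vx Ax in_setU in_setU Vx => -[] // u [w].
rewrite in_setD1 in_setD1 => -[] /andP[uv _] /andP[wv _].
rewrite in_setI => /andP[Au Vu] Aw ruw.
have [Sw r1uw] := cl1 Vu ruw; exists u, w; split; split=> //.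
by move: Sw; rewrite !inE.
Qed.

(** When [v] is not [k], every part is still tied to [k] through whichever of [a] and [b] is left,
    because the whole graph minus [v] is connected. When [k] itself is deleted the root is [a]: the
    whole graph minus [b] ties [V1] to [a], and minus [a] it ties [b] to [V1]. *)
Lemma nonseparable_side v : connected_on r1 ((V1 :|: [set a; b; k]) :\ v).
Proof.
have [->|nkv] := eqVneq v k; last first.
  apply: (@conn_root _ _ r1_sym _ k); first by rewrite !inE eq_sym nkv eqxx !orbT.
  move=> A x; rewrite in_setD1 => /andP[xv Sx] Ax Ak.
  have edge c : c \in [:: a; b] -> c \in A -> c != v -> r1 k c ->
      exists u w, [/\ u \in (V1 :|: [set a; b; k]) :\ v,
        w \in (V1 :|: [set a; b; k]) :\ v, u \in A, w \notin A & r1 u w].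
    move=> abc Ac cv kc; exists c, k; rewrite !inE cv [k == v]eq_sym nkv eqxx !orbT r1_sym.
    by move: abc; rewrite !inE => ->; rewrite orbT.
  case: (boolP ((a \in A) && (a != v))) => [/andP[Aa av]|na].
    by apply: (edge a); rewrite ?inE ?eqxx.
  case: (boolP ((b \in A) && (b != v))) => [/andP[Ab bv]|nb].
    by apply: (edge b); rewrite ?inE ?eqxx ?orbT.
  have Vx : x \in V1.
    move: Sx; rewrite !inE -!orbA => /or4P[//|/eqP D|/eqP D|/eqP D].
    - by rewrite -D Ax xv in na.
    - by rewrite -D Ax xv in nb.
    - by rewrite -D Ax in Ak.
  have [y [Sy yv yA]] : exists y, [/\ y \in S, y != v & y \notin A :&: V1].
    have [av|av] := eqVneq a v.
      by exists b; rewrite !inE eqxx (negbTE bV1) andbF !orbT -av eq_sym.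
    by exists a; rewrite !inE eqxx (negbTE aV1) andbF !orbT.
  have [u [w [[Vu Au Aw uv wv] [Vw _ r1uw]]]] := cut1 Vx Ax xv yA Sy yv.
  exists u, w; rewrite !inE Vu uv wv Au r1uw /=; split=> //.
    by move: Vw; rewrite !inE => /or3P[]->; rewrite ?orbT.
  move: Vw; rewrite !inE => /or3P[Vw|/eqP Dw|/eqP Dw].
  - by rewrite inE Vw andbT in Aw.
  - by rewrite Dw; rewrite -Dw wv andbT in na; rewrite -Dw.
  - by rewrite Dw; rewrite -Dw wv andbT in nb; rewrite -Dw.
apply: (@conn_root _ _ r1_sym _ a); first by rewrite !inE [a == k]eq_sym ka eqxx orbT.
move=> A x; rewrite in_setD1 => /andP[xk Sx] Ax Aa.
case: (pickP (fun x => (x \in V1) && (x \in A))) => [y /andP[Vy Ay]|noA].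
  have [||||u [w [[Vu Au Aw uv wv] [Vw _ r1uw]]]] := cut1 (v := b) (y := a) Vy Ay => //.
  - by apply: contraTneq Vy => ->.
  - by rewrite inE (negbTE Aa).
  - by rewrite !inE eqxx !orbT.
  have nkw : w != k by apply: contraTneq Vw => ->; rewrite (negbTE kab) (negbTE kV1).
  exists u, w; rewrite !inE Vu Au r1uw nkw /=; split=> //.
  - by rewrite andbT; apply: contraTneq Vu => ->.
  - by move: Vw; rewrite !inE => /or3P[]->; rewrite ?orbT.
  move: Vw; rewrite !inE => /or3P[Vw|/eqP-> //|/eqP Dw]; last by rewrite Dw eqxx in wv.
  by rewrite inE Vw andbT in Aw.
have Ab : b \in A.
  move: Sx; rewrite !inE (negbTE xk) orbF => /or3P[Vx|/eqP D|/eqP<- //].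
    by have := noA x; rewrite Vx Ax.
  by rewrite -D Ax in Aa.
have [z Vz] := set0Pn _ V1_neq0.
have [|||||u [w [[Vu _ Aw uv wv] [Vw _ r1uw]]]] := @cut1 setT a z b Vz => //.
- by apply: contraTneq Vz => ->.
- by rewrite inE in_setT.
- by rewrite !inE eqxx !orbT.
- by rewrite eq_sym.
have Dw : w = b.
  move: Vw; rewrite !inE => /or3P[Vw|/eqP Dw|/eqP-> //].
    by rewrite !inE Vw in Aw.
  by rewrite Dw eqxx in wv.
exists b, u; rewrite !inE Ab -Dw eqxx Vu r1_sym r1uw Dw [b == k]eq_sym kb !orbT /=.
split=> //; last by have := noA u; rewrite Vu /= => ->.
by rewrite andbT; apply: contraTneq Vu => ->.
Qed.

(** A component [X] of the far side has neighbours at both [a] and [b], since otherwise a single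
    vertex would separate it; contracting [X] to [k] yields [r1]. *)
Lemma side_minor :
  (forall x y, r1 x y ->
     [|| [&& x \in V1 :|: [set a; b], y \in V1 :|: [set a; b] & r x y],
         (x == k) && (y \in [:: a; b]) | (y == k) && (x \in [:: a; b])]) ->
  rminor r1 r.
Proof.
move=> r1E; have [z Vz] := set0Pn _ V2_neq0.
have [X [Xz /subsetP XV cX clX]] := component r_sym Vz.
have Xc c c' : c \in [:: a; b] -> c' \in [:: a; b] -> c != c' -> exists2 u, u \in X & r u c.
  move=> abc abc' ncc'; have cVc : c \notin V2 by move: abc; rewrite !inE => /orP[]/eqP->.
  have cVc' : c' \notin V2 by move: abc'; rewrite !inE => /orP[]/eqP->.
  have /connP/(_ X z c) := nsS c'; rewrite !in_setD1 ncc'.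
  have -> : z != c' by apply: contraTneq Vz => ->.
  have -> : z \in S by rewrite !inE Vz orbT.
  have -> : c \in S by move: abc; rewrite !inE => ->; rewrite orbT.
  case=> //; first by apply: contra cVc => /XV.
  move=> u [w []]; rewrite in_setD1 => /andP[_ _]; rewrite in_setD1 => /andP[wc' _] Xu Xw ruw.
  exists u => //; have := cl2 (XV u Xu) ruw; rewrite in_setU => /orP[Vw|].
    by rewrite (clX u w) in Xw.
  rewrite !inE in abc abc' *; move=> abw; suff <- : w = c by [].
  case/orP: abw wc' => /eqP->; case/orP: abc ncc' => /eqP->; case/orP: abc' => /eqP->;
    by rewrite ?eqxx.
have [ua Xua rua] : exists2 u, u \in X & r u a by apply: (Xc a b); rewrite ?inE ?eqxx ?orbT.
have [ub Xub rub] : exists2 u, u \in X & r u b by apply: (Xc b a); rewrite ?inE ?eqxx ?orbT // eq_sym.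
pose g x := if x \in V1 :|: [set a; b] then Some x else if x \in X then Some k else None.
have gV x : x \in V1 :|: [set a; b] -> g x = Some x by rewrite /g => ->.
have gX x : x \in X -> g x = Some k.
  move=> /[dup] Xx /XV Vx; rewrite /g ifN ?Xx // !inE !negb_or.
  rewrite (disjointFl V12 Vx); apply/and3P; split=> //.
    by apply: contraTneq Vx => ->.
  by apply: contraTneq Vx => ->.
have kS : k \notin V1 :|: [set a; b].
  by rewrite !inE (negbTE kV1) (negbTE ka) (negbTE kb).
have aS : a \in V1 :|: [set a; b] by rewrite !inE eqxx orbT.
have bS : b \in V1 :|: [set a; b] by rewrite !inE eqxx !orbT.
exists g; split=> [x|x y r1xy].
  have [->|nxk] := eqVneq x k.
    suff -> : [set w | g w == Some k] = X by [].
    apply/setP=> w; rewrite inE; apply/eqP/idP=> [|/gX//].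
    rewrite /g; case: ifP => [Sw [Dw]|_]; first by rewrite Dw (negbTE kS) in Sw.
    by case: ifP.
  have [Sx|Sx] := boolP (x \in V1 :|: [set a; b]).
    suff -> : [set w | g w == Some x] = [set x] by apply: conn1.
    apply/setP=> w; rewrite !inE; apply/eqP/eqP=> [|->]; last exact: gV.
    rewrite /g; case: ifP => [Sw [//]|_]; case: ifP => // _ [Dx].
    by rewrite Dx eqxx in nxk.
  suff -> : [set w | g w == Some x] = set0 by apply: conn0.
  apply/setP=> w; rewrite !inE; apply/negbTE; apply: contra Sx.
  rewrite /g; case: ifP => [Sw /eqP[<-]//|_]; case: ifP => // _ /eqP[Dx].
  by rewrite Dx eqxx in nxk.
case/or3P: (r1E _ _ r1xy) => [/and3P[Sx Sy rxy]|/andP[/eqP-> aby]|/andP[/eqP-> abx]].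
- by exists x, y; split=> //; apply: gV.
- move: aby; rewrite !inE => /orP[]/eqP->.
    by exists ua, a; split=> //; [apply: gX | apply: gV].
  by exists ub, b; split=> //; [apply: gX | apply: gV].
move: abx; rewrite !inE => /orP[]/eqP->.
  by exists a, ua; split; [apply: gV | apply: gX | rewrite r_sym].
by exists b, ub; split; [apply: gV | apply: gX | rewrite r_sym].
Qed.

End TwoSum.

(** * Pieces and splittings *)

Section Pieces.
Local Open Scope fset_scope.
Variable G : sgraph.
Implicit Types (P E : piece G) (e : tedge G) (A : {set G}) (x y a b : G).

Lemma piece_supportP P x :
  reflect (exists2 e, e \in P & x \in e.1) (x \in piece_support P).
Proof.
apply: (iffP bigcupP) => [[e _ xe]|[e Pe xe]]; first by exists (val e); rewrite ?fsvalP.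
by exists [` Pe].
Qed.

Lemma supportU P E : piece_support (P `|` E) = piece_support P :|: piece_support E.
Proof.
apply/setP=> x; rewrite inE; apply/piece_supportP/orP=> [[e]|].
  by rewrite inE => /orP[Pe|Ee] xe; [left | right]; apply/piece_supportP; exists e.
by case=> /piece_supportP[e Pe xe]; exists e; rewrite // inE Pe ?orbT.
Qed.

Lemma support1 e : piece_support [fset e] = e.1.
Proof.
apply/setP=> x; apply/piece_supportP/idP=> [[f]|xe]; first by rewrite inE => /eqP->.
by exists e; rewrite // inE.
Qed.

Lemma supportS P E : P `<=` E -> piece_support P \subset piece_support E.
Proof.
move/fsubsetP=> PE; apply/subsetP=> x /piece_supportP[e /PE Ee xe].
by apply/piece_supportP; exists e.
Qed.

(** Within a piece a label determines its ends. The bound [N] lets the labels serve as vertices of a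
    finite graph. *)
Definition wf_piece (N : nat) P : Prop :=
  [/\ forall e, e \in P -> #|e.1| = 2,
      forall A A' k, (A, Some k) \in P -> (A', Some k) \in P -> A = A' &
      forall A k, (A, Some k) \in P -> (k < N)%N].

(* The graph of P with each virtual edge k subdivided by a vertex inr k. *)
Definition hat (N : nat) P : rel (G + 'I_N)%type :=
  fun z w => match z, w with
  | inl x, inl y => ([set x; y], None) \in P
  | inl x, inr k => [exists A : {set G}, (x \in A) && ((A, Some (val k)) \in P)]
  | inr k, inl x => [exists A : {set G}, (x \in A) && ((A, Some (val k)) \in P)]
  | inr _, inr _ => false
  end.

(** [hat] lives on all of [G + 'I_N], where vertices and labels foreign to the piece are isolated;
    connectivity is asked on this set only. *)
Definition hat_support (N : nat) P : {set (G + 'I_N)%type} :=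
  [set z | match z with
           | inl x => x \in piece_support P
           | inr k => [exists A : {set G}, (A, Some (val k)) \in P]
           end].

(** Deleting a label vertex amounts to deleting a virtual edge, and a [v] outside the support gives
    connectivity itself. *)
Definition nonseparable_piece (N : nat) P : Prop :=
  forall v, connected_on (@hat N P) (hat_support N P :\ v).

Lemma hat_sym N P : symmetric (@hat N P).
Proof. by move=> [x|k] [y|l] //=; rewrite setUC. Qed.

Lemma hatU N P E z w : @hat N (P `|` E) z w = @hat N P z w || @hat N E z w.
Proof.
have labU (x : G) (k : 'I_N) :
    [exists A : {set G}, (x \in A) && ((A, Some (val k)) \in P `|` E)] =
    [exists A : {set G}, (x \in A) && ((A, Some (val k)) \in P)] ||
    [exists A : {set G}, (x \in A) && ((A, Some (val k)) \in E)].
  apply/existsP/orP=> [[A]|[]/existsP[A]]; rewrite ?inE.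
  - by case/andP=> xA /orP[] AP; [left | right]; apply/existsP; exists A; rewrite xA.
  - by case/andP=> xA PA; exists A; rewrite !inE xA PA.
  - by case/andP=> xA PA; exists A; rewrite !inE xA PA orbT.
by case: z w => [x|k] [y|l] //=; [rewrite inE | exact: labU | exact: labU].
Qed.

Lemma hat_supportU N P E : hat_support N (P `|` E) = hat_support N P :|: hat_support N E.
Proof.
apply/setP=> [[x|k]]; rewrite !inE ?supportU ?inE //.
apply/existsP/orP=> [[A]|[]/existsP[A PA]]; rewrite ?inE.
- by case/orP=> PA; [left | right]; apply/existsP; exists A.
- by exists A; rewrite inE PA.
- by exists A; rewrite inE PA orbT.
Qed.

Lemma hat_in_support N P z w : hat P z w -> z \in hat_support N P.
Proof.
case: z w => [x|k] [y|l] //=; rewrite inE.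
- by move=> Pxy; apply/piece_supportP; exists ([set x; y], None); rewrite //= !inE eqxx.
- by case/existsP=> A /andP[xA PA]; apply/piece_supportP; exists (A, Some (val l)).
- by case/existsP=> A /andP[_ PA]; apply/existsP; exists A.
Qed.

Definition split_piece P E1 E2 a b : Prop :=
  [/\ E1 `|` E2 = P, E1 `&` E2 = fset0, (1 < #|` E1|)%N & (1 < #|` E2|)%N] /\
  (a != b /\ piece_support E1 :&: piece_support E2 = [set a; b]).

Lemma split_pieceC P E1 E2 a b : split_piece P E1 E2 a b -> split_piece P E2 E1 a b.
Proof.
case=> -[PE E12 lt1 lt2] [nab supp]; split; split=> //.
- by rewrite fsetUC.
- by rewrite fsetIC.
- by rewrite setIC.
Qed.

Section Split.
Variables (N : nat) (P E1 E2 : piece G) (a b : G) (k : nat).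
Hypotheses (wfP : wf_piece N P) (splitP : split_piece P E1 E2 a b).
Hypotheses (ltkN : (k < N)%N) (freshk : forall e, e \in P -> e.2 != Some k).

Let e : tedge G := ([set a; b], Some k).
Let PE : E1 `|` E2 = P. Proof. by case: splitP => -[]. Qed.
Let E12 : E1 `&` E2 = fset0. Proof. by case: splitP => -[]. Qed.
Let nab : a != b. Proof. by case: splitP => _ []. Qed.
Let supp12 : piece_support E1 :&: piece_support E2 = [set a; b].
Proof. by case: splitP => _ []. Qed.
Let sub1 f : f \in E1 -> f \in P. Proof. by rewrite -PE inE => ->. Qed.
Let sub2 f : f \in E2 -> f \in P. Proof. by rewrite -PE inE orbC => ->. Qed.

Lemma wf_side : wf_piece N (e |` E1).
Proof.
have [card2 lab ltN] := wfP; split=> [f|A A' l|A l].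
- rewrite !inE => /orP[/eqP->|/sub1/card2 //]; by rewrite cards2 nab.
- rewrite !inE => /orP[/eqP[-> ->]|/sub1 PA] /orP[/eqP[-> //]|/sub1 PA'].
  + by have := freshk PA'; rewrite eqxx.
  + by move=> Dl; have := freshk PA; rewrite Dl eqxx.
  + exact: lab PA PA'.
- by rewrite !inE => /orP[/eqP[_ ->]|/sub1/ltN].
Qed.

Let A0 : (inl a : G + 'I_N) \in hat_support N E1 :&: hat_support N E2.
Proof. by rewrite !inE -in_setI supp12 !inE eqxx. Qed.
Let B0 : (inl b : G + 'I_N) \in hat_support N E1 :&: hat_support N E2.
Proof. by rewrite !inE -in_setI supp12 !inE eqxx orbT. Qed.

Definition side_interior E := hat_support N E :\: [set inl a; inl b].

Lemma hat_support_sides : hat_support N P =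
  side_interior E1 :|: side_interior E2 :|: [set inl a; inl b].
Proof.
rewrite -PE hat_supportU; apply/setP=> z; rewrite !(in_setU, in_setD, in_set1).
case: (z =P inl a) => [->|_]; first by move: A0; rewrite in_setI orbT => /andP[-> _].
case: (z =P inl b) => [->|_]; first by move: B0; rewrite in_setI orbT => /andP[-> _].
by rewrite /= orbF.
Qed.

(** The shared vertices are [a] and [b] by hypothesis; a shared label would be a shared edge,
    because in [P] a label determines its ends. *)
Lemma side_interior_disjoint : [disjoint side_interior E1 & side_interior E2]%B.
Proof.
apply/pred0P=> z /=; apply/negbTE; rewrite !in_setD.
case: (boolP (z \in [set _; _])) => //= Nz; apply/negP=> /andP[].
case: z Nz => [x|l]; rewrite !inE.
  move=> /= Nx E1x E2x; have: x \in [set a; b] by rewrite -supp12 inE E1x.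
  by rewrite !inE; apply/negP.
move=> _ /existsP[A E1A] /existsP[A' E2A'].
have [_ lab _] := wfP; have DA := lab _ _ _ (sub1 E1A) (sub2 E2A').
by have: (A, Some (val l)) \in E1 `&` E2; [rewrite inE E1A DA | rewrite E12].
Qed.

Lemma hat_side z w : z \in side_interior E1 -> @hat N P z w ->
  w \in side_interior E1 :|: [set inl a; inl b] /\ hat (e |` E1) z w.
Proof.
move=> Vz; rewrite -PE hatU => /orP[E1zw|E2zw].
  rewrite fsetUC hatU E1zw; split=> //.
  have : w \in hat_support N E1 by apply: (@hat_in_support _ _ w z); rewrite hat_sym.
  by rewrite in_setU in_setD => ->; rewrite andbT orbC orbN.
have Sz := hat_in_support E2zw; have /negP[] := disjointFr side_interior_disjoint Vz.
by move: Vz; rewrite !in_setD Sz andbT => /andP[].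
Qed.

Lemma hat_label x : @hat N (e |` E1) (inr (Ordinal ltkN)) (inl x) = (x \in [set a; b]).
Proof.
apply/existsP/idP=> [[A /andP[xA]]|xab]; last by exists [set a; b]; rewrite xab /= !inE eqxx.
by rewrite in_fsetU in_fset1 => /orP[/eqP[<-] //|/sub1/freshk]; rewrite eqxx.
Qed.

Lemma label_notin : {in [:: inl a; inl b; inr (Ordinal ltkN)], forall z,
  z \notin side_interior E1 :|: side_interior E2}.
Proof.
have labN E : (forall f, f \in E -> f \in P) -> inr (Ordinal ltkN) \notin hat_support N E.
  move=> EP; rewrite inE; apply/existsP=> -[A /EP/freshk]; by rewrite eqxx.
move=> z zabk; have: [|| z == inl a, z == inl b | z == inr (Ordinal ltkN)].
  by move: zabk; rewrite !inE.
case/or3P=> /eqP->.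
- by rewrite !(in_setU, in_setD, in_set1) eqxx.
- by rewrite !(in_setU, in_setD, in_set1) eqxx orbT.
by rewrite !(in_setU, in_setD) (negbTE (labN _ sub1)) (negbTE (labN _ sub2)) !andbF.
Qed.

(** A side has two edges, hence one that is not the real edge [ab]. It has an end outside [a] and
    [b], or it is a virtual edge, whose label is interior. *)
Lemma side_interior_neq0 : side_interior E1 != set0.
Proof.
clear freshk ltkN; have [card2 lab ltN] := wfP.
have [f E1f nfN] : exists2 f, f \in E1 & f != ([set a; b], None).
  have /fset0Pn[f] : E1 `\ ([set a; b], None) != fset0.
    rewrite -cardfs_gt0; case: splitP => -[_ _ lt1 _] _.
    by have := cardfsD1 ([set a; b], None) E1; case: (_ \in _); lia.
  by rewrite !inE => /andP[nf E1f]; exists f.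
case: (boolP (f.1 \subset [set a; b])) => [sub|]; last first.
  case/subsetPn=> x fx Nx; apply/set0Pn; exists (inl x); rewrite !inE /=.
  by move: Nx; rewrite !inE => -> /=; apply/piece_supportP; exists f.
have Df : f.1 = [set a; b].
  by apply/eqP; rewrite eqEcard sub (card2 _ (sub1 E1f)) cards2 nab.
case: f Df E1f nfN {sub} => _ [l|] /= -> E1f nfN; last by rewrite eqxx in nfN.
apply/set0Pn; exists (inr (Ordinal (ltN _ _ (sub1 E1f)))); rewrite !inE /=.
by apply/existsP; exists [set a; b].
Qed.

Lemma hat_sideE z w : @hat N (e |` E1) z w ->
  [|| [&& z \in side_interior E1 :|: [set inl a; inl b],
          w \in side_interior E1 :|: [set inl a; inl b] & hat P z w],
      (z == inr (Ordinal ltkN)) && (w \in [:: inl a; inl b]) |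
      (w == inr (Ordinal ltkN)) && (z \in [:: inl a; inl b])].
Proof.
have in1 u v : @hat N E1 u v -> u \in side_interior E1 :|: [set inl a; inl b].
  by move/hat_in_support; rewrite in_setU in_setD => ->; rewrite andbT orbC orbN.
have label_side u v : @hat N [fset e] u v ->
    (u == inr (Ordinal ltkN)) && (v \in [:: inl a; inl b]) ||
    (v == inr (Ordinal ltkN)) && (u \in [:: inl a; inl b]).
  have lab (x : G) (l : 'I_N) :
      [exists A : {set G}, (x \in A) && ((A, Some (val l)) \in [fset e])] ->
      (l == Ordinal ltkN) && (x \in [:: a; b]).
    case/existsP=> A /andP[xA]; rewrite in_fset1 => /eqP[DA Dl].
    by rewrite -val_eqE /= Dl eqxx; move: xA; rewrite DA !inE.
  case: u v => [x|l] [y|m] //=; first by rewrite in_fset1 => /eqP[].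
    by case/lab/andP=> /eqP-> ; rewrite eqxx !inE orbC.
  by case/lab/andP=> /eqP-> ; rewrite eqxx !inE => ->.
rewrite hatU => /orP[/label_side->|E1zw]; first by rewrite orbT.
rewrite (in1 z w E1zw) (in1 w z); last by rewrite hat_sym.
by rewrite -PE hatU E1zw.
Qed.

Lemma hat_support_side : hat_support N (e |` E1) =
  side_interior E1 :|: [set inl a; inl b; inr (Ordinal ltkN)].
Proof.
rewrite hat_supportU; apply/setP=> z; rewrite in_setU.
have -> : (z \in hat_support N [fset e]) = (z \in [set inl a; inl b; inr (Ordinal ltkN)]).
  case: z => [x|l]; rewrite !inE; first by rewrite support1 !inE orbF.
  apply/existsP/idP=> [[A]|].
    rewrite in_fset1 => /eqP[_ Dl]; apply/orP; right; apply/eqP; congr inr.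
    exact: val_inj.
  case/orP=> [/orP[]/eqP//|/eqP[->]].
  by exists [set a; b]; rewrite in_fset1.
rewrite !(in_setU, in_setD, in_set1).
case: (z =P inl a) => [->|_]; first by [].
case: (z =P inl b) => [->|_]; first by [].
by rewrite /= orbC.
Qed.

End Split.

Section SplitTheory.
Variables (N : nat) (P E1 E2 : piece G) (a b : G) (k : nat).
Hypotheses (wfP : wf_piece N P) (splitP : split_piece P E1 E2 a b).
Hypotheses (ltkN : (k < N)%N) (freshk : forall e, e \in P -> e.2 != Some k).
Let e : tedge G := ([set a; b], Some k).
Let splitPC := split_pieceC splitP.

Lemma rminor_split (H : sgraph) : nearly_3connected H ->
  rminor (@adj H) (@hat N P) ->
  rminor (@adj H) (@hat N (e |` E1)) \/ rminor (@adj H) (@hat N (e |` E2)).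
Proof.
move=> H3; apply: (two_separation_rminor H3 (a := inl a) (b := inl b)
  (k := inr (Ordinal ltkN)) (V1 := side_interior N a b E1) (V2 := side_interior N a b E2));
  try exact: hat_sym.
- exact: side_interior_disjoint wfP splitP.
- exact: label_notin splitP _ freshk.
- by [].
- by move=> x y /hat_in_support; rewrite (hat_support_sides _ splitP).
- by move=> x y; apply: (hat_side k wfP splitP).
- by move=> x y; apply: (hat_side k wfP splitPC).
- by rewrite (hat_label splitP) // !inE eqxx.
- by rewrite (hat_label splitP) // !inE eqxx orbT.
- by rewrite (hat_label splitPC) // !inE eqxx.
- by rewrite (hat_label splitPC) // !inE eqxx orbT.
Qed.

Hypothesis nsP : nonseparable_piece N P.

Let nsS v : connected_on (@hat N P)
  ((side_interior N a b E1 :|: side_interior N a b E2 :|: [set inl a; inl b]) :\ v).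
Proof. by rewrite -(hat_support_sides _ splitP); apply: nsP. Qed.

Lemma nonseparable_split : nonseparable_piece N (e |` E1).
Proof.
move=> v; rewrite hat_support_side.
apply: (nonseparable_side (r := @hat N P) (V2 := side_interior N a b E2)) => //;
  try exact: hat_sym.
- by case: splitP => _ [nab _]; apply: contra_neq nab => -[].
- exact: label_notin splitP _ freshk.
- by move=> x y; apply: (hat_side k wfP splitP).
- by rewrite (hat_label splitP) // !inE eqxx.
- by rewrite (hat_label splitP) // !inE eqxx orbT.
- exact: side_interior_neq0 wfP splitP.
Qed.

Lemma rminor_side : rminor (@hat N (e |` E1)) (@hat N P).
Proof.
apply: (side_minor (V1 := side_interior N a b E1) (V2 := side_interior N a b E2)
  (a := inl a) (b := inl b) (k := inr (Ordinal ltkN))) => //; try exact: hat_sym.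
- exact: side_interior_disjoint wfP splitP.
- by case: splitP => _ [nab _]; apply: contra_neq nab => -[].
- exact: label_notin splitP _ freshk.
- by move=> x y Vx /(hat_side k wfP splitPC Vx)[].
- exact: side_interior_neq0 wfP splitPC.
- by move=> x y; apply: (hat_sideE splitP).
Qed.
End SplitTheory.
End Pieces.

(** * The piece of a block *)

Section Splitting.
Local Open Scope fset_scope.
Variable G : sgraph.
Implicit Types (P Q B E : piece G) (D : {fset piece G}) (e : tedge G).
Implicit Types (A S : {set G}) (x y a b : G).

Lemma induced_pieceP S e :
  reflect (exists x y, [/\ x \in S, y \in S, adj x y & e = ([set x; y], None)])
          (e \in induced_piece S).
Proof.
apply: (iffP idP) => [/imfsetP[A /= SA ->]|[x [y [Sx Sy xy ->]]]].
  move: SA; rewrite inE => /andP[/imsetP[[x y]]]; rewrite inE /= => xy ->.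
  by rewrite subUset !sub1set => /andP[Sx Sy]; exists x, y.
apply/imfsetP; exists [set x; y] => //=; rewrite inE subUset !sub1set Sx Sy !andbT.
by apply/imsetP; exists (x, y); rewrite ?inE.
Qed.

(** The first two clauses are asked for every [N], as the bound is read off only from the final
    decomposition. The three edges start the count in [splitting_card]. *)
Definition base_piece B : Prop :=
  [/\ forall N, wf_piece N B, forall N, nonseparable_piece N B, (2 < #|` B|)%N &
      forall e, e \in B -> e.2 = None].

Lemma wf_induced N S : wf_piece N (induced_piece S).
Proof.
split=> [e|A A' k|A k] /induced_pieceP[x [y [_ _ xy De]]] //.
rewrite De cards2; case: eqP xy => // ->; by rewrite adj_irrefl.
Qed.

Lemma hat_inducedE N S x y : @hat G N (induced_piece S) (inl x) (inl y) =
  restrict (@adj G) S x y.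
Proof.
apply/induced_pieceP/and3P=> [[u [v [Su Sv uv [/eqP]]]]|[Sx Sy xy]]; last by exists x, y.
by rewrite set2_eq => /orP[]/andP[/eqP-> /eqP->]; rewrite // adj_sym.
Qed.

Lemma hat_induced_label N S (k : 'I_N) z : hat (induced_piece S) (inr k) z = false.
Proof.
case: z => //= x; apply/existsP=> -[A /andP[_]] /induced_pieceP.
by case=> u [v []].
Qed.

Lemma rminor_induced N S : rminor (@hat G N (induced_piece S)) (@adj G).
Proof.
exists (fun x => Some (inl x)); split=> [[x|k]|[x|k] [y|l]].
- suff -> : [set z | Some (inl z : G + 'I_N) == Some (inl x)] = [set x] by apply: conn1.
  by apply/setP=> z; rewrite !inE; apply/eqP/eqP=> [[]|->].
- suff -> : [set z | Some (inl z : G + 'I_N) == Some (inr k)] = set0 by apply: conn0.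
  by apply/setP=> z; rewrite !inE.
- by rewrite hat_inducedE => /and3P[_ _ xy]; exists x, y.
- by rewrite hat_sym hat_induced_label.
- by rewrite hat_induced_label.
- by [].
Qed.

Lemma rminor_to_induced (H : sgraph) N S : rminor (@adj H) (restrict (@adj G) S) ->
  rminor (@adj H) (@hat G N (induced_piece S)).
Proof.
move/rminor_trans; apply; apply: (@inj_rminor _ _ _ _ inl); first by move=> ? ? [].
by move=> x y; rewrite hat_inducedE.
Qed.

Lemma base_block S : block S -> (2 < #|S|)%N -> base_piece (induced_piece S).
Proof.
move=> /maxsetp/and3P[S0 /connP cS /forall_inP nsS] ltS.
have adjN x : x \in S -> exists y, [/\ y \in S, adj x y & x != y].
  move=> Sx; have [y Sy nyx] : exists2 y, y \in S & y != x.
    have : (0 < #|S :\ x|)%N by rewrite (cardsD1 x S) Sx in ltS; lia.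
    by case/card_gt0P=> y; rewrite !inE => /andP[]; exists y.
  have := cS [set x] x y Sx Sy; rewrite !inE eqxx => -[] // u [v [_ Sv /set1P->]].
  by rewrite inE => nvx xv; exists v; rewrite eq_sym.
have suppS : piece_support (induced_piece S) = S.
  apply/setP=> x; apply/idP/idP=> [/piece_supportP[e /induced_pieceP[u [v [Su Sv uv ->]]]]|Sx].
    by rewrite !inE => /orP[]/eqP->.
  have [y [Sy xy _]] := adjN x Sx; apply/piece_supportP; exists ([set x; y], None); last by rewrite !inE eqxx.
  by apply/induced_pieceP; exists x, y.
split; first by move=> N; apply: wf_induced.
- move=> N v.
  have cSv : connected_on (@adj G) [set x in S | inl x != v].
    case: v => [v|k]; last first.
      by have -> : [set x in S | inl x != inr k] = S; [apply/setP=> x; rewrite !inE andbT | apply/connP].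
    have [Sv|Sv] := boolP (v \in S).
      have := nsS v Sv; congr connected_on; apply/setP=> x; rewrite !inE andbC.
      by congr (_ && ~~ _); apply/eqP/eqP=> [->|[]].
    suff -> : [set x in S | inl x != inl v :> G + 'I_N] = S by apply/connP.
    apply/setP=> x; rewrite !inE; case Sx: (x \in S) => //=.
    by apply/eqP=> -[Dx]; rewrite -Dx Sx in Sv.
  apply/connP=> A [x|k] [y|l]; rewrite !inE ?suppS.
  + move=> /andP[xv Sx] /andP[yv Sy] Ax Ay.
    have /connP/(_ [set x | inl x \in A] x y) := cSv; rewrite !inE Sx Sy xv yv Ax Ay.
    case=> // u [w [+ + + +]]; rewrite !inE => /andP[Su uv] /andP[Sw wv] Au Aw uw.
    by exists (inl u), (inl w); rewrite !in_setD1 !inE uv wv suppS Su Sw hat_inducedE /restrict Su Sw.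
  + by move=> _ /andP[_ /existsP[A' /induced_pieceP[? [? []]]]].
  + by move=> /andP[_ /existsP[A' /induced_pieceP[? [? []]]]].
  + by move=> /andP[_ /existsP[A' /induced_pieceP[? [? []]]]].
(* The three edges are [xy], a second edge at [x] and a second edge at [y]. *)
- have [x Sx] := set0Pn _ S0; have [y [Sy xy nxy]] := adjN x Sx.
  have deg2 u v : u \in S -> v \in S -> u != v -> exists w, [/\ w \in S, w != v, w != u & adj u w].
    move=> Su Sv nuv; have [t St] : exists2 t, t \in S & t \notin [:: u; v].
      have : (0 < #|S :\ u :\ v|)%N.
        by rewrite (cardsD1 u S) Su (cardsD1 v (_ :\ _)) !inE eq_sym nuv Sv in ltS; lia.
      case/card_gt0P=> t; rewrite !inE => /and3P[tv tu St]; exists t => //.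
      by rewrite !inE negb_or tu.
    rewrite !inE negb_or => /andP[tu tv].
    have /connP/(_ [set u] u t) := nsS v Sv; rewrite !inE nuv Su tv St eqxx tu.
    case=> // u' [w [_ + /set1P->]]; rewrite !inE => /andP[wv Sw] wu uw.
    by exists w.
  have [z [Sz zy zx xz]] := deg2 x y Sx Sy nxy.
  have nyx : y != x by rewrite eq_sym.
  have [w [Sw wx wy yw]] := deg2 y x Sy Sx nyx.
  pose e1 : tedge G := ([set x; y], None); pose e2 : tedge G := ([set x; z], None).
  pose e3 : tedge G := ([set y; w], None).
  have sub : e1 |` (e2 |` [fset e3]) `<=` induced_piece S.
    apply/fsubsetP=> e; rewrite !in_fset1U in_fset1 => /or3P[]/eqP->; apply/induced_pieceP.
    - by exists x, y.
    - by exists x, z.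
    - by exists y, w.
  apply: leq_trans (fsubset_leq_card sub); rewrite !cardfsU1 cardfs1 !in_fset1U !in_fset1.
  rewrite /e1 /e2 /e3 !xpair_eqE !andbT !set2_eq eqxx.
  rewrite [y == z]eq_sym (negbTE zy) (negbTE nxy) /= [x == z]eq_sym (negbTE zx) /=.
  by rewrite [x == w]eq_sym (negbTE wx).
- by move=> e /induced_pieceP[? [? [_ _ _ ->]]].
Qed.
End Splitting.

(** * Invariants of a splitting *)

Section SplittingInvariants.
Local Open Scope fset_scope.
Variable G : sgraph.
Implicit Types (P Q B E : piece G) (D : {fset piece G}) (e : tedge G).
Implicit Types (A S : {set G}) (x y a b : G).

Definition labels_below N D : Prop :=
  forall P A k, P \in D -> (A, Some k) \in P -> (k < N)%N.

Definition good_piece N P : Prop :=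
  [/\ wf_piece N P, nonseparable_piece N P & (2 < #|` P|)%N].

Definition replace D P P1 P2 : {fset piece G} := (D `\ P) `|` [fset P1; P2].

Lemma in_replace D P P1 P2 Q :
  (Q \in replace D P P1 P2) = [|| (Q != P) && (Q \in D), Q == P1 | Q == P2].
Proof. by rewrite !inE. Qed.

Lemma labels_below_split N D P E1 E2 a b k :
  E1 `|` E2 = P -> P \in D ->
  labels_below N (replace D P (([set a; b], Some k) |` E1) (([set a; b], Some k) |` E2)) ->
  labels_below N D /\ (k < N)%N.
Proof.
move=> PE DP ltN; split; last first.
  by apply: (ltN (([set a; b], Some k) |` E1) [set a; b] k); rewrite ?in_replace ?eqxx ?orbT ?fset1U1.
move=> Q A l DQ QA; have [DQP|nQP] := eqVneq Q P; last first.
  by apply: ltN QA; rewrite in_replace nQP DQ.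
move: QA; rewrite DQP -PE in_fsetU => /orP[EA|EA].
  by apply: (ltN (([set a; b], Some k) |` E1) A l); rewrite ?in_replace ?eqxx ?orbT ?fset1Ur.
by apply: (ltN (([set a; b], Some k) |` E2) A l); rewrite ?in_replace ?eqxx ?orbT ?fset1Ur.
Qed.

Lemma splitting_labels B D : (forall e, e \in B -> e.2 = None) -> splitting B D ->
  exists N, labels_below N D.
Proof.
move=> B0; elim=> [|D' P E1 E2 a b k _ [N ltN] DP PE _ _ _ _ _ _ /=].
  by exists 0 => P A k; rewrite in_fset1 => /eqP-> /B0.
exists (maxn N k.+1) => Q A l; rewrite -/(replace _ _ _ _) in_replace.
case/or3P=> [/andP[_ DQ] QA|/eqP->|/eqP->]; rewrite ?in_fset1U.
- by rewrite leq_max (ltN Q A l).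
- case/orP=> [/eqP[_ ->]|EA]; first by rewrite leq_max ltnSn orbT.
  by rewrite leq_max (ltN P A l) // -PE in_fsetU EA.
- case/orP=> [/eqP[_ ->]|EA]; first by rewrite leq_max ltnSn orbT.
  by rewrite leq_max (ltN P A l) // -PE in_fsetU EA orbT.
Qed.

Lemma good_side N P E1 E2 a b k :
  good_piece N P -> split_piece P E1 E2 a b -> (k < N)%N ->
  (forall e, e \in P -> e.2 != Some k) -> good_piece N (([set a; b], Some k) |` E1).
Proof.
move=> [wfP nsP _] splP ltkN frk; split.
- exact: wf_side wfP splP ltkN frk.
- exact: nonseparable_split wfP splP ltkN frk nsP.
have [[PE _ lt1 _] _] := splP; rewrite cardfsU1.
suff -> : ([set a; b], Some k) \notin E1 by rewrite add1n ltnS.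
apply/negP=> E1e; have := frk ([set a; b], Some k); rewrite -PE in_fsetU E1e eqxx.
by move/(_ isT).
Qed.

(** [N] bounds the labels of the last stage, hence those of all earlier stages, as labels only
    accumulate. So a single [N] serves the whole induction, and the minors compose on one vertex
    type. *)
Lemma splitting_good N B D : splitting B D -> base_piece B -> labels_below N D ->
  forall P, P \in D -> good_piece N P /\ rminor (@hat G N P) (@hat G N B).
Proof.
move=> spl [wfB nsB ltB _]; elim: spl => [|D' P E1 E2 a b k _ IH DP PE E12 lt1 lt2 nab supp fr /= ltN].
  by move=> ltN P; rewrite in_fset1 => /eqP->; split; [split | apply: rminor_refl].
have [ltN' ltkN] := labels_below_split PE DP ltN; have {}IH := IH ltN'.
have splP : split_piece P E1 E2 a b by [].
have frP e : e \in P -> e.2 != Some k by apply: fr.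
have [goodP minP] := IH P DP; have [wfP nsP _] := goodP.
move=> Q; rewrite -/(replace _ _ _ _) in_replace => /or3P[/andP[_ /IH]//|/eqP->|/eqP->].
  split; first exact: good_side goodP splP ltkN frP.
  exact: rminor_trans (rminor_side wfP splP ltkN frP nsP) minP.
have splPC := split_pieceC splP.
split; first exact: good_side goodP splPC ltkN frP.
exact: rminor_trans (rminor_side wfP splPC ltkN frP nsP) minP.
Qed.

Lemma splitting_rminor (H : sgraph) N B D : nearly_3connected H ->
  splitting B D -> base_piece B -> labels_below N D ->
  rminor (@adj H) (@hat G N B) ->
  exists2 P, P \in D & rminor (@adj H) (@hat G N P).
Proof.
move=> H3 spl baseB ltN HB.
elim: spl ltN => [|D' P E1 E2 a b k spl IH DP PE E12 lt1 lt2 nab supp fr /= ltN].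
  by exists B; rewrite ?in_fset1.
have [ltN' ltkN] := labels_below_split PE DP ltN.
have [Q DQ HQ] := IH ltN'.
have [DQP|nQP] := eqVneq Q P; last first.
  by exists Q => //; rewrite -/(replace _ _ _ _) in_replace nQP DQ.
have [[wfP _ _] _] := splitting_good spl baseB ltN' DP.
have splP : split_piece P E1 E2 a b by [].
rewrite DQP in HQ; have [HQ1|HQ2] := rminor_split wfP splP ltkN (fun e Pe => fr P e DP Pe) H3 HQ.
  by eexists; last exact: HQ1; rewrite -/(replace _ _ _ _) in_replace eqxx orbT.
by eexists; last exact: HQ2; rewrite -/(replace _ _ _ _) in_replace eqxx !orbT.
Qed.

(** If [e] were the only edge at [x], deleting the other end of [e], or its label when it is
    virtual, would cut [x] off from the rest of the piece. *)
Lemma piece_degree2 N P x : wf_piece N P -> nonseparable_piece N P -> (1 < #|` P|)%N ->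
  x \in piece_support P ->
  exists e f, [/\ e \in P, f \in P, e != f, x \in e.1 & x \in f.1].
Proof.
move=> [card2 lab ltN] nsP ltP /piece_supportP[e Pe xe].
have [f Pf nfe] : exists2 f, f \in P & f != e.
  have /fset0Pn[f] : P `\ e != fset0 by rewrite -cardfs_gt0; have := cardfsD1 e P; rewrite Pe; lia.
  by rewrite !inE => /andP[nf Pf]; exists f.
have [xf|xf] := boolP (x \in f.1); first by exists e, f; rewrite eq_sym.
have [y De nxy] : exists2 y, e.1 = [set x; y] & x != y.
  have /eqP/cards2P[u [v [nuv Duv]]] := card2 e Pe; move: xe; rewrite Duv !inE => /orP[]/eqP->.
    by exists v.
  by exists u; rewrite 1?setUC // eq_sym.
have [z fz nzy] : exists2 z, z \in f.1 & z != y.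
  have /eqP/cards2P[u [v [nuv ->]]] := card2 f Pf.
  have [Du|nuy] := eqVneq u y; last by exists u; rewrite // !inE eqxx.
  by exists v; rewrite ?inE ?eqxx ?orbT // -Du eq_sym.
have main (v : G + 'I_N) : inl x != v -> inl z != v ->
    (forall w, hat P (inl x) w -> w != v -> exists g, [/\ g \in P, e != g & x \in g.1]) ->
    exists e f, [/\ e \in P, f \in P, e != f, x \in e.1 & x \in f.1].
  move=> xv zv edge; have /connP/(_ [set inl x] (inl x) (inl z)) := nsP v.
  have Sx : inl x \in hat_support N P by rewrite inE; apply/piece_supportP; exists e.
  have Sz : inl z \in hat_support N P by rewrite inE; apply/piece_supportP; exists f.
  rewrite !in_setD1 xv zv Sx Sz set11 in_set1; case=> //.
    by apply: contraNneq xf => -[<-].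
  move=> u [w [_ + /set1P-> _ xw]]; rewrite in_setD1 => /andP[wv _].
  by have [g [Pg neg xg]] := edge w xw wv; exists e, g.
case De2: (e.2) => [k|]; last first.
  apply: (main (inl y)).
  - by apply: contra_neq nxy => -[].
  - by apply: contra_neq nzy => -[].
  move=> [t|l] /=; last first.
    case/existsP=> A /andP[xA PA] _; exists (A, Some (val l)); split=> //.
    by apply/eqP=> Dl; rewrite Dl in De2.
  move=> Pxt nty; exists ([set x; t], None); split=> //; last by rewrite !inE eqxx.
  apply: contra_neq nty => Dxt; congr inl; move: De; rewrite Dxt /= => /eqP.
  rewrite set2_eq eqxx /= => /orP[/eqP//|/andP[/eqP Dx]].
  by rewrite Dx eqxx in nxy.
have ltkN : (k < N)%N by apply: (ltN e.1); rewrite -De2 -surjective_pairing.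
apply: (main (inr (Ordinal ltkN))) => // -[t|l] /=.
  move=> Pxt _; exists ([set x; t], None); split=> //; last by rewrite !inE eqxx.
  by apply/eqP=> Dxt; rewrite Dxt in De2.
case/existsP=> A /andP[xA PA] nlk; exists (A, Some (val l)); split=> //.
apply: contra_neq nlk => Dl; congr inr; apply: val_inj => /=.
by move: De2; rewrite Dl => -[].
Qed.
End SplittingInvariants.

(** * Existence of the canonical decomposition *)

Section MaximalSplitting.
Local Open Scope fset_scope.
Variable G : sgraph.
Implicit Types (P Q B E : piece G) (D : {fset piece G}) (e : tedge G).
Implicit Types (A S : {set G}) (x y a b : G).

(** A decomposition is a set, so counting its pieces needs the sides to be new and distinct. The
    fresh label makes them new, and they differ since their other edges are disjoint. *)
Lemma split_sides_new D P E1 E2 a b k :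
  E1 `|` E2 = P -> P \in D ->
  E1 `&` E2 = fset0 -> (1 < #|` E1|)%N -> fresh D k ->
  [/\ (([set a; b], Some k) |` E1) \notin D, (([set a; b], Some k) |` E2) \notin D &
      ([set a; b], Some k) |` E1 != ([set a; b], Some k) |` E2].
Proof.
move=> PE DP E12 lt1 fr; have new E : (([set a; b], Some k) |` E) \notin D.
  by apply/negP=> DE; have := fr _ ([set a; b], Some k) DE (fset1U1 _ _); rewrite eqxx.
split=> //; have /fset0Pn[f E1f] : E1 != fset0 by rewrite -cardfs_gt0 ltnW.
apply/eqP=> /fsetP/(_ f); rewrite !in_fset1U E1f orbT => /esym/orP[/eqP Df|E2f].
  have Pf : f \in P by rewrite -PE in_fsetU E1f.
  by have := fr P f DP Pf; rewrite Df eqxx.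
by have: f \in E1 `&` E2; [rewrite in_fsetI E1f | rewrite E12].
Qed.

Lemma sum_replace (F : piece G -> nat) D P P1 P2 :
  P \in D -> P1 \notin D -> P2 \notin D -> P1 != P2 ->
  (\sum_(Q <- replace D P P1 P2) F Q + F P = \sum_(Q <- D) F Q + F P1 + F P2)%N.
Proof.
move=> DP D1 D2 n12; rewrite (big_fsetD1 P DP) /=.
have -> : replace D P P1 P2 = P1 |` (P2 |` (D `\ P)).
  by apply/fsetP=> Q; rewrite in_replace !inE; case: (Q == P1) (Q == P2) => [] []; rewrite ?orbT ?orbF.
rewrite big_fsetU1 /= ?big_fsetU1 /= ?inE ?(negbTE D1) ?(negbTE D2) ?andbF ?orbF //; lia.
Qed.

(** The weight of a piece, its number of edges minus 2, is additive: both sides receive the virtual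
    edge, and (m1 + 1 - 2) + (m2 + 1 - 2) = m1 + m2 - 2. Every weight is at least 1, which bounds
    the number of pieces and makes splitting terminate. *)
Lemma splitting_card B D : splitting B D -> (2 < #|` B|)%N ->
  (#|` D| + 2 <= #|` B|)%N.
Proof.
move=> spl ltB.
suff [gt2 sumD] : (forall P, P \in D -> (2 < #|` P|)%N) /\
    (\sum_(P <- D) (#|` P| - 2) = #|` B| - 2)%N.
  suff : (#|` D| <= \sum_(P <- D) (#|` P| - 2))%N by lia.
  rewrite -sum1_size big_seq [X in (_ <= X)%N]big_seq; apply: leq_sum => P /gt2; lia.
elim: spl => [|D' P E1 E2 a b k _ [gt2 sumD] DP PE E12 lt1 lt2 nab supp fr /=].
  by split; [move=> P; rewrite in_fset1 => /eqP-> | rewrite big_seq_fset1].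
have new E : E `<=` P -> ([set a; b], Some k) \notin E.
  move=> /fsubsetP sub; apply/negP=> /sub Pe.
  by have := fr P ([set a; b], Some k) DP Pe; rewrite eqxx.
have c1 : #|` ([set a; b], Some k) |` E1| = #|` E1|.+1.
  by rewrite cardfsU1 new // -PE fsubsetUl.
have c2 : #|` ([set a; b], Some k) |` E2| = #|` E2|.+1.
  by rewrite cardfsU1 new // -PE fsubsetUr.
have cP : #|` P| = (#|` E1| + #|` E2|)%N by rewrite -PE -cardfsUI E12 cardfs0 addn0.
split=> [Q|].
  by rewrite -/(replace _ _ _ _) in_replace => /or3P[/andP[_ /gt2]//|/eqP->|/eqP->]; rewrite ?c1 ?c2.
have [n1 n2 n12] := split_sides_new a b PE DP E12 lt1 fr.
have := sum_replace (fun Q => #|` Q| - 2)%N DP n1 n2 n12.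
rewrite sumD c1 c2 cP -/(replace _ _ _ _); set s := (\sum_(_ <- replace _ _ _ _) _)%N.
have cancel (m1 m2 t t' : nat) : (1 < m1 -> 1 < m2 -> t + (m1 + m2 - 2) = t' + (m1.+1 - 2) + (m2.+1 - 2) -> t = t')%N by lia.
exact: cancel lt1 lt2.
Qed.

Lemma maximal_splitting B : base_piece B ->
  exists2 D, splitting B D &
    forall P E1 E2 a b, P \in D -> ~ split_piece P E1 E2 a b.
Proof.
move=> [_ _ ltB B0].
have [n] := ubnP (#|` B| - #|` [fset B]|)%N.
elim: n [fset B] (splitting_start B) => // n IHn D spl leDn.
have [[P [E1 [E2 [a [b [DP splP]]]]]]|nspl] :=
  classic (exists P E1 E2 a b, P \in D /\ split_piece P E1 E2 a b); last first.
  by exists D => // P E1 E2 a b DP splP; case: nspl; exists P, E1, E2, a, b.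
have [N ltN] := splitting_labels B0 spl.
have frN : fresh D N.
  move=> Q [A [k|]] DQ Qe //=; have := ltN Q A k DQ Qe.
  by apply: contraTneq => -[->]; rewrite ltnn.
have [[PE E12 lt1 lt2] [nab supp]] := splP.
have spl' := splitting_step spl DP PE E12 lt1 lt2 nab supp frN.
apply: (IHn _ spl').
have [n1 n2 n12] := split_sides_new a b PE DP E12 lt1 frN.
have := sum_replace (fun Q => 1)%N DP n1 n2 n12.
rewrite !sum1_size => cD'; have leD' := splitting_card spl' ltB.
have descent (s t t' : nat) : (s - t < n.+1 -> t' + 1 = t + 1 + 1 -> t' + 2 <= s -> s - t' < n)%N by lia.
exact: descent leDn cD' leD'.
Qed.

End MaximalSplitting.

(** * Undoing splittings *)

Section Merging.
Local Open Scope fset_scope.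
Variable G : sgraph.
Implicit Types (P Q R B E : piece G) (D : {fset piece G}) (e : tedge G).
Implicit Types (A S : {set G}) (x y a b : G).

(** The part of the tree structure of a decomposition that merging uses. Nothing is asked of pieces
    without a common edge, which may still share vertices. *)
Definition tree_like D : Prop :=
  forall P Q e, P \in D -> Q \in D -> P != Q -> e \in P -> e \in Q ->
    P `&` Q = [fset e] /\ piece_support P :&: piece_support Q = e.1.

Lemma support_side E1 E2 a b (o : option nat) :
  piece_support E1 :&: piece_support E2 = [set a; b] ->
  piece_support (([set a; b], o) |` E1) = piece_support E1.
Proof.
move=> supp; rewrite supportU support1; apply/setUidPr.
by rewrite -supp subsetIl.
Qed.

Lemma splitting_tree_like B D : splitting B D -> tree_like D.
Proof.
elim=> [|D' P E1 E2 a b k _ IH DP PE E12 lt1 lt2 nab supp fr /=].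
  by move=> P Q e; rewrite !in_fset1 => /eqP-> /eqP->; rewrite eqxx.
set e := (_, Some k).
have suppC : piece_support E2 :&: piece_support E1 = [set a; b] by rewrite setIC.
(* An old piece against a side: apart from the fresh edge, which is in no old piece, the side lies
   in [P], so the property of [P] restricts to it. *)
have mixed E E' Q f : E `<=` P -> piece_support E :&: piece_support E' = [set a; b] ->
    Q \in D' -> Q != P ->
    f \in Q -> f \in e |` E ->
    Q `&` (e |` E) = [fset f] /\
    piece_support Q :&: piece_support (e |` E) = f.1.
  move=> EP suppE DQ nQP Qf; rewrite in_fset1U => /orP[/eqP Df|Ef].
    by have := fr Q f DQ Qf; rewrite Df eqxx.
  have Pf := fsubsetP EP f Ef; have [QP suppQP] := IH Q P f DQ DP nQP Qf Pf.
  split.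
    apply/eqP; rewrite eqEfsubset; apply/andP; split; last first.
      by apply/fsubsetP=> g; rewrite in_fset1 => /eqP->; rewrite in_fsetI Qf in_fset1U Ef orbT.
    apply/fsubsetP=> g; rewrite in_fsetI in_fset1U => /andP[Qg /orP[/eqP Dg|Eg]].
      by have := fr Q g DQ Qg; rewrite Dg eqxx.
    by rewrite -QP in_fsetI Qg (fsubsetP EP).
  rewrite (support_side _ suppE); apply/eqP; rewrite eqEsubset; apply/andP; split.
    by rewrite -suppQP setIS // supportS.
  apply/subsetP=> x xf; rewrite inE; apply/andP; split; apply/piece_supportP.
    by exists f.
  by exists f.
have sides f : f \in e |` E1 -> f \in e |` E2 ->
    (e |` E1) `&` (e |` E2) = [fset f] /\
    piece_support (e |` E1) :&: piece_support (e |` E2) = f.1.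
  have eqI g : (g \in e |` E1) && (g \in e |` E2) = (g == e).
    rewrite !in_fset1U; case: (g == e) => //=; apply/negbTE/negP=> /andP[g1 g2].
    by have: g \in E1 `&` E2; [rewrite in_fsetI g1 | rewrite E12].
  move=> f1 f2; have := eqI f; rewrite f1 f2 => /esym/eqP->; split.
    by apply/fsetP=> g; rewrite in_fsetI eqI in_fset1.
  by rewrite (support_side _ supp) (support_side _ suppC).
have P1 : E1 `<=` P by rewrite -PE fsubsetUl.
have P2 : E2 `<=` P by rewrite -PE fsubsetUr.
move=> Q Q' f; rewrite -/(replace _ _ _ _) !in_replace.
move=> /or3P[/andP[nQ DQ]|/eqP->|/eqP->] /or3P[/andP[nQ' DQ']|/eqP->|/eqP->] nQQ' Qf Q'f.
- exact: IH.
- exact: mixed P1 supp DQ nQ Qf Q'f.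
- exact: mixed P2 suppC DQ nQ Qf Q'f.
- by rewrite fsetIC setIC; apply: mixed P1 supp DQ' nQ' Q'f Qf.
- by rewrite eqxx in nQQ'.
- exact: sides.
- by rewrite fsetIC setIC; apply: mixed P2 suppC DQ' nQ' Q'f Qf.
- by rewrite fsetIC setIC; apply: sides.
- by rewrite eqxx in nQQ'.
Qed.

Definition merge_pieces D P Q e : {fset piece G} := ((D `\ P) `\ Q) `|` [fset (P `|` Q) `\ e].

Lemma in_merge D P Q e (X : piece G) :
  (X \in merge_pieces D P Q e) = [&& X != Q, X != P & X \in D] || (X == (P `|` Q) `\ e).
Proof. by rewrite !inE. Qed.

Lemma mergeC D P Q e : merge_pieces D P Q e = merge_pieces D Q P e.
Proof. by apply/fsetP=> X; rewrite !in_merge [P `|` Q]fsetUC andbCA. Qed.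

Lemma replaceC D P P1 P2 : replace D P P1 P2 = replace D P P2 P1.
Proof. by apply/fsetP=> X; rewrite !in_replace [(X == P1) || _]orbC. Qed.

Lemma fresh_merge D P Q e k : P \in D -> Q \in D -> fresh D k -> fresh (merge_pieces D P Q e) k.
Proof.
move=> DP DQ fr X f; rewrite in_merge => /orP[/and3P[_ _ DX]|/eqP->]; first exact: fr.
by rewrite !inE => /andP[_ /orP[]]; apply: fr.
Qed.

Lemma tree_like_inter D P Q E : tree_like D -> P \in D -> Q \in D -> P != Q ->
  E `<=` P -> E `<=` Q -> (#|` E| <= 1)%N.
Proof.
move=> trD DP DQ nPQ /fsubsetP EP /fsubsetP EQ.
have [->|/fset0Pn[e Ee]] := eqVneq E fset0; first by rewrite cardfs0.
have [PQ _] := trD P Q e DP DQ nPQ (EP e Ee) (EQ e Ee).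
rewrite -(cardfs1 e) fsubset_leq_card // -PQ; apply/fsubsetP=> f Ef.
by rewrite in_fsetI EP ?EQ.
Qed.

(** Merging a side of [P] with [Q] is the same as merging [P] with [Q] and then splitting along the
    same pair. [Q] must keep an edge at each end of [e], and two edges in all, so that the enlarged
    part still has the support and the size that a splitting demands. *)
Lemma merge_side B D P Q E1 E2 e a b k :
  splitting B (merge_pieces D P Q e) -> tree_like D -> P \in D -> Q \in D -> Q != P ->
  split_piece P E1 E2 a b -> fresh D k -> e \in E1 -> e \in Q -> (2 < #|` Q|)%N ->
  (forall x, x \in piece_support Q -> exists f g,
     [/\ f \in Q, g \in Q, f != g, x \in f.1 & x \in g.1]) ->
  splitting B (merge_pieces (replace D P (([set a; b], Some k) |` E1) (([set a; b], Some k) |` E2))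
                 (([set a; b], Some k) |` E1) Q e).
Proof.
move=> splM trD DP DQ nQP [[PE E12 lt1 lt2] [nab supp]] fr E1e Qe ltQ deg2.
set v := (_, Some k); set M := (P `|` Q) `\ e in splM.
pose F1 := (E1 `|` Q) `\ e.
have Pe : e \in P by rewrite -PE in_fsetU E1e.
have nPQ : P != Q by rewrite eq_sym.
have [PQ suppPQ] := trD P Q e DP DQ nPQ Pe Qe.
have E2e : e \notin E2.
  by apply/negP=> E2e; have: e \in E1 `&` E2; [rewrite in_fsetI E1e | rewrite E12].
have nev : e != v by apply: contraNneq (fr Q e DQ Qe) => ->.
have [n1 n2 n12] := split_sides_new a b PE DP E12 lt1 fr.
have E2P : E2 `<=` P by rewrite -PE fsubsetUr.
have E2M : E2 `<=` M.
  apply/fsubsetP=> f E2f; rewrite !inE (fsubsetP E2P) //= andbT.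
  by apply: contraNneq E2e => <-.
(* [M] and [P] share [E2], which has two edges, whereas two pieces share at most one. *)
have M1 : M \notin D.
  apply/negP=> DM; have nPM : P != M by apply: contraTneq Pe => ->; rewrite !inE eqxx.
  by have := tree_like_inter trD DP DM nPM E2P E2M; rewrite leqNgt lt2.
have FM : F1 `|` E2 = M.
  apply/fsetP=> f; rewrite !inE -PE in_fsetU; have [->|_] := eqVneq f e.
    by rewrite (negbTE E2e).
  by rewrite /= -orbA [(f \in Q) || _]orbC orbA.
have F12 : F1 `&` E2 = fset0.
  apply/fsetP=> f; rewrite !inE; apply/negbTE/negP=> /andP[/andP[nfe /orP[E1f|Qf]] E2f].
    by have: f \in E1 `&` E2; [rewrite in_fsetI E1f | rewrite E12].
  have: f \in P `&` Q by rewrite in_fsetI (fsubsetP E2P).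
  by rewrite PQ in_fset1 (negbTE nfe).
have ltF1 : (1 < #|` F1|)%N.
  have sub : Q `\ e `<=` F1.
    by apply/fsubsetP=> f; rewrite !inE => /andP[-> ->]; rewrite orbT.
  apply: leq_trans (fsubset_leq_card sub).
  by move: ltQ; rewrite (cardfsD1 e Q) Qe add1n ltnS.
have suppF : piece_support F1 :&: piece_support E2 = [set a; b].
  apply/eqP; rewrite eqEsubset; apply/andP; split.
    apply/subsetP=> x; rewrite inE => /andP[/piece_supportP[f]]; rewrite !inE.
    case/andP=> nfe /orP[E1f|Qf] xf E2x.
      suff : x \in [set a; b] by rewrite !inE.
      by rewrite -supp inE E2x andbT; apply/piece_supportP; exists f.
    suff : x \in [set a; b] by rewrite !inE.
    rewrite -supp inE E2x andbT; apply/piece_supportP; exists e => //.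
    rewrite -suppPQ inE (subsetP (supportS E2P)) //=.
    by apply/piece_supportP; exists f.
  apply/subsetP=> x; rewrite -supp !in_setI => /andP[/piece_supportP[f E1f xf] ->].
  rewrite andbT; apply/piece_supportP; have [Df|nfe] := eqVneq f e; last first.
    by exists f; rewrite // !inE nfe E1f.
  have Qx : x \in piece_support Q by apply/piece_supportP; exists e; rewrite // -Df.
  have [g [h [Qg Qh ngh xg xh]]] := deg2 x Qx.
  have [Dg|nge] := eqVneq g e; last by exists g; rewrite // !inE nge Qg orbT.
  by exists h; rewrite // !inE Qh orbT andbT -Dg eq_sym.
have DM : M \in merge_pieces D P Q e by rewrite in_merge eqxx orbT.
have := splitting_step splM DM FM F12 ltF1 lt2 nab suppF (fresh_merge (e := e) DP DQ fr).
rewrite /= -/(replace _ _ _ _) -/v; congr splitting; apply/fsetP=> X.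
have -> : v |` F1 = ((v |` E1) `|` Q) `\ e.
  apply/fsetP=> f; rewrite !inE; have [->|] := eqVneq f e; last by rewrite /= orbA.
  by rewrite (negbTE nev).
set S1 := (_ `\ e); rewrite [LHS]in_replace [RHS]in_merge.
rewrite [X \in merge_pieces _ _ _ _]in_merge [X \in replace _ _ _ _]in_replace.
have nMv : v \notin M.
  rewrite !inE; apply/negP=> /andP[_ /orP[Pv|Qv]].
    by have := fr P v DP Pv; rewrite eqxx.
  by have := fr Q v DQ Qv; rewrite eqxx.
have [->|nX1] := eqVneq X (v |` E1).
  rewrite (negbTE n1) (negbTE n12) !andbF /=.
  suff -> : (v |` E1 == M) = false by rewrite /= ?eqxx /= ?andbF ?orbF.
  by apply/negbTE; apply: contraNneq nMv => <-; apply: fset1U1.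
have [->|nX2] := eqVneq X (v |` E2).
  rewrite !orbT /=; suff -> : v |` E2 != Q by [].
  by apply: contraNneq n2 => ->.
rewrite !orbF; have [->|nXM] := eqVneq X M; first by rewrite (negbTE M1) !andbF.
by rewrite orbF /=.
Qed.

(** The splitting step and the merge concern different pieces. They commute once [R] is known to
    differ from the merged piece, which holds because [R] cannot share two edges with [P]. *)
Lemma merge_old B D P Q R E1 E2 e a b k :
  splitting B (merge_pieces D P Q e) -> tree_like D -> P \in D -> Q \in D -> R \in D ->
  P != R -> Q != R -> P != Q -> split_piece R E1 E2 a b -> fresh D k ->
  e \in P -> e \in Q -> (2 < #|` P|)%N ->
  splitting B (merge_pieces (replace D R (([set a; b], Some k) |` E1) (([set a; b], Some k) |` E2)) P Q e).
Proof.
move=> splM trD DP DQ DR nPR nQR nPQ [[RE E12 lt1 lt2] [nab supp]] fr Pe Qe ltP.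
have [n1 n2 n12] := split_sides_new a b RE DR E12 lt1 fr.
set v := (_, Some k) in n1 n2 n12 *; set M := (P `|` Q) `\ e.
have nRM : R != M.
  have ltPe : (1 < #|` P `\ e|)%N by move: ltP; rewrite (cardfsD1 e P) Pe add1n ltnS.
  apply/eqP=> DM; have sub : P `\ e `<=` R.
    by rewrite DM; apply/fsubsetP=> f; rewrite !inE => /andP[-> ->].
  by have := tree_like_inter trD DP DR nPR (fsubD1set P e) sub; rewrite leqNgt ltPe.
have MR : R \in merge_pieces D P Q e by rewrite in_merge DR ![R == _]eq_sym nPR nQR.
have := splitting_step splM MR RE E12 lt1 lt2 nab supp (fresh_merge (e := e) DP DQ fr).
rewrite /= -/(replace _ _ _ _) -/v; congr splitting; apply/fsetP=> X.
rewrite [LHS]in_replace [RHS]in_merge.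
rewrite [X \in merge_pieces _ _ _ _]in_merge [X \in replace _ _ _ _]in_replace -/M.
have [->|nX1] := eqVneq X (v |` E1).
  rewrite !orbT /=; have -> : v |` E1 != Q by apply: contraNneq n1 => ->.
  by have -> : v |` E1 != P by apply: contraNneq n1 => ->.
have [->|nX2] := eqVneq X (v |` E2).
  rewrite !orbT /=; have -> : v |` E2 != Q by apply: contraNneq n2 => ->.
  by have -> : v |` E2 != P by apply: contraNneq n2 => ->.
rewrite !orbF; have [->|nXM] := eqVneq X M; first by rewrite eq_sym nRM !orbT.
by rewrite !orbF; do 3!case: (X == _).
Qed.

(** The sides just created share the fresh edge only, and merging them restores [D]. *)
Lemma merge_new B D R E1 E2 e a b k :
  splitting B D -> R \in D -> split_piece R E1 E2 a b -> fresh D k ->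
  e \in ([set a; b], Some k) |` E1 -> e \in ([set a; b], Some k) |` E2 ->
  splitting B (merge_pieces (replace D R (([set a; b], Some k) |` E1) (([set a; b], Some k) |` E2))
    (([set a; b], Some k) |` E1) (([set a; b], Some k) |` E2) e).
Proof.
move=> spl DR [[RE E12 lt1 lt2] [nab supp]] fr.
have [n1 n2 n12] := split_sides_new a b RE DR E12 lt1 fr.
set v := (_, Some k) in n1 n2 n12 *.
have vR : v \notin R by apply/negP=> Rv; have := fr R v DR Rv; rewrite eqxx.
rewrite !in_fset1U => e1 e2; have {e1 e2} -> : e = v.
  apply: contraTeq e1 => nev; apply/negP; rewrite (negbTE nev) /= => e1.
  move: e2; rewrite (negbTE nev) => e2.
  by have: e \in E1 `&` E2; [rewrite in_fsetI e1 | rewrite E12].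
have DR' : ((v |` E1) `|` (v |` E2)) `\ v = R.
  apply/fsetP=> f; rewrite -RE !inE; have [->|_] := eqVneq f v; last by [].
  by apply/esym/negbTE; move: vR; rewrite -RE inE.
suff -> : merge_pieces (replace D R (v |` E1) (v |` E2)) (v |` E1) (v |` E2) v = D by [].
apply/fsetP=> X; rewrite [LHS]in_merge [X \in replace _ _ _ _]in_replace DR'.
have [->|nX1] := eqVneq X (v |` E1).
  rewrite /= andbF (negbTE n1); apply: contraNF n1 => /eqP->.
  exact: DR.
have [->|nX2] := eqVneq X (v |` E2).
  rewrite /= (negbTE n2); apply: contraNF n2 => /eqP->.
  exact: DR.
by rewrite !orbF; have [->|] := eqVneq X R; rewrite ?DR ?orbF.
Qed.

(** [splitting] only splits, so an arbitrary merge is carried back through the derivation to the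
    step that created the shared edge, where it cancels. *)
Lemma merge_splitting B D P Q e : splitting B D -> base_piece B ->
  P \in D -> Q \in D -> P != Q -> e \in P -> e \in Q -> splitting B (merge_pieces D P Q e).
Proof.
move=> spl baseB; elim: spl P Q e => [|D' R E1 E2 a b k spl IH DR RE E12 lt1 lt2 nab supp fr /=] P Q e.
  by rewrite !in_fset1 => /eqP-> /eqP->; rewrite eqxx.
have splR : split_piece R E1 E2 a b by [].
have splRC := split_pieceC splR; have trD := splitting_tree_like spl.
have [_ _ _ B0] := baseB; have [N ltN] := splitting_labels B0 spl.
have good X : X \in D' -> good_piece N X.
  by move=> DX; have [] := splitting_good spl baseB ltN DX.
have big X : X \in D' -> (2 < #|` X|)%N by case/good.
have deg2 X : X \in D' -> forall x, x \in piece_support X -> exists f g,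
    [/\ f \in X, g \in X, f != g, x \in f.1 & x \in g.1].
  by move=> /good[wfX nsX ltX] x; apply: (piece_degree2 wfX nsX (ltnW ltX)).
have side E E' X f : split_piece R E E' a b -> X \in D' -> X != R ->
    f \in ([set a; b], Some k) |` E -> f \in X ->
    splitting B (merge_pieces (replace D' R (([set a; b], Some k) |` E) (([set a; b], Some k) |` E'))
      (([set a; b], Some k) |` E) X f).
  move=> splE DX nXR + Xf; rewrite in_fset1U => /orP[/eqP Df|Ef].
    by have := fr X f DX Xf; rewrite Df eqxx.
  have Rf : f \in R by case: splE => -[<- _ _ _] _; rewrite in_fsetU Ef.
  apply: (merge_side _ trD DR DX nXR splE fr Ef Xf (big X DX) (deg2 X DX)).
  by apply: (IH R X f DR DX _ Rf Xf); rewrite eq_sym.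
rewrite -/(replace _ _ _ _) !in_replace.
move=> /or3P[/andP[nPR DP]|/eqP->|/eqP->] /or3P[/andP[nQR DQ]|/eqP->|/eqP->] nPQ Pe Qe.
- exact: merge_old (IH P Q e DP DQ nPQ Pe Qe) trD DP DQ DR nPR nQR nPQ splR fr Pe Qe (big P DP).
- by rewrite mergeC; apply: side.
- by rewrite mergeC replaceC; apply: side.
- exact: side.
- by rewrite eqxx in nPQ.
- exact: merge_new.
- by rewrite replaceC; apply: side.
- by rewrite mergeC; apply: merge_new.
- by rewrite eqxx in nPQ.
Qed.

End Merging.

Lemma surj_inv (T T' : finType) (f : T -> T') :
  injective f -> (forall y, exists x, f x = y) ->
  exists f', cancel f f' /\ cancel f' f.
Proof.
move=> inj_f surj_f; have [f' f'K] := fin_all_exists surj_f.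
by exists f'; split=> // x; apply: inj_f.
Qed.

(** * Cycles and multiedges among pieces *)

Section Atoms.
Local Open Scope fset_scope.
Variable G : sgraph.
Implicit Types (P Q R B E : piece G) (D : {fset piece G}) (e : tedge G).
Implicit Types (A S : {set G}) (x y a b : G).

Lemma in_support P e x : e \in P -> x \in e.1 -> x \in piece_support P.
Proof. by move=> Pe xe; apply/piece_supportP; exists e. Qed.

Lemma multiedgeP P :
  is_multiedge (piece_mgraph P) <->
  (2 < #|` P|)%N /\ exists a b, a != b /\ forall e, e \in P -> e.1 = [set a; b].
Proof.
split=> [[n lt2n [f [g [[f' fK f'K] [g' gK g'K] gE _]]]]|[ltP [a [b [nab Pab]]]]].
  split.
    by rewrite cardfE (bij_eq_card (Bijective gK g'K)) card_ord.
  exists (val (f' true)), (val (f' false)); split.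
    by rewrite val_eqE (inj_eq (can_inj f'K)).
  move=> e Pe; have := gE [` Pe]; rewrite /= => /setP fE.
  have xP (c : bool) : val (f' c) \in e.1.
    have := fE c; rewrite inE => /esym/imsetP[x]; rewrite inE /= => xe Db.
    by rewrite Db fK.
  apply/setP=> x; apply/idP/idP=> [xe|]; last by rewrite !inE => /orP[]/eqP->; apply: xP.
  have <- : val (Sub x (in_support Pe xe) : {x : G | x \in piece_support P}) = x by [].
  rewrite !inE !val_eqE -!(inj_eq (can_inj fK)) !f'K.
  by case: (f _).
exists #|{: P}|; first by rewrite -cardfE.
have suppP x : (x \in piece_support P) = (x \in [set a; b]).
  apply/piece_supportP/idP=> [[e Pe]|xab]; first by rewrite Pab.
  have /fset0Pn[e Pe] : P != fset0 by rewrite -cardfs_gt0; lia.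
  by exists e; rewrite ?Pab.
have [aP bP] : a \in piece_support P /\ b \in piece_support P.
  by rewrite !suppP !inE !eqxx orbT.
exists (fun x : {x : G | x \in piece_support P} => val x == a), enum_rank; split=> //.
- exists (fun c : bool => if c then Sub a aP else Sub b bP) => [x|[]] /=.
  + have: val x \in piece_support P := valP x; rewrite suppP !inE.
    by case: eqP => [Dx _|_ /eqP Dx]; apply: val_inj; rewrite /= Dx.
  + exact: eqxx.
  + by rewrite eq_sym (negbTE nab).
- exact: enum_rank_bij.
move=> e /=; apply/setP=> c; rewrite inE; apply/esym/imsetP.
exists (if c then Sub a aP else Sub b bP); rewrite ?inE /=.
  by rewrite Pab ?fsvalP //; case: c; rewrite !inE eqxx ?orbT.
by case: c; rewrite /= ?eqxx // eq_sym (negbTE nab).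
Qed.

(** A cycle numbered by natural numbers, the successor being taken modulo [n]: rotating, reversing
    and concatenating then need no casts between ordinals. *)
Definition polygon P n (v : nat -> G) (f : nat -> tedge G) : Prop :=
  [/\ (2 < n)%N,
      forall i j, (i < n)%N -> (j < n)%N -> v i = v j -> i = j,
      forall i j, (i < n)%N -> (j < n)%N -> f i = f j -> i = j,
      forall e, e \in P <-> exists2 i, (i < n)%N & e = f i &
      forall i, (i < n)%N -> (f i).1 = [set v i; v (i.+1 %% n)]].

Lemma cycleP P : is_cycle (piece_mgraph P) <-> exists n v f, polygon P n v f.
Proof.
split=> [[[|n] // lt2n [f [g [[f' fK f'K] [g' gK g'K] gE _]]]]|[n [v [f [lt2n inj_v inj_f Pf fE]]]]].
  exists n.+1, (fun i => val (f' (inord i))), (fun i => val (g' (inord i))); split=> //.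
  - move=> i j lti ltj /val_inj/(can_inj f'K)/(congr1 val).
    by rewrite /= !inordK.
  - move=> i j lti ltj /val_inj/(can_inj g'K)/(congr1 val).
    by rewrite /= !inordK.
  - move=> e; split=> [Pe|[i lti ->]]; last exact: fsvalP.
    by exists (g [` Pe]); rewrite ?ltn_ord // inord_val gK.
  move=> i lti; have := gE (g' (inord i)); rewrite g'K /= => /setP E.
  have DS : inord (i.+1 %% n.+1) = ordS (inord i : 'I_n.+1).
    by apply: val_inj; rewrite /= !inordK // ltn_mod.
  apply/setP=> x; apply/idP/idP=> [xe|].
    have Sx := in_support (fsvalP (g' (inord i))) xe.
    have <- : val (Sub x Sx : {x : G | x \in piece_support P}) = x by [].
    have := E (f (Sub x Sx)); rewrite mem_imset; last exact: can_inj fK.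
    rewrite [_ \in piece_ends _]inE /= xe !inE => /orP[]/eqP Df; apply/orP.
      by left; rewrite -Df fK.
    by right; rewrite DS -Df fK.
  have Ex j : j \in [set inord i; ordS (inord i)] -> val (f' j) \in (fsval (g' (inord i))).1.
    by rewrite E => /imsetP[y]; rewrite inE /= => ye ->; rewrite fK.
  by rewrite !inE => /orP[]/eqP->; apply: Ex; rewrite ?DS !inE eqxx ?orbT.
exists n => //.
have Pfi (i : 'I_n) : f i \in P by apply/Pf; exists i.
have vP (i : 'I_n) : v i \in piece_support P.
  by apply: (in_support (Pfi i)); rewrite fE // !inE eqxx.
pose F (i : 'I_n) : {x : G | x \in piece_support P} := Sub (v i) (vP i).
pose H (i : 'I_n) : P := [` Pfi i].
have [f' [FK f'K]] : exists f', cancel F f' /\ cancel f' F.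
  apply: surj_inv => [i j /(congr1 val) /= /inj_v Dij|x]; first by apply/val_inj/Dij.
  have /piece_supportP[e /Pf[i lti ->]] := valP x.
  rewrite fE // !inE => /orP[]/eqP Dx.
    by exists (Ordinal lti); apply: val_inj.
  have n_gt0 : (0 < n)%N by lia.
  by exists (Ordinal (ltn_pmod i.+1 n_gt0)); apply: val_inj.
have [h' [HK h'K]] : exists h', cancel H h' /\ cancel h' H.
  apply: surj_inv => [i j /(congr1 val) /= /inj_f Dij|e]; first by apply/val_inj/Dij.
  have /Pf[i lti De] := fsvalP e.
  by exists (Ordinal lti); apply: val_inj.
exists f', h'; split=> //; first by exists F.
  by exists H.
move=> e; rewrite -[e in RHS]h'K /=; apply/setP=> j; rewrite -[j in RHS]FK mem_imset; last exact: can_inj f'K.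
rewrite !inE /= fE // !inE; congr (_ || _).
  by apply/eqP/eqP=> [->//|/inj_v Dj]; apply/val_inj/Dj.
apply/eqP/eqP=> [->//|/inj_v Dj]; apply/val_inj/Dj => //=.
by rewrite ltn_mod; lia.
Qed.
End Atoms.

Section MergeAtoms.
Local Open Scope fset_scope.
Variable G : sgraph.
Implicit Types (P Q R B E : piece G) (D : {fset piece G}) (e : tedge G).
Implicit Types (A S : {set G}) (x y a b : G).

(* The polygon P seen as a path v 0, ..., v n closed by the edge e. *)
Definition open_polygon P e n (v : nat -> G) (f : nat -> tedge G) : Prop :=
  [/\ (1 < n)%N, e.1 = [set v n; v 0],
      forall i j, (i <= n)%N -> (j <= n)%N -> v i = v j -> i = j,
      forall i, (i < n)%N -> (f i).1 = [set v i; v i.+1] &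
      [/\ forall i j, (i < n)%N -> (j < n)%N -> f i = f j -> i = j,
          forall g, g \in P <-> g = e \/ exists2 i, (i < n)%N & g = f i &
          forall i, (i < n)%N -> f i <> e]].

Lemma polygon_open P e n v f : polygon P n v f -> e \in P ->
  exists m w d, open_polygon P e m w d.
Proof.
move=> [lt2n inj_v inj_f Pf fE] /[dup] Pe /Pf[j ltj De].
have n_gt0 : (0 < n)%N by lia.
(* The numbering is rotated so that [e], which is [f j], comes last and can serve as the closing
   edge. *)
pose r i := ((i + j.+1) %% n)%N.
have ltr i : (r i < n)%N by rewrite ltn_mod.
have inj_r i i' : (i <= n.-1)%N -> (i' <= n.-1)%N -> r i = r i' -> i = i'.
  move=> lei lei' /eqP; rewrite /r eqn_modDr !modn_small; [by move/eqP | lia | lia].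
have rS i : (r i).+1 %% n = r i.+1 by rewrite /r -addn1 modnDml; congr modn; lia.
have rn : r n.-1 = j.
  by rewrite /r (_ : n.-1 + j.+1 = j + n)%N; [rewrite modnDr modn_small | lia].
have r_surj i : (i < n)%N -> exists2 i', (i' < n)%N & r i' = i.
  move=> lti; exists ((i + n - j.+1) %% n)%N; first by rewrite ltn_mod.
  by rewrite /r modnDml (_ : i + n - j.+1 + j.+1 = i + n)%N; [rewrite modnDr modn_small | lia].
exists n.-1, (fun i => v (r i)), (fun i => f (r i)); split=> //.
- by lia.
- by rewrite De fE // rn -[in X in (X.+1 %% n)%N]rn rS prednK //= /r modnDl.
- by move=> i i' lei lei' /inj_v/inj_r; apply; rewrite ?ltr.
- by move=> i lti; rewrite fE // rS.
split.
- move=> i i' lei lei' /inj_f/inj_r; apply; rewrite ?ltr //; lia.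
- move=> g; split=> [/Pf[i lti ->]|[->//|[i _ ->]]]; last by apply/Pf; exists (r i).
  have [i' lti' <-] := r_surj i lti.
  have [Di'|ni'] := eqVneq i' n.-1; first by left; rewrite Di' rn.
  by right; exists i' => //; lia.
move=> i lti; rewrite De -{1}rn => /inj_f/inj_r Di.
have Di' : i = n.-1 by apply: Di; rewrite ?ltr //; lia.
by lia.
Qed.

Lemma open_polygon_rev P e n v f : open_polygon P e n v f ->
  open_polygon P e n (fun i => v (n - i)%N) (fun i => f (n.-1 - i)%N).
Proof.
move=> [lt1n eE inj_v fE [inj_f Pf fe]]; split=> //.
- by rewrite subnn subn0 setUC.
- by move=> i j lei lej /inj_v; lia.
- move=> i lti; rewrite fE; last by lia.
  by rewrite setUC; congr [set v _; v _]; lia.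
split.
- by move=> i j lei lej /inj_f; lia.
- move=> g; rewrite Pf; split=> -[->|[i lti ->]]; try by left.
    by right; exists (n.-1 - i)%N; [lia | congr f; lia].
  by right; exists (n.-1 - i)%N; [lia | congr f; lia].
- by move=> i lti; apply: fe; lia.
Qed.

Lemma is_cycle_merge P Q e : is_cycle (piece_mgraph P) -> is_cycle (piece_mgraph Q) ->
  e \in P -> e \in Q -> P `&` Q = [fset e] ->
  piece_support P :&: piece_support Q = e.1 ->
  is_cycle (piece_mgraph ((P `|` Q) `\ e)).
Proof.
move=> /cycleP[? [? [? /polygon_open pP]]] /cycleP[? [? [? /polygon_open pQ]]] Pe Qe PQ supp.
have {pP} [n [v [f poP]]] := pP e Pe.
(* After reversing one path if necessary, the second begins where the first ends and ends where it
   begins, so the two concatenate to the merged cycle. *)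
have {pQ} [m [w [d [poQ [wm w0]]]]] : exists m w d, open_polygon Q e m w d /\
    (w m = v 0 /\ w 0 = v n).
  have [m [w [d poQ]]] := pQ e Qe.
  have [_ eP _ _ _] := poP; have [_ eQ _ _ _] := poQ.
  move/eqP: eP; rewrite eQ set2_eq => /orP[]/andP[/eqP wm /eqP w0].
    exists m, (fun i => w (m - i)%N), (fun i => d (m.-1 - i)%N).
    by split; [apply: open_polygon_rev | rewrite subnn subn0].
  by exists m, w, d.
have [lt1n eP inj_v fE [inj_f Pf fe]] := poP.
have [lt1m eQ inj_w dE [inj_d Qd de]] := poQ.
have Pfi i : (i < n)%N -> f i \in P by move=> lti; apply/Pf; right; exists i.
have Qdi i : (i < m)%N -> d i \in Q by move=> lti; apply/Qd; right; exists i.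
have nfd i j : (i < n)%N -> (j < m)%N -> f i <> d j.
  move=> lti ltj fd; have: f i \in P `&` Q by rewrite in_fsetI Pfi // fd Qdi.
  by rewrite PQ in_fset1 => /eqP; apply: fe.
have nvw i j : (i < n)%N -> (j < m)%N -> v i <> w j.
  move=> lti ltj vw; have : v i \in piece_support P :&: piece_support Q.
    rewrite inE (in_support (Pfi i lti)) /=; last by rewrite fE // !inE eqxx.
    by rewrite (in_support (Qdi j ltj)) // vw dE // !inE eqxx.
  rewrite supp eP !inE => /orP[]/eqP vE.
    by have := inj_v i n (ltnW lti) (leqnn n) vE; lia.
  have := inj_w j m (ltnW ltj) (leqnn m); rewrite -vw vE wm => /(_ erefl); lia.
apply/cycleP; exists (n + m)%N, (fun i => if (i < n)%N then v i else w (i - n)%N),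
  (fun i => if (i < n)%N then f i else d (i - n)%N); split.
- by lia.
- move=> i j lti ltj; case: ltnP => lei; case: ltnP => lej.
  + by apply: inj_v; lia.
  + by move/nvw; lia.
  + by move/esym/nvw; lia.
  + by move/inj_w; lia.
- move=> i j lti ltj; case: ltnP => lei; case: ltnP => lej.
  + by apply: inj_f.
  + by move/nfd; lia.
  + by move/esym/nfd; lia.
  + by move/inj_d; lia.
- move=> g; rewrite !inE; split=> [/andP[nge /orP[/Pf|/Qd]] [gE|[i lti ->]]|[i lti ->]].
  + by rewrite gE eqxx in nge.
  + by exists i; [lia | rewrite lti].
  + by rewrite gE eqxx in nge.
  + by exists (n + i)%N; [lia | rewrite ifF ?addKn //; lia].
  + case: ltnP => lei; first by rewrite Pfi // andbT; apply/eqP/fe.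
    by rewrite Qdi ?orbT ?andbT; [apply/eqP/de; lia | lia].
move=> i lti; have [lei|lei] := ltnP i n.
  rewrite fE // modn_small; last by lia.
  have [//|lei'] := ltnP i.+1 n.
  by rewrite (_ : i.+1 - n = 0)%N ?w0; [congr [set _; v _]; lia | lia].
rewrite dE; last by lia.
have [lti'|lei'] := ltnP i.+1 (n + m).
  by rewrite modn_small // ifF; [congr [set _; w _]; lia | lia].
rewrite (_ : i.+1 = n + m)%N; last by lia.
rewrite modnn (_ : 0 < n)%N; last by lia.
by rewrite -wm; congr [set _; w _]; lia.
Qed.

Lemma is_multiedge_merge P Q e :
  is_multiedge (piece_mgraph P) -> is_multiedge (piece_mgraph Q) ->
  e \in P -> e \in Q -> P `&` Q = [fset e] ->
  is_multiedge (piece_mgraph ((P `|` Q) `\ e)).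
Proof.
move=> /multiedgeP[ltP [a [b [nab Pab]]]] /multiedgeP[ltQ [c [d [_ Qcd]]]] Pe Qe PQ.
apply/multiedgeP; split.
  have := cardfsUI P Q; rewrite PQ cardfs1 => cU.
  have := cardfsD1 e (P `|` Q); rewrite in_fsetU Pe /=.
  move: ltP ltQ cU; move: (size P) (size Q) (size (P `|` Q)) (size _) => ? ? ? ?; lia.
exists a, b; split=> // g; rewrite !inE => /andP[_ /orP[/Pab//|/Qcd->]].
by rewrite -(Qcd e Qe) Pab.
Qed.

End MergeAtoms.

(** * Unsplittable pieces and the canonical decomposition *)

Section Existence.
Local Open Scope fset_scope.
Variable G : sgraph.
Implicit Types (P Q R B E : piece G) (D : {fset piece G}) (e : tedge G).
Implicit Types (A S : {set G}) (x y a b c : G).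

Definition atom P : Prop :=
  [\/ is_cycle (piece_mgraph P), is_multiedge (piece_mgraph P)
    | simple_3connected (piece_mgraph P)].

(** Delete [c] and cross from one part to the other: the vertex where this happens lies in both, and
    it is no label, as a shared label would be a shared edge. Two choices of [c] show that the parts
    share two vertices. *)
Lemma nonseparable_meet N P E1 E2 c : wf_piece N P -> nonseparable_piece N P ->
  E1 `|` E2 = P -> E1 `&` E2 = fset0 -> E1 != fset0 -> E2 != fset0 ->
  exists2 x, x != c & x \in piece_support E1 :&: piece_support E2.
Proof.
move=> [card2 lab ltN] nsP PE E12 /fset0Pn[e1 E1e] /fset0Pn[e2 E2e].
have P1 f : f \in E1 -> f \in P by rewrite -PE in_fsetU => ->.
have P2 f : f \in E2 -> f \in P by rewrite -PE in_fsetU orbC => ->.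
have end_ne f : f \in P -> exists2 x, x \in f.1 & x != c.
  move=> Pf; have /eqP/cards2P[u [v [nuv ->]]] := card2 f Pf.
  have [Du|nuc] := eqVneq u c; last by exists u; rewrite // !inE eqxx.
  by exists v; rewrite ?inE ?eqxx ?orbT // -Du eq_sym.
have [x xe1 nxc] := end_ne e1 (P1 e1 E1e); have [y ye2 nyc] := end_ne e2 (P2 e2 E2e).
have S1x := in_support E1e xe1; have S2y := in_support E2e ye2.
have [S1y|S1y] := boolP (y \in piece_support E1); first by exists y; rewrite ?inE ?S1y.
have ncl z : z != c -> inl z != inl c :> G + 'I_N by apply: contra_neq => -[].
have hatE E z : (inl z \in hat_support N E) = (z \in piece_support E) by rewrite inE.
have Sx : inl x \in hat_support N P :\ inl c.
  by rewrite in_setD1 ncl // hatE -PE supportU inE S1x.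
have Sy : inl y \in hat_support N P :\ inl c.
  by rewrite in_setD1 ncl // hatE -PE supportU inE S2y orbT.
have /connP/(_ (hat_support N E1) _ _ Sx Sy) := nsP (inl c).
rewrite !hatE S1x => /(_ isT S1y)[z [w []]].
rewrite in_setD1 => /andP[zc _]; rewrite in_setD1 => /andP[wc _] S1z S1w.
rewrite -PE hatU ![hat _ z w]hat_sym => /orP[/hat_in_support|]; first by rewrite (negbTE S1w).
rewrite hat_sym => /hat_in_support S2z; case: z => [z|k] in zc S1z S2z.
  exists z; first by apply: contra_neq zc => ->.
  by rewrite !inE in S1z S2z; rewrite inE S1z.
rewrite !inE in S1z S2z; have /existsP[A1 EA1] := S1z; have /existsP[A2 EA2] := S2z.
have DA := lab _ _ _ (P1 _ EA1) (P2 _ EA2).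
by have: (A1, Some (val k)) \in E1 `&` E2; [rewrite in_fsetI EA1 DA | rewrite E12].
Qed.

Section Unsplittable.
Variables (N : nat) (P : piece G).
Hypothesis goodP : good_piece N P.
Hypothesis unsplit : forall E1 E2 a b, ~ split_piece P E1 E2 a b.

Let card2 e : e \in P -> #|e.1| = 2. Proof. by case: goodP => -[c2 _ _] _ _; apply: c2. Qed.

Let meet E1 E2 c : E1 `|` E2 = P -> E1 `&` E2 = fset0 -> E1 != fset0 -> E2 != fset0 ->
  exists2 x, x != c & x \in piece_support E1 :&: piece_support E2.
Proof. by have [wfP nsP _] := goodP; apply: nonseparable_meet wfP nsP. Qed.

Let rest E1 : E1 `<=` P -> E1 `|` (P `\` E1) = P /\ E1 `&` (P `\` E1) = fset0.
Proof.
move=> /fsubsetP sub; split; apply/fsetP=> g; rewrite !inE.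
  by case E1g: (g \in E1) => //=; rewrite sub.
by case: (g \in E1); rewrite ?andbF.
Qed.

(** The pair [e], [f] could be split off unless only one edge remains; that edge meets the pair in
    both ends, so it is parallel to them. *)
Lemma unsplittable_parallel e f : e \in P -> f \in P -> e != f -> e.1 = f.1 ->
  is_multiedge (piece_mgraph P).
Proof.
move=> Pe Pf nef Def; have [_ _ ltP] := goodP.
have /eqP/cards2P[a [b [nab Deab]]] := card2 Pe.
pose E1 : piece G := [fset e; f]; pose E2 := P `\` E1.
have E1P : E1 `<=` P by apply/fsubsetP=> g; rewrite !inE => /orP[]/eqP->.
have [PE E12] := rest E1P.
have cE1 : #|` E1| = 2 by rewrite cardfs2 nef.
have cP : #|` P| = (2 + #|` E2|)%N by rewrite cardfsDS // cE1 subnKC // ltnW.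
have suppE1 : piece_support E1 = [set a; b].
  by rewrite supportU !support1 -Def setUid.
have E1_neq0 : E1 != fset0 by rewrite -cardfs_gt0 cE1.
have E2_neq0 : E2 != fset0.
  by rewrite -cardfs_gt0; move: ltP; rewrite cP; case: (#|` E2|).
have supp2 : piece_support E1 :&: piece_support E2 = [set a; b].
  rewrite suppE1; apply/setIidPl/subsetP=> x.
  have [u nub] := meet b PE E12 E1_neq0 E2_neq0.
  have [w nwa] := meet a PE E12 E1_neq0 E2_neq0.
  rewrite suppE1 !inE (negbTE nub) (negbTE nwa) orbF /=.
  by move=> /andP[/eqP-> wE2] /andP[/eqP-> uE2] /orP[]/eqP->.
apply/multiedgeP; split=> //; exists a, b; split=> // g Pg.
have [E1g|E1g] := boolP (g \in E1).
  by move: E1g; rewrite !inE => /orP[]/eqP->; rewrite -?Def.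
have E2g : g \in E2 by rewrite inE E1g.
have [ltE2|leE2] := ltnP 1 #|` E2|.
  by case: (@unsplit E1 E2 a b); split; split; rewrite // cE1.
have DE2 : E2 = [fset g].
  apply/eqP; rewrite eq_sym eqEfcard cardfs1 leE2 andbT.
  by apply/fsubsetP=> h; rewrite in_fset1 => /eqP->.
apply/esym/eqP; rewrite eqEcard card2 // cards2 nab andbT.
by move: supp2; rewrite DE2 support1 => <-; apply: subsetIr.
Qed.

Hypothesis simpleP : forall e f, e \in P -> f \in P -> e.1 = f.1 -> e = f.

Lemma unsplittable_triangle : (#|piece_support P| <= 3)%N -> is_cycle (piece_mgraph P).
Proof.
move=> le3; have [wfP nsP ltP] := goodP.
have /fset0Pn[e0 Pe0] : P != fset0 by rewrite -cardfs_gt0; apply: leq_trans ltP.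
have /eqP/cards2P[x [y0 [_ De0]]] := card2 Pe0.
have Sx : x \in piece_support P by apply: in_support Pe0 _; rewrite De0 !inE eqxx.
have [e [f [Pe Pf nef xe xf]]] := piece_degree2 wfP nsP (ltnW ltP) Sx.
have other g : g \in P -> x \in g.1 -> exists2 y, g.1 = [set x; y] & x != y.
  move=> Pg; have /eqP/cards2P[u [v [nuv ->]]] := card2 Pg; rewrite !inE => /orP[]/eqP->.
    by exists v.
  by exists u; rewrite 1?setUC // eq_sym.
have [y De nxy] := other e Pe xe; have [z Df nxz] := other f Pf xf.
have nyz : y != z.
  by apply: contraNneq nef => Dy; apply/eqP/simpleP; rewrite // De Df Dy.
have suppE : piece_support P = [set x; y; z].
  apply/esym/eqP; rewrite eqEcard; apply/andP; split; last first.
    by rewrite (leq_trans le3) // -setUA cardsU1 cards2 !inE negb_or nxy nxz nyz.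
  rewrite !subUset !sub1set Sx (in_support Pe) ?De ?inE ?eqxx ?orbT //=.
  by rewrite (in_support Pf) // Df !inE eqxx orbT.
have all3 g : g \in P -> [|| g.1 == [set x; y], g.1 == [set x; z] | g.1 == [set y; z]].
  move=> Pg; have /eqP/cards2P[u [v [nuv Dg]]] := card2 Pg.
  have Su : u \in piece_support P by apply: in_support Pg _; rewrite Dg !inE eqxx.
  have Sv : v \in piece_support P by apply: in_support Pg _; rewrite Dg !inE eqxx orbT.
  move: Su Sv; rewrite suppE !inE -!orbA Dg !set2_eq.
  move=> /or3P[]/eqP Du /or3P[]/eqP Dv; rewrite ?Du ?Dv ?eqxx ?orbT //;
    by rewrite Du Dv eqxx in nuv.
have [g Pg Dg] : exists2 g, g \in P & g.1 = [set y; z].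
  have /fset0Pn[g] : P `\` [fset e; f] != fset0.
    rewrite -cardfs_gt0; have sub : [fset e; f] `<=` P.
      by apply/fsubsetP=> h; rewrite !inE => /orP[]/eqP->.
    by rewrite cardfsDS // cardfs2 nef subn_gt0.
  rewrite !inE negb_or => /andP[/andP[nge ngf] Pg]; exists g => //.
  case/or3P: (all3 g Pg) => /eqP Dg //.
    by case/eqP: nge; apply: simpleP; rewrite // De.
  by case/eqP: ngf; apply: simpleP; rewrite // Df.
apply/cycleP; exists 3, (nth x [:: x; y; z]), (nth e [:: e; g; f]).
have uvx : uniq [:: x; y; z] by rewrite /= !inE negb_or nxy nxz nyz.
have neg : e != g.
  apply: contraNneq nxz => Deg; have : x \in [set y; z] by rewrite -Dg -Deg.
  by rewrite !inE (negbTE nxy).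
have ngf : g != f.
  apply: contraNneq nxy => Deg; have : x \in [set y; z] by rewrite -Dg Deg.
  by rewrite !inE (negbTE nxz) orbF.
have ufx : uniq [:: e; g; f] by rewrite /= !inE negb_or neg nef ngf.
split=> //.
- by move=> i j lti ltj /eqP; rewrite nth_uniq // => /eqP.
- by move=> i j lti ltj /eqP; rewrite nth_uniq // => /eqP.
- move=> h; split=> [Ph|[[|[|[|i]]] // _ ->] //=].
  case/or3P: (all3 h Ph) => /eqP Dh.
  + by exists 0 => //=; apply: simpleP; rewrite // De.
  + by exists 2 => //=; apply: simpleP; rewrite // Df.
  + by exists 1 => //=; apply: simpleP; rewrite // Dg.
- by case=> [|[|[|i]]] //= _; rewrite ?De ?Df ?Dg // setUC.
Qed.

(** The edges that touch a component left by at most two vertices meet the other edges only in these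
    vertices, hence, by nonseparability, in exactly two. Each part has an edge with an end
    elsewhere, hence at least two edges, so this would be a splitting. *)
Lemma unsplittable_3connected : (3 < #|piece_support P|)%N ->
  simple_3connected (piece_mgraph P).
Proof.
move=> gt3; split.
- move=> e f /setP Def; apply: val_inj; apply: simpleP; try exact: fsvalP.
  apply/setP=> x; apply/idP/idP=> xe.
    have := Def (Sub x (in_support (fsvalP e) xe)).
    by rewrite !inE /= xe => /esym.
  have := Def (Sub x (in_support (fsvalP f) xe)).
  by rewrite !inE /= xe.
- by rewrite card_sig.
move=> S ltS; apply/negPn/negP=> nc.
have madj_sym : symmetric (@madj (piece_mgraph P)).
  by move=> x y; rewrite /madj eq_sym setUC.
have [K [K0 /properP[/subsetP KS [w Sw Kw]] _ clK]] := disconnected_component madj_sym nc.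
rewrite inE in Sw.
pose V := {x : G | x \in piece_support P}.
pose touches (e : tedge G) := [exists x : V, (x \in K) && (val x \in e.1)].
pose E1 : piece G := [fset e in P | touches e].
have E1P : E1 `<=` P by apply/fsubsetP=> g; rewrite !inE => /andP[].
have [PE E12] := rest E1P; set E2 := P `\` E1 in PE E12.
have close e (x y : V) : e \in P -> val x \in e.1 -> val y \in e.1 -> x \in K -> y \notin S -> y \in K.
  move=> Pe xe ye Kx Sy; have [<-//|nxy] := eqVneq x y.
  apply: (clK x y Kx); rewrite ?inE // /madj nxy; apply/existsP; exists [` Pe].
  rewrite eq_sym eqEcard; apply/andP; split.
    by rewrite subUset !sub1set !inE /= xe ye.
  rewrite cards2 nxy -(card2 Pe) -(card_imset _ val_inj); apply/subset_leq_card/subsetP.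
  by move=> _ /imsetP[z + ->]; rewrite inE.
have E1_neq0 : E1 != fset0.
  have [x Kx] := set0Pn _ K0; have /piece_supportP[e Pe xe] := valP x.
  by apply/fset0Pn; exists e; rewrite !inE Pe; apply/existsP; exists x; rewrite Kx.
have [e2 E2e we2] : exists2 e, e \in E2 & val w \in e.1.
  have /piece_supportP[e Pe we] := valP w; exists e => //.
  rewrite !inE Pe andbT /=; apply/existsP=> -[x /andP[Kx xe]].
  by rewrite (close e x w) in Kw.
have E2_neq0 : E2 != fset0 by apply/fset0Pn; exists e2.
have SV (x : G) : x \in piece_support E1 :&: piece_support E2 -> exists2 s : V, s \in S & val s = x.
  rewrite inE => /andP[/piece_supportP[e E1e xe] /piece_supportP[f E2f xf]].
  move: E1e E2f; rewrite !inE /= => /andP[Pe /existsP[t /andP[Kt te]]] /andP[Nf Pf].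
  rewrite Pf in Nf; have Sx := in_support Pf xf; exists (Sub x Sx) => //.
  apply: contraNT Nf => nSx; apply/existsP; exists (Sub x Sx); rewrite xf andbT.
  exact: (close e t).
have [x1 _ Ix1] := meet (val w) PE E12 E1_neq0 E2_neq0.
have [x2 nx21 Ix2] := meet x1 PE E12 E1_neq0 E2_neq0.
have [s1 Ss1 Ds1] := SV x1 Ix1; have [s2 Ss2 Ds2] := SV x2 Ix2.
have DS : S = [set s1; s2].
  apply/esym/eqP; rewrite eqEcard subUset !sub1set Ss1 Ss2 /= cards2.
  have -> : s1 != s2 by apply: contraNneq nx21 => Ds; rewrite -Ds1 -Ds2 Ds.
  by rewrite -ltnS.
have supp2 : piece_support E1 :&: piece_support E2 = [set x1; x2].
  apply/setP=> x; apply/idP/idP=> [/SV[s Ss <-]|].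
    by move: Ss; rewrite DS !inE -!val_eqE /= Ds1 Ds2.
  by rewrite in_set2 => /orP[]/eqP->.
have two (E : piece G) e u : e \in E -> E `<=` P -> u \in e.1 -> u \notin [set x1; x2] ->
    x1 \in piece_support E -> x2 \in piece_support E -> (1 < #|` E|)%N.
  move=> Ee EP ue nu sx1 sx2; rewrite ltnNge; apply: contra nu => le1.
  have DE : E = [fset e].
    apply/eqP; rewrite eq_sym eqEfcard cardfs1 le1 andbT.
    by apply/fsubsetP=> h; rewrite in_fset1 => /eqP->.
  rewrite DE !support1 in sx1 sx2.
  have -> : [set x1; x2] = e.1.
    apply/eqP; rewrite eqEcard subUset !sub1set sx1 sx2 cards2 [x1 == x2]eq_sym nx21.
    by rewrite card2 // (fsubsetP EP).
  by [].
case: (@unsplit E1 E2 x1 x2); split; last by rewrite eq_sym.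
move: Ix1 Ix2; rewrite !inE => /andP[x1E1 x1E2] /andP[x2E1 x2E2].
split=> //.
  have [x Kx] := set0Pn _ K0; have /piece_supportP[e Pe xe] := valP x.
  apply: (two E1 e (val x)) => //.
    by rewrite !inE Pe; apply/existsP; exists x; rewrite Kx.
  have := KS x Kx; rewrite inE DS !inE -Ds1 -Ds2 !val_eqE.
  by [].
apply: (two E2 e2 (val w)) => //; first exact: fsubsetDl.
by move: Sw; rewrite DS !inE -Ds1 -Ds2 !val_eqE.
Qed.

End Unsplittable.

Lemma unsplittable_atom N P : good_piece N P ->
  (forall E1 E2 a b, ~ split_piece P E1 E2 a b) -> atom P.
Proof.
move=> goodP unsplit.
case: (classic (exists e f, [/\ e \in P, f \in P, e != f & e.1 = f.1])) => [|simpleP].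
  case=> e [f [Pe Pf nef Def]]; constructor 2.
  exact: (unsplittable_parallel goodP unsplit Pe Pf nef Def).
have {}simpleP e f : e \in P -> f \in P -> e.1 = f.1 -> e = f.
  by move=> Pe Pf Def; apply/eqP/negPn/negP=> nef; case: simpleP; exists e, f.
have [le3|gt3] := leqP #|piece_support P| 3.
  by constructor 1; apply: unsplittable_triangle goodP simpleP le3.
by constructor 3; apply: unsplittable_3connected goodP unsplit simpleP gt3.
Qed.

(** Splitting as far as possible leaves only atoms, but two cycles or two multiedges may share a
    virtual edge. Their merge is again a cycle or a multiedge, and the number of pieces drops with
    each merge. *)
Lemma tutte_exists B : base_piece B -> exists D, tutte_decomposition B D.
Proof.
move=> baseB; have [D0 spl0 max0] := maximal_splitting baseB.
have [_ _ _ B0] := baseB; have [N ltN] := splitting_labels B0 spl0.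
have atoms0 P : P \in D0 -> atom P.
  move=> DP; have [goodP _] := splitting_good spl0 baseB ltN DP.
  by apply: (unsplittable_atom goodP) => E1 E2 a b; apply: max0.
have [n] := ubnP #|` D0|; elim: n D0 spl0 atoms0 {N ltN max0} => // n IHn D spl atoms ltD.
case: (classic (exists P Q e, [/\ P \in D, Q \in D, P != Q, e \in P & e \in Q] /\
    ((is_cycle (piece_mgraph P) /\ is_cycle (piece_mgraph Q)) \/
     (is_multiedge (piece_mgraph P) /\ is_multiedge (piece_mgraph Q))))) => [|canon]; last first.
  exists D; split=> // P Q e DP DQ nPQ Pe Qe.
  by split=> PQ; apply: canon; exists P, Q, e; split=> //; [left | right].
move=> [P [Q [e [[DP DQ nPQ Pe Qe] PQ]]]].
have [PQe suppPQ] := splitting_tree_like spl DP DQ nPQ Pe Qe.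
apply: (IHn (merge_pieces D P Q e)).
- exact: merge_splitting.
- move=> X; rewrite in_merge => /orP[/and3P[_ _ /atoms//]|/eqP->].
  case: PQ => -[aP aQ]; first by constructor 1; apply: is_cycle_merge.
  by constructor 2; apply: is_multiedge_merge.
have DQ' : Q \in D `\ P by rewrite !inE eq_sym nPQ.
have := cardfsD1 P D; have := cardfsD1 Q (D `\ P); rewrite DP DQ' => c1 c2.
have := cardfsUI (D `\ P `\ Q) [fset (P `|` Q) `\ e]; rewrite cardfs1 => c3.
rewrite /merge_pieces; move: ltD; rewrite c2 c1; move: c3.
move: (size _) (size _) (size _) => m1 m2 m3.
lia.
Qed.

End Existence.

(** * Degree counts *)

Section Degrees.
Variables (K T : finType) (h : rel K) (r : rel T).
Hypotheses (h_irr : irreflexive h) (r_sym : symmetric r).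

Definition nbrs (V : finType) (s : rel V) x := [set y | s x y].

Let out (A : {set T}) : {set T * T} :=
  [set p | [&& p.1 \in A, p.2 \notin A & r p.1 p.2]].

(** Grow a subset [B] of [A] vertex by vertex. A vertex [v] joined to [B] through [uv] adds at most
    [1 + w v] leaving edges and absorbs [uv], a net gain of [w v]; the constant 2 comes from the
    first vertex. *)
Lemma out_conn (w : T -> nat) (A : {set T}) :
  (forall z, #|nbrs r z| <= 2 + w z)%N -> connected_on r A -> A != set0 ->
  (#|out A| <= 2 + \sum_(x in A) w x)%N.
Proof.
move=> deg /connP cA /set0Pn[x0 Ax0].
pose good (B : {set T}) := [&& B \subset A, B != set0 & (#|out B| <= 2 + \sum_(x in B) w x)%N].
have good1 : good [set x0].
  apply/and3P; split; first by rewrite sub1set.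
    by apply/set0Pn; exists x0; rewrite inE.
  rewrite big_set1; apply: leq_trans (deg x0).
  rewrite -(card_imset (nbrs r x0) (f := pair x0)); last by move=> ? ? [].
  apply/subset_leq_card/subsetP=> -[u v]; rewrite !inE /= => /and3P[/eqP-> _ ruv].
  by apply/imsetP; exists v; rewrite ?inE.
have [B /maxsetP[/and3P[BA B0 outB] maxB] _] := maxset_exists good1.
have [<-//|nBA] := eqVneq B A.
have [y Ay By] : exists2 y, y \in A & y \notin B.
  by apply/subsetPn; apply: contra nBA => AB; rewrite eqEsubset BA.
have [x Bx] := set0Pn _ B0.
have [u [v [_ Av Bu Bv ruv]]] := cA B x y (subsetP BA x Bx) Ay Bx By.
suff goodB : good (v |: B) by case/negP: Bv; rewrite -(maxB _ goodB) ?setU11 ?subsetUr.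
apply/and3P; split; first by rewrite subUset sub1set Av.
  by apply/set0Pn; exists v; rewrite setU11.
rewrite big_setU1 //=.
have sub : out (v |: B) \subset (out B :\ (u, v)) :|: pair v @: (nbrs r v :\ u).
  apply/subsetP=> -[a b]; rewrite !inE /= => /and3P[/predU1P[->|Ba] nb rab]; last first.
    move: nb; rewrite negb_or => /andP[nbv Bb].
    by rewrite Ba Bb rab xpair_eqE (negbTE nbv) andbF.
  apply/orP; right; apply/imsetP; exists b => //; rewrite !inE rab andbT.
  by apply: contraNneq nb => ->; rewrite Bu orbT.
apply: leq_trans (subset_leq_card sub) _; apply: leq_trans (leq_card_setU _ _) _.
rewrite card_imset; last by move=> ? ? [].
have c1 := cardsD1 (u, v) (out B); rewrite !inE /= Bu Bv ruv /= in c1.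
have c2 := cardsD1 u (nbrs r v); rewrite !inE r_sym ruv /= in c2.
have arith (o d s d' : nat) : (1 + o <= 2 + s -> 1 + d <= 2 + d' -> o + d <= 2 + (d' + s))%N by lia.
have := deg v; move: outB; rewrite c1 c2; exact: arith.
Qed.

(** Distinct neighbours of [t] are reached by distinct edges leaving the branch set of [t], so the
    excess of [t] is at most the weight of its branch set; and branch sets are disjoint. *)
Lemma degree_sum (w : T -> nat) : (forall z, #|nbrs r z| <= 2 + w z)%N ->
  rminor h r -> (\sum_t (#|nbrs h t| - 2) <= \sum_z w z)%N.
Proof.
move=> deg [g [cg ag]].
have bound t : (#|nbrs h t| - 2 <= \sum_(z | g z == Some t) w z)%N.
  have [->|/set0Pn[y]] := eqVneq (nbrs h t) set0; first by rewrite cards0.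
  rewrite inE => /ag[z [_ [gz _ _]]].
  have := out_conn deg (cg t); rewrite -leq_subLR big_set => outle.
  apply: leq_trans (outle _); last by apply/set0Pn; exists z; rewrite inE gz.
  apply: leq_sub2r.
  apply: leq_trans (leq_imset_card (fun p : T * T => odflt t (g p.2)) _).
  apply/subset_leq_card/subsetP=> x; rewrite inE => /[dup] htx /ag[a [b [ga gb rab]]].
  apply/imsetP; exists (a, b); rewrite ?inE /= ?gb // ga eqxx rab andbT /=.
  by apply: contraTneq htx => -[->]; rewrite h_irr.
have le1 : (\sum_t (#|nbrs h t| - 2) <= \sum_t \sum_(z | g z == Some t) w z)%N.
  by apply: leq_sum => t _; apply: bound.
apply: leq_trans le1 _.
rewrite (exchange_big_dep xpredT) //=; apply: leq_sum => z _.
case: (g z) => [t|]; last by rewrite big_pred0.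
by rewrite (big_pred1 t) // => t'; rewrite (inj_eq Some_inj) eq_sym.
Qed.

End Degrees.

Lemma card_nbrs_ge (V : finType) (s : rel V) x (l : seq V) :
  uniq l -> all (s x) l -> (size l <= #|nbrs s x|)%N.
Proof.
move=> Ul /allP xl; rewrite -(card_uniqP Ul); apply/subset_leq_card/subsetP=> y.
by move/xl; rewrite inE.
Qed.

Definition o5 i (lti : (i < 5)%N) : K5_minus := Ordinal lti.
Definition o33 (b : bool) i (lti : (i < 3)%N) : K33_minus := (b, Ordinal lti).

Lemma sum_list (V : finType) (l : seq V) (F : V -> nat) :
  uniq l -> (\sum_(t <- l) F t <= \sum_t F t)%N.
Proof.
by move=> Ul; rewrite big_uniq //= [X in (_ <= X)%N](bigID (mem l)) /= leq_addr.
Qed.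

(** Three vertices of degree 4 contribute 2 each and two vertices of degree 3 contribute 1 each. *)
Lemma K5_degree_sum : (8 <= \sum_(t : K5_minus) (#|nbrs (@adj K5_minus) t| - 2))%N.
Proof.
pose p0 := @o5 0 isT; pose p1 := @o5 1 isT; pose p2 := @o5 2 isT.
pose p3 := @o5 3 isT; pose p4 := @o5 4 isT.
have d0 : (3 <= #|nbrs (@adj K5_minus) p0|)%N.
  by apply: (card_nbrs_ge (l := [:: p1; p2; p3])); rewrite ?(eq_all (K5_adjE _)).
have d4 : (3 <= #|nbrs (@adj K5_minus) p4|)%N.
  by apply: (card_nbrs_ge (l := [:: p1; p2; p3])); rewrite ?(eq_all (K5_adjE _)).
have d1 : (4 <= #|nbrs (@adj K5_minus) p1|)%N.
  by apply: (card_nbrs_ge (l := [:: p0; p2; p3; p4])); rewrite ?(eq_all (K5_adjE _)).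
have d2 : (4 <= #|nbrs (@adj K5_minus) p2|)%N.
  by apply: (card_nbrs_ge (l := [:: p0; p1; p3; p4])); rewrite ?(eq_all (K5_adjE _)).
have d3 : (4 <= #|nbrs (@adj K5_minus) p3|)%N.
  by apply: (card_nbrs_ge (l := [:: p0; p1; p2; p4])); rewrite ?(eq_all (K5_adjE _)).
apply: leq_trans (sum_list (l := [:: p0; p1; p2; p3; p4]) _ isT).
rewrite !big_cons big_nil.
move: d0 d1 d2 d3 d4.
move: #|_| #|_| #|_| #|_| #|_| => ? ? ? ? ?; lia.
Qed.

(** The four vertices off the deleted edge have degree 3, the other two have degree 2. *)
Lemma K33_degree_sum : (4 <= \sum_(t : K33_minus) (#|nbrs (@adj K33_minus) t| - 2))%N.
Proof.
have d b i (lti : (i < 3)%N) : (0 < i)%N -> (3 <= #|nbrs (@adj K33_minus) (o33 b lti)|)%N.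
  move=> i_gt0; apply: (card_nbrs_ge (l := [:: @o33 (~~ b) 0 isT; @o33 (~~ b) 1 isT; @o33 (~~ b) 2 isT])).
    by case: b.
  by rewrite (eq_all (K33_adjE _)) /= i_gt0; case: b.
apply: leq_trans (sum_list (l := [:: @o33 false 1 isT; @o33 false 2 isT; @o33 true 1 isT; @o33 true 2 isT]) _ isT).
rewrite !big_cons big_nil.
move: (d false 1 isT isT) (d false 2 isT isT) (d true 1 isT isT) (d true 2 isT isT).
move: #|_| #|_| #|_| #|_| => ? ? ? ?; lia.
Qed.

Definition cubic_vertex (h : sgraph) : Prop :=
  forall s : option h, exists t : h, Some t != s /\
    (3 <= #|nbrs (fun x y => [&& adj x y, Some x != s & Some y != s]) t|)%N.

Lemma K5_cubic_vertex : cubic_vertex K5_minus.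
Proof.
pose p1 := @o5 1 isT; pose p2 := @o5 2 isT.
have main s t : Some t != s -> (0 < val t < 4)%N ->
    (3 <= #|nbrs (fun x y => [&& @adj K5_minus x y, Some x != s & Some y != s]) t|)%N.
  move=> ts /andP[t_gt0 t_lt4].
  have -> : nbrs (fun x y => [&& @adj K5_minus x y, Some x != s & Some y != s]) t =
      [set~ t] :\: [set y | Some y == s].
    apply/setP=> y; rewrite !inE ts K5_adjE t_gt0 t_lt4 /= andbT andbC.
    by rewrite [t == y]eq_sym.
  have c4 : #|[set~ t]| = 4 by rewrite cardsC1 card_ord.
  have le1 : (#|[set y : K5_minus | Some y == s]| <= 1)%N.
    case: s {ts} => [s|]; last first.
      by rewrite (_ : [set y | _] = set0) ?cards0 //; apply/setP=> y; rewrite !inE.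
    have sub : [set y : K5_minus | Some y == Some s] \subset [set s].
      by apply/subsetP=> y; rewrite !inE => /eqP[->].
    by have := subset_leq_card sub; rewrite cards1.
  rewrite cardsD c4; have := subset_leq_card (subsetIr [set~ t] [set y | Some y == s]).
  by move: le1; move: #|_| #|_| => ? ?; lia.
move=> s; have [Ds|ns] := eqVneq (Some p1) s; last by exists p1; split; last exact: main.
have n2 : Some p2 != s by rewrite -Ds.
by exists p2; split; last exact: main.
Qed.

Lemma K33_cubic_vertex : cubic_vertex K33_minus.
Proof.
have main b s i (lti : (i < 3)%N) : Some (o33 b lti) != s -> (0 < i)%N ->
    (forall j (ltj : (j < 3)%N), Some (o33 (~~ b) ltj) != s) ->
    (3 <= #|nbrs (fun x y => [&& @adj K33_minus x y, Some x != s & Some y != s]) (o33 b lti)|)%N.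
  move=> ns i_gt0 others.
  apply: (card_nbrs_ge (l := [:: @o33 (~~ b) 0 isT; @o33 (~~ b) 1 isT; @o33 (~~ b) 2 isT])).
    by case: (b).
  rewrite (eq_all (a2 := fun y : K33_minus => [&& (b != y.1) && ((0 < i) || (0 < y.2)), true & Some y != s]%N)).
    by rewrite /= i_gt0 !others; case: (b).
  by move=> y; rewrite K33_adjE ns.
have side (b : bool) (s : option K33_minus) : (forall j (ltj : (j < 3)%N), Some (o33 (~~ b) ltj) != s) ->
    exists t, Some t != s /\
    (3 <= #|nbrs (fun x y => [&& @adj K33_minus x y, Some x != s & Some y != s]) t|)%N.
  move=> others; have [Ds|ns] := eqVneq (Some (@o33 b 1 isT)) s; last first.
    by exists (@o33 b 1 isT); split; last exact: main.
  have n2 : Some (@o33 b 2 isT) != s.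
    by rewrite -Ds (inj_eq Some_inj) /o33 xpair_eqE andbF.
  by exists (@o33 b 2 isT); split; last exact: main.
case=> [[b j]|]; last by apply: (side true) => j ltj.
by apply: (side b) => i lti; rewrite (inj_eq Some_inj) /o33 xpair_eqE; case: (b).
Qed.

(** The whole branch set of [c] is discarded, which costs at most one vertex [s] of [H]. What is
    left has maximum degree 2, so [degree_sum] with weight 0 contradicts the vertex of degree 3. *)
Lemma hub_no_rminor (H : sgraph) (T : finType) (r : rel T) (c : T) :
  cubic_vertex H -> symmetric r ->
  (forall z, z != c -> #|nbrs r z :\ c| <= 2)%N -> ~ rminor (@adj H) r.
Proof.
move=> H3 r_sym deg [g [cg ag]]; pose s := g c.
pose h' x y := [&& @adj H x y, Some x != s & Some y != s].
pose r' x y := [&& r x y, x != c & y != c].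
have r'_sym : symmetric r' by move=> x y; rewrite /r' r_sym [(x != c) && _]andbC.
have h'_irr : irreflexive h' by move=> x; rewrite /h' adj_irrefl.
have nc x z : Some x != s -> g z = Some x -> z != c.
  by move=> xs gz; apply: contraNneq xs => Dz; rewrite -gz Dz.
have Hr' : rminor h' r'.
  exists (fun z => if g z == s then None else g z); split=> [x|x y /and3P[xy xs ys]].
    have [Dx|xs] := eqVneq (Some x) s.
      suff -> : [set z | (if g z == s then None else g z) == Some x] = set0 by apply: conn0.
      by apply/setP=> z; rewrite !inE; case: (g z =P s) => // nzs; rewrite Dx; apply/eqP.
    have -> : [set z | (if g z == s then None else g z) == Some x] = [set z | g z == Some x].
      apply/setP=> z; rewrite !inE; case: (g z =P s) => // gzs.
      by apply/esym/negbTE; rewrite gzs eq_sym.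
    apply: sub_conn (cg x) => u v; rewrite !inE /r' => /eqP gu /eqP gv ->.
    by rewrite (nc x u xs gu) (nc x v xs gv).
  have [z [w [gz gw rzw]]] := ag x y xy; exists z, w.
  by rewrite gz gw (negbTE xs) (negbTE ys) /r' rzw (nc x z xs gz) (nc y w ys gw).
have degr' z : (#|nbrs r' z| <= 2 + 0)%N.
  have [->|nzc] := eqVneq z c.
    rewrite (_ : nbrs r' c = set0) ?cards0 //.
    by apply/setP=> y; rewrite !inE /r' eqxx andbF.
  rewrite addn0; apply: leq_trans (deg z nzc); apply/subset_leq_card/subsetP=> y.
  by rewrite !inE => /and3P[-> _ ->].
have [t [_ t3]] := H3 s.
have := degree_sum h'_irr r'_sym degr' Hr'; rewrite sum_nat_const muln0 (bigD1 t) //=.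
have -> : nbrs h' t = nbrs (fun x y => [&& adj x y, Some x != s & Some y != s]) t by [].
by move: t3; case: #|_| => [|[|[|?]]].
Qed.

(** Serves for multiedges, whose hat has all its edges at two vertices. Discarding the branch sets
    of [a] and [b] leaves no edge, yet [H] keeps at least two vertices, and these are connected; at
    most three vertices [s], [t], [c] are ever removed, whence the bound on the size of [H]. *)
Lemma cover2_no_rminor (H : sgraph) (T : finType) (r : rel T) (a b : T) :
  nearly_3connected H -> (4 < #|H|)%N ->
  (forall x y, r x y -> (x \in [:: a; b]) || (y \in [:: a; b])) ->
  ~ rminor (@adj H) r.
Proof.
move=> H3 cH cover [g [cg ag]].
have noedge (Z : pred H) : (forall x, ~~ Z x -> Some x != g a /\ Some x != g b) ->
    (forall x y, ~~ Z x -> ~~ Z y -> x = y) \/ ~ conn_off Z.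
  move=> ZN; case: (pickP (fun p : H * H => [&& ~~ Z p.1, ~~ Z p.2 & p.1 != p.2])) => [[x y]|Zeq].
    case/and3P=> Zx Zy nxy; right=> cZ; have := cZ (pred1 x) _ x y Zx Zy.
    rewrite /= eqxx eq_sym (negbTE nxy) => eqP1.
    suff: true = false by []; apply: eqP1 => u v Zu Zv /ag[z [w [gz gw /cover]]].
    rewrite !inE; have [ua ub] := ZN u Zu; have [va vb] := ZN v Zv.
    by case/orP=> /orP[]/eqP D; move: ua ub va vb; rewrite -?gz -?gw D eqxx.
  left=> x y Zx Zy; apply/eqP/negPn/negP=> nxy.
  by have := Zeq (x, y); rewrite /= Zx Zy nxy.
have few (l : seq H) : (size l <= 3)%N -> (forall x y, x \notin l -> y \notin l -> x = y) -> False.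
  move=> sl eql; have c2 : (1 < #|[predC l]|)%N.
    have := cardC (mem l); have := card_size l.
    by move: cH sl; move: (size l) #|_| #|_| #|_| => ? ? ? ?; lia.
  have /card_gt1P[x [y [lx ly]]] := c2; case/eqP; apply: eql; [exact: lx | exact: ly].
have [cZ|[s [t [c [ga gb _ _ [_ _ cZ]]]]]] := H3.2 (g a) (g b).
  have [|eqZ|//] := noedge (fun x => (Some x == g a) || (Some x == g b)).
    by move=> x; rewrite negb_or => /andP.
  apply: (few (pmap id [:: g a; g b])).
    by rewrite size_pmap; apply: leq_trans (count_size _ _) _.
  have memp x : x \notin pmap id [:: g a; g b] -> ~~ ((Some x == g a) || (Some x == g b)).
    by rewrite mem_pmap map_id !inE.
  by move=> x y /memp Zx /memp Zy; apply: eqZ.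
have [|eqZ|//] := noedge (fun x => x \in [:: s; t; c]).
  move=> x; rewrite !inE !negb_or ga gb !(inj_eq Some_inj) => /and3P[-> ->].
  by [].
exact: (few [:: s; t; c]).
Qed.

(** * Dropping an edge of a triangle *)

Section Triangle.
Variables (H : sgraph) (T : finType) (r : rel T).
Hypothesis triangle_free : forall x y z : H, ~~ [&& adj x y, adj y z & adj x z].
Hypothesis r_sym : symmetric r.

Definition remove_edge x y : rel T := fun u v => r u v && ([set u; v] != [set x; y]).

Lemma remove_edge_sym x y : symmetric (remove_edge x y).
Proof. by move=> u v; rewrite /remove_edge r_sym setUC. Qed.

(** The edge [xy] is dispensable: inside one bag a common neighbour replaces it, between two bags
    another edge does. *)
Let keep (g : T -> option H) x y : Prop := forall u v, g x = Some u -> g y = Some v ->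
  if u == v then exists z, [/\ z != x, z != y, g z = Some u & r x z && r z y]
  else adj u v -> exists z w, [/\ g z = Some u, g w = Some v, r z w & [set z; w] != [set x; y]].

Let keep_rminor g x y : x != y ->
  (forall t, connected_on r [set z | g z == Some t]) ->
  (forall s t, adj s t -> exists z w, [/\ g z = Some s, g w = Some t & r z w]) ->
  keep g x y -> rminor (@adj H) (remove_edge x y).
Proof.
move=> nxy cg ag kp; exists g; split=> [t|s t st].
  apply/connP=> A a b Ba Bb Aa Ab; have /connP/(_ A a b Ba Bb Aa Ab) := cg t.
  move=> [u [v [Bu Bv Au Av ruv]]].
  case: (eqVneq [set u; v] [set x; y]) => [Duv|nuv]; last first.
    by exists u, v; split; rewrite // /remove_edge ruv.
  have [gx gy] : g x = Some t /\ g y = Some t.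
    move/eqP: Duv; rewrite set2_eq; move: Bu Bv; rewrite !inE => /eqP gu /eqP gv.
    by case/orP=> /andP[/eqP<- /eqP<-].
  have := kp t t gx gy; rewrite eqxx => -[z [zx zy gz /andP[rxz rzy]]].
  have Bz : z \in [set z | g z == Some t] by rewrite inE gz.
  have [zu zv] : remove_edge x y u z /\ remove_edge x y z v.
    have xz : [set x; z] != [set x; y] by rewrite set2_eq (negbTE zx) (negbTE zy) !andbF.
    have yz : [set y; z] != [set x; y] by rewrite set2_eq (negbTE zx) (negbTE zy) !andbF.
    move/eqP: Duv; rewrite /remove_edge set2_eq => /orP[]/andP[/eqP-> /eqP->].
      by rewrite rxz rzy xz setUC yz.
    by rewrite [r y z]r_sym [r z x]r_sym rxz rzy yz setUC xz.
  by have [Az|Az] := boolP (z \in A); [exists z, v | exists u, z].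
have [z [w [gz gw rzw]]] := ag s t st.
case: (eqVneq [set z; w] [set x; y]) => [Dzw|nzw]; last first.
  by exists z, w; split; rewrite // /remove_edge rzw.
have nst : s != t by apply: contraTneq st => ->; rewrite adj_irrefl.
move/eqP: Dzw; rewrite set2_eq => /orP[]/andP[/eqP Dz /eqP Dw].
  rewrite Dz in gz; rewrite Dw in gw; have := kp s t gz gw; rewrite (negbTE nst).
  by case=> // z' [w' [gz' gw' rzw' nzw']]; exists z', w'; split; rewrite // /remove_edge rzw'.
rewrite Dz in gz; rewrite Dw in gw; have := kp t s gw gz; rewrite eq_sym (negbTE nst).
rewrite adj_sym => /(_ st)[z' [w' [gz' gw' rzw' nzw']]].
by exists w', z'; split; rewrite // remove_edge_sym /remove_edge rzw'.
Qed.

(** A corner in no bag makes its edges dispensable. Two corners in one bag make some edge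
    dispensable, through the third corner or through a second edge to its bag. Corners in three
    different bags cannot be pairwise adjacent in [H], so one of the edges realises nothing. *)
Lemma triangle_rminor (t1 t2 t3 : T) : uniq [:: t1; t2; t3] ->
  r t1 t2 -> r t2 t3 -> r t1 t3 -> rminor (@adj H) r ->
  [\/ rminor (@adj H) (remove_edge t1 t2), rminor (@adj H) (remove_edge t2 t3)
    | rminor (@adj H) (remove_edge t1 t3)].
Proof.
rewrite /= !inE negb_or andbT => /andP[/andP[n12 n13] n23] r12 r23 r13 [g [cg ag]].
have kp12 := keep_rminor n12 cg ag; have kp23 := keep_rminor n23 cg ag.
have kp13 := keep_rminor n13 cg ag.
have [r21 r32 r31] : [/\ r t2 t1, r t3 t2 & r t3 t1] by rewrite r_sym r12 r_sym r23 r_sym r13.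
case g1: (g t1) => [c1|]; last by constructor 1; apply: kp12 => u v; rewrite g1.
case g2: (g t2) => [c2|]; last by constructor 1; apply: kp12 => u v; rewrite g2.
case g3: (g t3) => [c3|]; last by constructor 2; apply: kp23 => u v; rewrite g3.
have [D12|d12] := eqVneq c1 c2.
  constructor 3; apply: kp13 => u v; rewrite g1 g3 => -[<-] [<-].
  case: eqP => [_|_ _].
    by exists t2; rewrite eq_sym n12 n23 g2 D12 r12 r23.
  exists t2, t3; split; rewrite ?g2 ?D12 // set2_eq negb_or !negb_and.
  by rewrite eq_sym n12 n23.
have [D23|d23] := eqVneq c2 c3.
  constructor 1; apply: kp12 => u v; rewrite g1 g2 => -[<-] [<-].
  rewrite (negbTE d12) => _; exists t1, t3; split; rewrite ?g3 ?D23 //.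
  by rewrite set2_eq negb_or !negb_and [t3 == t2]eq_sym n23 n12 orbT.
have [D13|d13] := eqVneq c1 c3.
  constructor 2; apply: kp23 => u v; rewrite g2 g3 => -[<-] [<-].
  rewrite (negbTE d23) => _; exists t2, t1; split; rewrite ?g1 ?D13 //.
  by rewrite set2_eq negb_or !negb_and n13 n23 orbT.
have := triangle_free c1 c2 c3; rewrite !negb_and => /or3P[] /negP na.
- by constructor 1; apply: kp12 => u v; rewrite g1 g2 => -[<-] [<-]; rewrite (negbTE d12).
- by constructor 2; apply: kp23 => u v; rewrite g2 g3 => -[<-] [<-]; rewrite (negbTE d23).
- by constructor 3; apply: kp13 => u v; rewrite g1 g3 => -[<-] [<-]; rewrite (negbTE d13).
Qed.

Lemma remove_edge_degree (w : T -> nat) x y : x != y -> r x y ->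
  (0 < w x)%N -> (0 < w y)%N -> (forall z, #|nbrs r z| <= 2 + w z)%N ->
  let w' z := (w z - (z \in [:: x; y]))%N in
  (forall z, #|nbrs (remove_edge x y) z| <= 2 + w' z)%N /\
  (\sum_z w' z + 2 = \sum_z w z)%N.
Proof.
move=> nxy rxy wx wy deg w'; split=> [z|].
  have sub : nbrs (remove_edge x y) z \subset nbrs r z by apply/subsetP=> u; rewrite !inE => /andP[].
  rewrite /w' !inE; have := deg z.
  have drop u v : z = u -> r u v -> [set u; v] == [set x; y] -> (#|nbrs (remove_edge x y) z| < #|nbrs r z|)%N.
    move=> -> ruv Duv; apply/proper_card/properP; split.
      by apply/subsetP=> t; rewrite !inE => /andP[].
    by exists v; rewrite !inE // /remove_edge Duv andbF.
  have [Dz|_] := eqVneq z x.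
    have := drop x y Dz rxy (eqxx _); rewrite Dz /=.
    by move: #|_| #|_| wx => ? ? ?; lia.
  have [Dz|_] := eqVneq z y.
    have ryx : r y x by rewrite r_sym.
    have := drop y x Dz ryx; rewrite setUC eqxx Dz => /(_ isT) /=.
    by move: #|_| #|_| wy => ? ? ?; lia.
  by rewrite subn0; apply: leq_trans; apply: subset_leq_card.
rewrite (bigD1 x) //= (bigD1 y) /=; last by rewrite eq_sym.
rewrite [RHS](bigD1 x) //= [X in _ = (_ + X)%N](bigD1 y) /=; last by rewrite eq_sym.
rewrite /w' !inE !eqxx orbT /=.
rewrite (eq_bigr w) => [|z /andP[zx zy]]; last by rewrite !inE (negbTE zx) (negbTE zy) subn0.
by move: (\sum_(_ | _) _)%N => ?; lia.
Qed.

End Triangle.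

Lemma K33_triangle_free (x y z : K33_minus) : ~~ [&& adj x y, adj y z & adj x z].
Proof.
rewrite !K33_adjE; apply/negP=> /and3P[/andP[+ _] /andP[+ _] /andP[+ _]].
by case: (x.1) (y.1) (z.1) => [] [] [].
Qed.

Lemma card_le_rel (T T' : finType) (A : {set T}) (B : {set T'}) (Q : T -> T' -> Prop) :
  (forall w, w \in A -> exists2 e, e \in B & Q w e) ->
  (forall w w' e, Q w e -> Q w' e -> w = w') -> (#|A| <= #|B|)%N.
Proof.
move=> AB inj_Q; have /fin_all_exists[f fE] (w : {w | w \in A}) : exists e, e \in B /\ Q (val w) e.
  by have [e Be Qe] := AB _ (valP w); exists e.
have inj_f : injective f.
  move=> w w' ff; apply/val_inj/(inj_Q _ _ (f w)); first by case: (fE w).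
  by rewrite ff; case: (fE w').
have <- : #|f @: [set: {w | w \in A}]| = #|A|.
  by rewrite (card_imset _ inj_f) cardsT card_sig; apply: eq_card.
apply/subset_leq_card/subsetP=> _ /imsetP[w _ ->].
by case: (fE w).
Qed.

(** * Degrees in a subdivided piece *)

Definition edges_at (M : mgraph) (x : mvertex M) := [set e : medge M | x \in ends e].

Section Degrees.
Local Open Scope fset_scope.
Variables (G : sgraph) (N : nat) (C : piece G).
Hypothesis wfC : wf_piece N C.
Local Notation V := {x : G | x \in piece_support C}.
Implicit Types (x y : V).

Let nbr_edge (x : G) (w : G + 'I_N) (e : C) : Prop :=
  match w with
  | inl y => val e = ([set x; y], None)
  | inr k => (val e).2 = Some (val k)
  end.

Let nbr_edge_inj (x : G) w w' e : nbr_edge x w e -> nbr_edge x w' e -> w = w'.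
Proof.
case: w w' => [y|k] [z|l] /= De.
- rewrite De => -[] /eqP; rewrite set2_eq eqxx /= => /orP[/eqP->//|].
  by move=> /andP[/eqP<- /eqP->].
- by rewrite De.
- by move=> De'; rewrite De' in De.
- by rewrite De => -[] /val_inj->.
Qed.

Let nbr_edgeP x w : w \in nbrs (@hat G N C) (inl (val x)) ->
  exists2 e : medge (piece_mgraph C), e \in edges_at (x : mvertex (piece_mgraph C)) & nbr_edge (val x) w e.
Proof.
rewrite inE; case: w => [y|k] /=.
  by move=> Cxy; exists [` Cxy]; rewrite // ?inE /= ?inE ?eqxx.
by case/existsP=> A /andP[xA CA]; exists [` CA]; rewrite // ?inE.
Qed.

Lemma hat_degree x :
  (#|nbrs (@hat G N C) (inl (val x))| <= #|edges_at (x : mvertex (piece_mgraph C))|)%N.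
Proof. exact: card_le_rel (@nbr_edgeP x) (@nbr_edge_inj (val x)). Qed.

Lemma hat_degree_minus x y :
  hat C (inl (val x)) (inl (val y) : G + 'I_N) ->
  (#|nbrs (@hat G N C) (inl (val x)) :\ inl (val y)| <= #|edges_at (x : mvertex (piece_mgraph C))|.-1)%N.
Proof.
move=> /= Cxy; have := cardsD1 [` Cxy] (edges_at (x : mvertex (piece_mgraph C))).
rewrite !inE /= eqxx /= add1n => ->.
apply: (card_le_rel (Q := nbr_edge (val x))); last exact: nbr_edge_inj.
move=> w; rewrite in_setD1 => /andP[nwy /nbr_edgeP[e xe Qe]]; exists e => //.
rewrite in_setD1 xe andbT; apply: contra_neq nwy => De.
by apply: (nbr_edge_inj Qe); rewrite De.
Qed.

Lemma hat_label_degree (k : 'I_N) : (#|nbrs (@hat G N C) (inr k)| <= 2)%N.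
Proof.
have [card2 lab _] := wfC.
have [->|/set0Pn[w]] := eqVneq (nbrs (@hat G N C) (inr k)) set0; first by rewrite cards0.
rewrite inE; case: w => [x|//] /existsP[A /andP[_ CA]].
rewrite -(card2 _ CA) /= -(card_imset (mem A) (@inl_inj G 'I_N)).
apply/subset_leq_card/subsetP=> -[y|l]; rewrite inE //= => /existsP[A' /andP[yA' CA']].
by rewrite imset_f //= (lab _ _ _ CA CA').
Qed.

Lemma hat_isolated (x : G) : x \notin piece_support C -> nbrs (@hat G N C) (inl x) = set0.
Proof.
move=> Nx; apply/setP=> w; rewrite !inE; apply: contraNF Nx => /hat_in_support.
by rewrite inE.
Qed.

Variables (M : mgraph) (ok : pred (medge M)).
Variables (f : V -> mvertex M) (g : C -> medge M).
Hypotheses (bij_f : bijective f) (bij_g : bijective g).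
Hypothesis gE : forall e : medge (piece_mgraph C), ends (g e) = f @: ends e.
Hypothesis g_ok : forall e, @virtual G C e -> ok (g e).

Lemma copy_degree x : (#|edges_at (x : mvertex (piece_mgraph C))| <= #|edges_at (f x)|)%N.
Proof.
rewrite -(card_imset _ (bij_inj bij_g)); apply/subset_leq_card/subsetP=> _ /imsetP[e + ->].
by rewrite inE => xe; rewrite inE gE imset_f.
Qed.

(** An edge of the standard graph that may not be virtual is the image of an edge of G, which [hat]
    does not subdivide. *)
Lemma copy_real x y e' : ~~ ok e' -> ends e' = [set f x; f y] ->
  hat C (inl (val x)) (inl (val y) : G + 'I_N).
Proof.
have [g' gK g'K] := bij_g; rewrite -[e']g'K; set e : medge (piece_mgraph C) := g' e'.
move=> nok; rewrite gE => De; have e_real : (val e).2 = None.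
  by apply/eqP; apply: contraNT nok; apply: g_ok.
have ends_e : ends e = [set x; y].
  by apply: (imset_inj (bij_inj bij_f)); rewrite De imsetU1 imset_set1.
have [card2 _ _] := wfC; have := fsvalP e; rewrite [fsval e]surjective_pairing e_real.
suff -> : (fsval e).1 = [set val x; val y] by [].
apply/setP=> z; rewrite !inE; apply/idP/idP=> [ze|].
  have Sz : z \in piece_support C by apply: in_support (fsvalP e) ze.
  have : Sub z Sz \in ends e by rewrite inE.
  by rewrite ends_e !inE -!val_eqE.
have xy_e t : t \in ends e -> val t \in (fsval e).1 by rewrite inE.
by case/orP=> /eqP->; apply: xy_e; rewrite ends_e !inE eqxx ?orbT.
Qed.

End Degrees.

Definition FP_rel (T : finType) (r : rel T) : Prop :=
  ~ rminor (@adj K5_minus) r /\ ~ rminor (@adj K33_minus) r.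

Lemma cycle_edges_at n (j : 'I_n) : (#|@edges_at (cycle_mgraph n) j| <= 2)%N.
Proof.
have sub : @edges_at (cycle_mgraph n) j \subset [set j; ord_pred j].
  apply/subsetP=> i; rewrite !inE => /orP[/eqP->|/eqP->]; first by rewrite eqxx.
  by rewrite ordSK eqxx orbT.
by apply: leq_trans (subset_leq_card sub) _; rewrite cards2; case: (_ != _).
Qed.

Lemma wheel_edges_at k (j : 'I_k) : (#|@edges_at (wheel k) (Some j)| <= 3)%N.
Proof.
have sub : @edges_at (wheel k) (Some j) \subset [set inl j; inl (ord_pred j); inr j].
  apply/subsetP=> -[i|i]; rewrite !inE ?(inj_eq Some_inj).
    by case/orP=> /eqP->; rewrite ?ordSK eqxx ?orbT.
  by case/orP=> // /eqP[->]; rewrite eqxx !orbT.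
apply: leq_trans (subset_leq_card sub) _; rewrite -setUA cardsU1 cards2.
by case: (_ \notin _); case: (_ != _).
Qed.

Lemma hub_edges_at k : (#|@edges_at (wheel k) None| <= k)%N.
Proof.
have sub : @edges_at (wheel k) None \subset inr @: [set: 'I_k].
  by apply/subsetP=> -[i|i]; rewrite !inE //= => _; rewrite imset_f.
apply: leq_trans (subset_leq_card sub) _; apply: leq_trans (leq_imset_card _ _) _.
by rewrite cardsT card_ord.
Qed.

Lemma co_cycle6_nbrs (v : 'I_6) : (#|nbrs (@co_cycle_adj 6) v| <= 3)%N.
Proof.
rewrite /nbrs -sum1dep_card big_mkcond !big_ord_recl big_ord0.
by case: v => [[|[|[|[|[|[|]]]]]]].
Qed.

Lemma prism_edges_at (v : co_cycle 6) : (#|@edges_at prism v| <= 3)%N.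
Proof.
apply: leq_trans (co_cycle6_nbrs v).
apply: (card_le_rel (Q := fun (A : medge prism) u => val A = [set v; u])).
  move=> [A EA]; have /imsetP[[x y]] := EA; rewrite inE /= => xy DA.
  rewrite inE /= [in X in X -> _]DA !inE => /orP[]/eqP->.
    by exists y; rewrite ?inE.
  by exists x; rewrite ?inE 1?setUC // -[co_cycle_adj _ _]/(@adj (co_cycle 6) _ _) adj_sym.
by move=> A A' u EA EA'; apply: val_inj; rewrite EA.
Qed.

(** * The four types contain neither forbidden graph *)

Section TypedNotBad.
Local Open Scope fset_scope.
Variables (G : sgraph) (N : nat) (C : piece G).
Hypothesis wfC : wf_piece N C.
Local Notation V := {x : G | x \in piece_support C}.
Local Notation r := (@hat G N C).

Lemma type0_FP : type0 C -> FP_rel r.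
Proof.
move=> [n lt2n [[f [g [bij_f bij_g gE _]]]|copy]].
  have deg z : (#|nbrs r z| <= 2 + 0)%N.
    case: z => [x|k]; last exact: hat_label_degree.
    have [Sx|/hat_isolated->] := boolP (x \in piece_support C); last by rewrite cards0.
    rewrite addn0; apply: leq_trans (hat_degree N (Sub x Sx : V)) _.
    by apply: leq_trans (copy_degree bij_g gE _) _; apply: cycle_edges_at.
  split=> /(degree_sum (@adj_irrefl _) (@hat_sym _ _ _) deg); rewrite sum_nat_const muln0.
    by move/(leq_trans K5_degree_sum).
  by move/(leq_trans K33_degree_sum).
have /multiedgeP[_ [a [b [nab Cab]]]] : is_multiedge (piece_mgraph C).
  by exists n => //; case: copy => f [g [? ? ? _]]; exists f, g; split.
have cover x y : r x y -> (x \in [:: inl a; inl b]) || (y \in [:: inl a; inl b]).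
  have inab (x' : G) : x' \in [set a; b] -> (inl x' : G + 'I_N) \in [:: inl a; inl b].
    by rewrite !inE => /orP[]/eqP->; rewrite eqxx ?orbT.
  case: x y => [x|k] [y|l] //=.
  - by move/Cab => /= Dxy; rewrite inab // -Dxy !inE eqxx.
  - by case/existsP=> A /andP[xA /Cab /= DA]; rewrite inab // -DA.
  - by case/existsP=> A /andP[xA /Cab /= DA]; rewrite inab ?orbT // -DA.
split; apply: cover2_no_rminor cover.
- exact: K5_nearly_3connected.
- by rewrite card_ord.
- exact: K33_nearly_3connected.
- by rewrite card_prod card_bool card_ord.
Qed.

Lemma type2_FP : type2 C -> FP_rel r.
Proof.
move=> [k lt2k [f [g [bij_f bij_g gE g_ok]]]].
have [f' fK f'K] := bij_f; pose c : V := f' None.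
have deg z : z != inl (val c) -> (#|nbrs r z :\ inl (val c)| <= 2)%N.
  case: z => [x|l] nz; last first.
    by apply: leq_trans (hat_label_degree wfC l); rewrite subset_leq_card ?subD1set.
  have [Sx|/hat_isolated->] := boolP (x \in piece_support C); last by rewrite set0D cards0.
  pose x' : V := Sub x Sx; have Dx : x = val x' by [].
  have nxc : x' != c by apply: contra_neq nz => Dc; rewrite -Dc.
  case Dj: (f x') => [j|]; last first.
    by rewrite -(inj_eq (bij_inj bij_f)) Dj f'K eqxx in nxc.
  (* The spoke at [x'] is real, so without the hub only the two rim edges at [x'] count. *)
  have rxc : r (inl (val x')) (inl (val c)).
    apply: (copy_real wfC bij_f bij_g gE g_ok (e' := inr j)) => //=.
    by rewrite Dj f'K setUC.
  have := hat_degree_minus rxc; rewrite Dx => /leq_trans; apply.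
  have := leq_trans (copy_degree bij_g gE x') (_ : _ <= 3)%N; rewrite Dj => /(_ (wheel_edges_at j)).
  by case: #|_|.
split; apply: hub_no_rminor deg; try exact: hat_sym.
  exact: K5_cubic_vertex.
exact: K33_cubic_vertex.
Qed.

(* The weight 1 on each vertex of degree 3 bounds the cycle rank available to a
   minor; a triangle wastes one edge since K33_minus is triangle-free. *)
Let w0 (z : G + 'I_N) : nat := if z is inl x then x \in piece_support C else 0%N.

Let sum_w0 : (\sum_z w0 z = #|piece_support C|)%N.
Proof.
rewrite big_sumType /= [X in (_ + X)%N]big1 // addn0.
by rewrite -sum1_card [RHS]big_mkcond /=; apply: eq_bigr => x _; case: (_ \in _).
Qed.

Let deg_w0 : (forall x : V, #|edges_at (x : mvertex (piece_mgraph C))| <= 3)%N ->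
  forall z, (#|nbrs r z| <= 2 + w0 z)%N.
Proof.
move=> deg3 [x|k]; last exact: leq_trans (hat_label_degree wfC k) _.
have [Sx|/hat_isolated->] := boolP (x \in piece_support C); last by rewrite cards0.
by rewrite /w0 Sx; apply: leq_trans (hat_degree N (Sub x Sx : V)) (deg3 _).
Qed.

Let K5_no_cubic : (forall z, #|nbrs r z| <= 2 + w0 z)%N ->
  (#|piece_support C| < 8)%N -> ~ rminor (@adj K5_minus) r.
Proof.
move=> deg ltC /(degree_sum (@adj_irrefl _) (@hat_sym _ _ _) deg).
by rewrite sum_w0 leqNgt (leq_trans ltC K5_degree_sum).
Qed.

Lemma card_copy (M : mgraph) (f : V -> mvertex M) :
  bijective f -> #|piece_support C| = #|mvertex M|.
Proof. by move/bij_eq_card <-; rewrite card_sig. Qed.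

(** The new weight [w'] agrees with [w] off the triangle, so that the step can be repeated on a
    second, disjoint triangle. *)
Lemma remove_triangle (s : rel (G + 'I_N)) (w : G + 'I_N -> nat) t1 t2 t3 :
  symmetric s -> (forall z, #|nbrs s z| <= 2 + w z)%N -> uniq [:: t1; t2; t3] ->
  s t1 t2 -> s t2 t3 -> s t1 t3 -> (0 < w t1)%N -> (0 < w t2)%N -> (0 < w t3)%N ->
  rminor (@adj K33_minus) s ->
  exists x y, [/\ x \in [:: t1; t2; t3], y \in [:: t1; t2; t3] &
    exists w' : G + 'I_N -> nat, [/\ forall z, (#|nbrs (remove_edge s x y) z| <= 2 + w' z)%N,
      (\sum_z w' z + 2 = \sum_z w z)%N, forall z, z \notin [:: t1; t2; t3] -> w' z = w z &
      rminor (@adj K33_minus) (remove_edge s x y)]].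
Proof.
move=> s_sym deg U s12 s23 s13 w1 w2 w3 Hs.
have := U; rewrite /= !inE negb_or andbT => /andP[/andP[n12 n13] n23].
have finish x y : x \in [:: t1; t2; t3] -> y \in [:: t1; t2; t3] -> x != y -> s x y ->
    (0 < w x)%N -> (0 < w y)%N -> rminor (@adj K33_minus) (remove_edge s x y) ->
    exists x y, [/\ x \in [:: t1; t2; t3], y \in [:: t1; t2; t3] &
    exists w' : G + 'I_N -> nat, [/\ forall z, (#|nbrs (remove_edge s x y) z| <= 2 + w' z)%N,
      (\sum_z w' z + 2 = \sum_z w z)%N, forall z, z \notin [:: t1; t2; t3] -> w' z = w z &
      rminor (@adj K33_minus) (remove_edge s x y)]].
  move=> tx ty nxy sxy wx wy Hxy; exists x, y; split=> //.
  have [deg' sum'] := remove_edge_degree s_sym nxy sxy wx wy deg.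
  exists (fun z => w z - (z \in [:: x; y]))%N; split=> // z tz.
  suff -> : (z \in [:: x; y]) = false by rewrite subn0.
  rewrite inE mem_seq1; apply: contraNF tz => /orP[]/eqP->; [exact: tx | exact: ty].
have [m1 m2 m3] : [/\ t1 \in [:: t1; t2; t3], t2 \in [:: t1; t2; t3] & t3 \in [:: t1; t2; t3]].
  by rewrite !inE !eqxx !orbT.
by have [] := triangle_rminor K33_triangle_free s_sym U s12 s23 s13 Hs; apply: finish.
Qed.

Let w0V (x : V) : (0 < w0 (inl (val x)))%N.
Proof. by rewrite /w0 (valP x). Qed.

Let inlV (x y : V) : (inl (val x) == inl (val y) :> G + 'I_N) = (x == y).
Proof. by rewrite (inj_eq inl_inj) val_eqE. Qed.

Lemma type1_FP : type1 C -> FP_rel r.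
Proof.
move=> [f [g [bij_f bij_g gE g_ok]]]; have [f' fK f'K] := bij_f.
have cC : #|piece_support C| = 4 by rewrite (card_copy bij_f) card_option card_ord.
have deg : forall z, (#|nbrs r z| <= 2 + w0 z)%N.
  apply: deg_w0 => x; apply: leq_trans (copy_degree bij_g gE x) _.
  by case: (f x) => [j|]; [apply: wheel_edges_at | apply: hub_edges_at].
split; first by apply: K5_no_cubic deg _; rewrite cC.
move=> H33; pose v (i : 'I_3) : V := f' (Some i).
have rv i : r (inl (val (v i))) (inl (val (v (ordS i)))).
  by apply: (copy_real wfC bij_f bij_g gE g_ok (e' := inl i)) => //=; rewrite !f'K.
pose i0 : 'I_3 := inord 0; pose i1 : 'I_3 := inord 1; pose i2 : 'I_3 := inord 2.
have [S0 S1 S2] : [/\ ordS i0 = i1, ordS i1 = i2 & ordS i2 = i0].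
  by split; apply: val_inj; rewrite /= !inordK.
have r01 := rv i0; rewrite S0 in r01; have r12 := rv i1; rewrite S1 in r12.
have r20 := rv i2; rewrite S2 hat_sym in r20.
have inj_v : injective v by move=> i j /(can_inj f'K) [].
have U : uniq [:: inl (val (v i0)); inl (val (v i1)); inl (val (v i2)) : G + 'I_N].
  by rewrite /= !inE !inlV !(inj_eq inj_v) -!val_eqE /= !inordK.
(* The rim triangle is real. Dropping one of its edges lowers the total excess of K4 from 4 to 2,
   below the 4 of [K33_minus]. *)
have [x [y [_ _ [w' [deg' sum' _ H']]]]] :=
  remove_triangle (@hat_sym _ _ _) deg U r01 r12 r20 (w0V _) (w0V _) (w0V _) H33.
have := degree_sum (@adj_irrefl _) (remove_edge_sym (@hat_sym _ _ _) x y) deg' H'.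
move/(leq_trans K33_degree_sum); move: sum'; rewrite sum_w0 cC.
by move: (\sum_z _)%N => ?; lia.
Qed.

(** The two triangles of the prism are real and disjoint; one edge of each is dropped, and the
    excess falls from 6 to 2, below the 4 of [K33_minus]. The 8 of [K5_minus] exceeds 6 from the
    start. *)
Lemma type3_FP : type3 C -> FP_rel r.
Proof.
move=> [f [g [bij_f bij_g gE g_ok]]]; have [f' fK f'K] := bij_f.
have cC : #|piece_support C| = 6 by rewrite (card_copy bij_f) card_ord.
have deg : forall z, (#|nbrs r z| <= 2 + w0 z)%N.
  apply: deg_w0 => x; apply: leq_trans (copy_degree bij_g gE x) _.
  exact: prism_edges_at.
split; first by apply: K5_no_cubic deg _; rewrite cC.
move=> H33; pose v (i : 'I_6) : V := f' i.
have rv (i j k : 'I_6) : co_cycle_adj i j -> co_cycle_adj i k -> co_cycle_adj j k ->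
    r (inl (val (v i))) (inl (val (v j))).
  move=> ij ik jk; have E : [set i; j] \in edge_set (co_cycle 6).
    by apply/imsetP; exists (i, j); rewrite ?inE.
  apply: (copy_real (ok := fun e : medge prism => ~~ in_triangle e)
    wfC bij_f bij_g gE g_ok (e' := Sub [set i; j] E)); last by rewrite /= !f'K.
  rewrite negbK; apply/existsP; exists k; apply/forall_inP=> x.
  by rewrite !inE => /orP[]/eqP->.
have inj_v : injective v by apply: can_inj f'K.
pose o i (lti : (i < 6)%N) : 'I_6 := Ordinal lti.
pose i0 := @o 0 isT; pose i1 := @o 1 isT; pose i2 := @o 2 isT.
pose i3 := @o 3 isT; pose i4 := @o 4 isT; pose i5 := @o 5 isT.
have U : uniq [seq inl (val (v i)) : G + 'I_N | i <- [:: i0; i2; i4; i1; i3; i5]].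
  by rewrite map_inj_uniq // => i j [] /val_inj/inj_v.
have /= := U; have U1 : uniq [seq inl (val (v i)) : G + 'I_N | i <- [:: i0; i2; i4]].
  by move: U; rewrite -[[:: i0; i2; i4; i1; i3; i5]]/([:: i0; i2; i4] ++ _) map_cat cat_uniq => /andP[].
have [U2 U12] : uniq [seq inl (val (v i)) : G + 'I_N | i <- [:: i1; i3; i5]] /\
    ~~ has (mem [seq inl (val (v i)) : G + 'I_N | i <- [:: i0; i2; i4]])
       [seq inl (val (v i)) : G + 'I_N | i <- [:: i1; i3; i5]].
  by move: U; rewrite -[[:: i0; i2; i4; i1; i3; i5]]/([:: i0; i2; i4] ++ _) map_cat cat_uniq => /and3P[].
move=> _.
have [x [y [tx ty [w' [deg' sum' w'E H']]]]] :=
  remove_triangle (@hat_sym _ _ _) deg U1 (rv i0 i2 i4 isT isT isT) (rv i2 i4 i0 isT isT isT)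
    (rv i0 i4 i2 isT isT isT) (w0V _) (w0V _) (w0V _) H33.
have off i : i \in [:: i1; i3; i5] -> inl (val (v i)) \notin [seq inl (val (v i)) : G + 'I_N | i <- [:: i0; i2; i4]].
  by move=> ti; apply: (hasPn U12); apply: map_f.
have w'V i : i \in [:: i1; i3; i5] -> (0 < w' (inl (val (v i))))%N.
  by move=> ti; rewrite w'E ?w0V //; apply: off.
(* The edge dropped first has both ends in the even triangle, so the odd one is intact. *)
have r'v i j k : i \in [:: i1; i3; i5] -> co_cycle_adj i j -> co_cycle_adj i k -> co_cycle_adj j k ->
    remove_edge r x y (inl (val (v i))) (inl (val (v j))).
  move=> ti ij ik jk; rewrite /remove_edge (rv i j k) //= set2_eq.
  apply: contra (off i ti) => /orP[]/andP[/eqP-> _]; [exact: tx | exact: ty].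
have [x' [y' [_ _ [w'' [deg'' sum'' _ H'']]]]] :=
  remove_triangle (remove_edge_sym (@hat_sym _ _ _) x y) deg' U2
    (r'v i1 i3 i5 isT isT isT isT) (r'v i3 i5 i1 isT isT isT isT)
    (r'v i1 i5 i3 isT isT isT isT) (w'V i1 isT) (w'V i3 isT) (w'V i5 isT) H'.
have := degree_sum (@adj_irrefl _) (remove_edge_sym (remove_edge_sym (@hat_sym _ _ _) x y) x' y') deg'' H''.
move/(leq_trans K33_degree_sum); move: sum' sum''; rewrite sum_w0 cC.
by move: (\sum_z _)%N (\sum_z _)%N => ? ?; lia.
Qed.

Lemma typed_FP : [\/ type0 C, type1 C, type2 C | type3 C] -> FP_rel r.
Proof. by case; [apply: type0_FP | apply: type1_FP | apply: type2_FP | apply: type3_FP]. Qed.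

End TypedNotBad.

(** * Induced nonseparating cycles *)

Section Models.
Variables (T : finType) (r : rel T).
Implicit Types A B : {set T}.

Definition touches A B := [exists x in A, exists y in B, r x y].

Lemma touchesP A B : reflect (exists x y, [/\ x \in A, y \in B & r x y]) (touches A B).
Proof.
apply: (iffP exists_inP) => [[x Ax /exists_inP[y By rxy]]|[x [y [Ax By rxy]]]].
  by exists x, y.
by exists x => //; apply/exists_inP; exists y.
Qed.

Lemma touchesC A B : symmetric r -> touches A B = touches B A.
Proof.
by move=> r_sym; apply/touchesP/touchesP=> -[x [y [? ? ?]]]; exists y, x; rewrite r_sym.
Qed.

Lemma bags_rminor (K : finType) (h : rel K) (F : K -> {set T}) :
  (forall x, connected_on r (F x)) ->
  (forall x y, x != y -> [disjoint F x & F y]) ->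
  (forall x y, h x y -> touches (F x) (F y)) -> rminor h r.
Proof.
move=> cF dF tF; pose g z := [pick x | z \in F x].
have gE x z : z \in F x -> g z = Some x.
  move=> Fz; rewrite /g; case: pickP => [y Fy|/(_ x)]; last by rewrite Fz.
  by apply/eqP; rewrite (inj_eq Some_inj); apply: contraTT Fy => /dF/disjointFl->.
exists g; split=> [x|x y /tF/touchesP[z [w [Fz Fw rzw]]]].
  suff -> : [set z | g z == Some x] = F x by [].
  apply/setP=> z; rewrite inE; apply/eqP/idP=> [|/gE//].
  by rewrite /g; case: pickP => // y Fy [<-].
by exists z, w; rewrite (gE x) ?(gE y).
Qed.

Definition disjoint_list (l : seq {set T}) := pairwise (fun A B : {set T} => [disjoint A & B]) l.

Lemma disjoint_nth l i j : disjoint_list l -> i != j -> (i < size l)%N -> (j < size l)%N ->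
  [disjoint nth set0 l i & nth set0 l j].
Proof.
move=> /(pairwiseP set0) dl; rewrite neq_ltn => /orP[ltij|ltji] lti ltj; first exact: dl.
by rewrite disjoint_sym; apply: dl.
Qed.

(** [A0] and [B0] stand for the ends of the deleted edge, so no contact is asked between them. *)
Lemma K33_model A0 A1 A2 B0 B1 B2 : symmetric r ->
  disjoint_list [:: A0; A1; A2; B0; B1; B2] ->
  all (connected_on r) [:: A0; A1; A2; B0; B1; B2] ->
  [/\ touches A0 B1, touches A0 B2, touches A1 B0, touches A2 B0 &
    [/\ touches A1 B1, touches A1 B2, touches A2 B1 & touches A2 B2]] ->
  rminor (@adj K33_minus) r.
Proof.
move=> r_sym dl /allP cl [t01 t02 t10 t20 [t11 t12 t21 t22]].
pose F (x : K33_minus) := nth set0 [:: A0; A1; A2; B0; B1; B2] (x.1 * 3 + x.2)%N.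
have lt6 (x : K33_minus) : (x.1 * 3 + x.2 < 6)%N by case: x => [[] i] /=; have := ltn_ord i; lia.
apply: (bags_rminor (F := F)) => [x|x y nxy|x y].
- by apply/cl/mem_nth/lt6.
- apply: disjoint_nth dl _ (lt6 x) (lt6 y); apply: contra nxy.
  case: x y => [b i] [b' j]; rewrite xpair_eqE -val_eqE /=.
  by have := ltn_ord i; have := ltn_ord j; case: b b' => [] []; lia.
rewrite K33_adjE; case: x y => [[] [[|[|[|i]]] lti]] [[] [[|[|[|j]]] ltj]] //= _;
  by rewrite // touchesC.
Qed.

(** [A0] and [A4] stand for the ends of the deleted edge. *)
Lemma K5_model A0 A1 A2 A3 A4 : symmetric r ->
  disjoint_list [:: A0; A1; A2; A3; A4] ->
  all (connected_on r) [:: A0; A1; A2; A3; A4] ->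
  [/\ touches A1 A2, touches A1 A3 & touches A2 A3] ->
  [/\ touches A0 A1, touches A0 A2 & touches A0 A3] ->
  [/\ touches A4 A1, touches A4 A2 & touches A4 A3] ->
  rminor (@adj K5_minus) r.
Proof.
move=> r_sym dl /allP cl [t12 t13 t23] [t01 t02 t03] [t41 t42 t43].
pose F (x : K5_minus) := nth set0 [:: A0; A1; A2; A3; A4] x.
apply: (bags_rminor (F := F)) => [x|x y nxy|x y].
- by apply/cl/mem_nth/ltn_ord.
- exact: disjoint_nth dl nxy (ltn_ord x) (ltn_ord y).
rewrite K5_adjE; case: x y => [[|[|[|[|[|i]]]]] lti] [[|[|[|[|[|j]]]]] ltj] //= _;
  by rewrite // touchesC.
Qed.

End Models.

Lemma ltn_add_bools (b1 b2 : bool) m : (2 < b1 + (b2 + m) -> 0 < m)%N.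
Proof. by case: b1 b2 m => [] [] []. Qed.

(** * Peripheral cycles through an edge *)

Section ThreeConnected.
Variables (V : finType) (e : rel V).
Hypotheses (e_sym : symmetric e) (e_irr : irreflexive e).
Hypothesis V_gt3 : (3 < #|V|)%N.
Hypothesis conn3 : forall S : {set V}, (#|S| < 3)%N -> connected_on e (~: S).
Implicit Types (A Z D X Y S : {set V}) (c p q : seq V).

Lemma sep3 A Z x y : (#|Z| < 3)%N -> x \in A -> x \notin Z -> y \notin A -> y \notin Z ->
  exists u v, [/\ u \in A, u \notin Z, v \notin A, v \notin Z & e u v].
Proof.
move=> ltZ Ax Zx Ay Zy; have /connP/(_ A x y) := conn3 ltZ; rewrite !inE.
by case=> // u [v []]; rewrite !inE => *; exists u, v.
Qed.

Lemma ltV_notin (l : seq V) : (size l < #|V|)%N -> exists x, x \notin l.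
Proof.
move=> lt; have := cardC (mem l); have := card_size l => le1 eq1.
have : (0 < #|[predC l]|)%N by move: eq1 le1 lt; move: (size l) #|_| #|_| #|_| => ? ? ? ?; lia.
by case/card_gt0P=> x; exists x.
Qed.

Lemma degree3 x : (2 < #|[set y | e x y]|)%N.
Proof.
rewrite ltnNge; apply/negP=> le2; set Z := [set y | e x y] in le2.
have Zx : x \notin Z by rewrite inE e_irr.
have [y] : exists y, y \notin x :: enum Z.
  by apply: ltV_notin; rewrite /= -cardE (leq_trans _ V_gt3).
rewrite inE negb_or mem_enum => /andP[nyx Zy].
have [|u [v [/set1P-> _ _ Zv euv]]] := @sep3 [set x] Z x y le2 (set11 x) Zx _ Zy.
  by rewrite inE.
by rewrite inE euv in Zv.
Qed.

(** The peripheral cycles of Tutte. For an induced cycle the last clause is a consequence of minimum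
    degree 3; it is recorded for later use. *)
Definition peripheral c : Prop :=
  [/\ uniq c, (2 < size c)%N, cycle e c,
      {in c &, forall x y, e x y -> y = next c x \/ x = next c y} &
      connected_on e (~: [set x in c]) /\
      forall x, x \in c -> exists2 y, y \notin c & e x y].

Let avoid (u v : V) D : rel V :=
  fun x y => [&& x \notin D, y \notin D, e x y & [set x; y] != [set u; v]].

Let avoid_sym u v D : symmetric (avoid u v D).
Proof. by move=> x y; rewrite /avoid e_sym setUC andbCA. Qed.

(** To be applied to the neighbours of a connected set along a path: that set then bypasses the
    middle one, having neighbours before and after it. *)
Lemma middle_of_three (s : seq V) (N : {set V}) : uniq s -> (2 < #|N|)%N -> {subset N <= s} ->
  exists s1 t s2, [/\ s = s1 ++ t :: s2, t \in N, has (mem N) s1 & has (mem N) s2].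
Proof.
move=> Us ltN Ns.
have first_in (q : seq V) (M : {set V}) : (0 < #|M|)%N -> {subset M <= q} ->
    exists q1 x q2, [/\ q = q1 ++ x :: q2, x \in M & {subset M :\ x <= q2}].
  move=> /card_gt0P[z Mz] Mq; have hasM : has (mem M) q by apply/hasP; exists z; rewrite ?Mq.
  case/split_find: hasM Mq => x q1 q2 Mx nM Mq; exists q1, x, q2; rewrite cat_rcons.
  split=> // y; rewrite !inE => /andP[nyx My].
  have := Mq y My; rewrite mem_cat mem_rcons inE (negbTE nyx) /= => /orP[q1y|//].
  by case/hasP: nM; exists y.
have [s1 [x [s2 [Ds Nx N2]]]] := first_in s N (ltn_trans (isT : 0 < 2)%N ltN) Ns.
have c1 : (1 < #|N :\ x|)%N by rewrite (cardsD1 x) Nx in ltN.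
have [s3 [t [s4 [Ds2 Nt N4]]]] := first_in s2 (N :\ x) (ltnW c1) N2.
have c2 : (0 < #|N :\ x :\ t|)%N by rewrite (cardsD1 t) Nt in c1.
exists (s1 ++ x :: s3), t, s4; split.
- by rewrite Ds Ds2 -catA.
- by move: Nt; rewrite inE => /andP[].
- by rewrite has_cat /= Nx orbT.
have /card_gt0P[y Ny] := c2; apply/hasP; exists y; first exact: N4.
by move: Ny; rewrite !inE => /and3P[].
Qed.

(* Take D connected, containing w and maximal such that u and v stay joined
   outside D without the edge uv: the complement of D is the cycle. *)
Lemma peripheral_cycle u v w : e u v -> w != u -> w != v ->
  exists c, [/\ peripheral c, u \in c, v \in c & w \notin c].
Proof.
move=> euv nwu nwv; have nuv : u != v by apply: contraTneq euv => ->; rewrite e_irr.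
pose Q D := [&& w \in D, u \notin D, v \notin D, connected_on e D & connect (avoid u v D) u v].
(* If [v] were not reached, the set [U] reached from [u] would be separated from [v] by [w] and [u],
   or, when [U] is just [u], from any further vertex by [w] and [v]. *)
have Q1 : Q [set w].
  rewrite /Q !inE eqxx ![_ == w]eq_sym nwu nwv conn1 /=.
  pose U := [set x | connect (avoid u v [set w]) u x].
  suff : v \in U by rewrite inE.
  apply: contraT => Uv; have Uu : u \in U by rewrite inE.
  have Uw : w \notin U.
    rewrite inE; apply/connectP=> -[p]; elim/last_ind: p => [|p z _] /=.
      by move=> _ Dw; rewrite Dw eqxx in nwu.
    rewrite rcons_path last_rcons => /andP[_ /and4P[_ + _ _]] Dw.
    by rewrite -Dw inE eqxx.
  have step x y : x \in U -> y != w -> e x y -> [set x; y] != [set u; v] -> y \in U.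
    move=> Ux nyw exy nxy; have nxw : x != w by apply: contraNneq Uw => <-.
    rewrite !inE in Ux *; apply: connect_trans Ux (connect1 _).
    by rewrite /avoid !inE nyw exy nxy nxw.
  case: (pickP (fun x => (x \in U) && (x != u))) => [x /andP[Ux nxu]|Uu1].
    have [|||||a [b [Ua +]]] := @sep3 U [set w; u] x v.
    - by rewrite cards2; case: (_ != _).
    - by [].
    - by rewrite !inE negb_or nxu andbT; apply: contraNneq Uw => <-.
    - by [].
    - by rewrite !inE negb_or ![v == _]eq_sym nwv nuv.
    rewrite !in_set2 !negb_or => /andP[_ nau] Ub /andP[nbw nbu] eab; case/negP: Ub.
    apply: (step a b) => //; rewrite set2_eq (negbTE nau) /=.
    by apply/negP=> /andP[_ Dbu]; rewrite Dbu in nbu.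
  have [y] : exists y, y \notin [:: u; v; w] by apply: ltV_notin.
  rewrite !inE !negb_or => /and3P[nyu nyv nyw].
  have [|||||a [b [Ua _ Ub +]]] := @sep3 U [set w; v] u y.
  - by rewrite cards2; case: (_ != _).
  - by [].
  - by rewrite !inE negb_or ![u == _]eq_sym nwu eq_sym nuv.
  - by apply/negP=> Uy; have := Uu1 y; rewrite /= Uy nyu.
  - by rewrite !inE negb_or nyw.
  rewrite !in_set2 !negb_or => /andP[nbw nbv] eab; case/negP: Ub.
  have Da : a = u by apply/eqP/negPn/negP=> nau; have := Uu1 a; rewrite /= Ua nau.
  apply: (step a b) => //; rewrite set2_eq Da eqxx (negbTE nbv) /=.
  by rewrite (negbTE nuv).
have [D /maxsetP[/and5P[Dw Du Dv cD uvD] maxD] _] := maxset_exists Q1.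
have grow t d : t \notin D -> t != u -> t != v -> d \in D -> e d t ->
    connect (avoid u v (t |: D)) u v -> False.
  move=> Dt ntu ntv Dd edt uvt; case/negP: (Dt).
  have cDt : connected_on e (t |: D).
    by rewrite setUC; apply: (connU e_sym cD (conn1 e t) Dd (set11 t)); rewrite edt orbT.
  have QD : Q (t |: D).
    by rewrite /Q cDt uvt !inE Dw orbT ![_ == t]eq_sym !negb_or ntu ntv Du Dv.
  by rewrite -(maxD _ QD) ?setU11 ?subsetUr.
have [p0 p0P Dp0] := connectP uvD; move: Dp0.
have [p pP Up _ Dv'] := shortenP p0P.
have notD z : z \in u :: p -> z \notin D.
  rewrite inE => /predU1P[->//|].
  have qD q a : path (avoid u v D) a q -> z \in q -> z \notin D.
    elim: q a => //= y q IHq a /andP[/and4P[_ Dy _ _] qP].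
    by rewrite inE => /predU1P[->//|]; apply: IHq qP.
  exact: qD pP.
set s := u :: p in notD Up.
have sv : v \in s by rewrite Dv' mem_last.
have su : u \in s by rewrite inE eqxx.
have conn_seq t a (q : seq V) b : path (avoid u v D) a q -> t \notin a :: q -> b \in a :: q ->
    connect (avoid u v (t |: D)) a b.
  move=> qP qt; apply: path_connect; elim: q a qP qt => //= c q IHq a /andP[ac qP].
  rewrite !inE !negb_or => /and3P[nta ntc qt]; apply/andP; split; last first.
    by apply: IHq; rewrite // inE negb_or ntc.
  move: ac; rewrite /avoid !inE !negb_or => /and4P[-> -> -> ->].
  by rewrite ![_ == t]eq_sym nta ntc.
have ends s1 t s2 : s = s1 ++ t :: s2 -> s1 != [::] -> s2 != [::] ->
    [/\ t != u, t != v, u \in s1, v \in s2 & (t \notin s1) && (t \notin s2)].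
  move=> Ds s1n s2n; move: Up; rewrite Ds cat_uniq /= negb_or => /and3P[_ /andP[s1t _] /andP[s2t _]].
  have s1u : u \in s1 by case: s1 Ds s1n {s1t} => // u' s1 [<- _] _; rewrite inE eqxx.
  have s2v : v \in s2.
    have -> : v = last t s2 by rewrite Dv' -(last_cons u u p) -/s Ds last_cat.
    by case: s2 {Ds s2t} s2n => //= h s2 _; apply: mem_last.
  split=> //; last by rewrite s1t.
    by apply: contraNneq s1t => ->.
  by apply: contraNneq s2t => ->.
have reach s1 s2 t x y : s = s1 ++ t :: s2 -> x \in s1 -> y \in s2 ->
    connect (avoid u v (t |: D)) x y -> connect (avoid u v (t |: D)) u v.
  move=> Ds s1x s2y xy; have [||_ _ _ s2v /andP[s1t s2t]] := ends s1 t s2 Ds.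
  - by apply: contraTneq s1x => ->.
  - by apply: contraTneq s2y => ->.
  case: s1 Ds s1x s1t => [//|u' s1] [Du' Dp]; rewrite -{u'}Du' => s1x s1t.
  move: pP; rewrite Dp cat_path => /andP[s1P /andP[_ s2P]].
  apply: connect_trans (conn_seq t u s1 x s1P s1t s1x) _; apply: connect_trans xy _.
  case: s2 s2v s2y s2t s2P {Dp} => [//|h s2] s2v s2y s2t /= /andP[_ s2P].
  apply: connect_trans (conn_seq t h s2 v s2P s2t s2v).
  by rewrite (sym_connect_sym (avoid_sym u v (t |: D))); apply: (conn_seq t h s2 y s2P s2t s2y).
pose border t := [exists d in D, e d t].
have border_in t : t \notin D -> border t -> t \in s.
  move=> Dt /exists_inP[d Dd edt]; apply: contraT => st.
  case: (grow t d Dt _ _ Dd edt); try by apply: contraNneq st => ->.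
  exact: conn_seq pP st sv.
(* Hence the path cannot be rerouted around a vertex [t] adjacent to [D]. *)
have no_bypass s1 s2 t x y : s = s1 ++ t :: s2 -> border t -> x \in s1 -> y \in s2 ->
    connect (avoid u v (t |: D)) x y -> False.
  move=> Ds /exists_inP[d Dd edt] s1x s2y xy; have [||ntu ntv _ _ _] := ends s1 t s2 Ds.
  - by apply: contraTneq s1x => ->.
  - by apply: contraTneq s2y => ->.
  apply: (grow t d _ ntu ntv Dd edt); last exact: reach Ds s1x s2y xy.
  by apply: notD; rewrite Ds mem_cat inE eqxx orbT.
pose T := [set t | (t \notin D) && [|| t == u, t == v | border t]].
have Ts t : t \in T -> t \in s.
  by rewrite inE => /andP[Dt /or3P[/eqP->//|/eqP->//|]]; apply: border_in.
(* A component [W] of the vertices outside [D] and [T] is not adjacent to [D] and has at least three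
   neighbours, all in [T] and thus on the path; it would bypass a middle one. So the path covers the
   complement of [D]. *)
have allT z : z \notin D -> z \in T.
  move=> Dz; apply: contraT => Tz; pose S0 := ~: (D :|: T).
  have S0z : z \in S0 by rewrite in_setC in_setU negb_or Dz.
  have [W [Wz /subsetP WS cW clW]] := component e_sym S0z.
  have WN x : x \in W -> x \notin D /\ x \notin T.
    by move/WS; rewrite in_setC in_setU negb_or => /andP[].
  pose N := [set t in T | [exists x in W, e x t]].
  have ltN : (2 < #|N|)%N.
    rewrite ltnNge; apply/negP=> leN; have [Dz' Tz'] := WN z Wz.
    have [|||a [b [Wa Na Wb Nb eab]]] := @sep3 W N z w leN Wz.
    - by rewrite in_set (negbTE Tz').
    - by apply/negP=> /WN[]; rewrite Dw.
    - by rewrite in_set in_set Dw.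
    have [Da Ta] := WN a Wa; have [Db|Db] := boolP (b \in D).
      case/negP: Ta; rewrite in_set Da /=; apply/or3P; constructor 3.
      by apply/exists_inP; exists b; rewrite // e_sym.
    have [Tb|Tb] := boolP (b \in T).
      by case/negP: Nb; rewrite in_set Tb /=; apply/exists_inP; exists a.
    by case/negP: Wb; apply: clW Wa _ eab; rewrite in_setC in_setU negb_or Db.
  have Ns t : t \in N -> t \in s by rewrite in_set => /andP[/Ts].
  have [s1 [t [s2 [Ds Nt /hasP[x1 s1x1 Nx1] /hasP[x3 s2x3 Nx3]]]]] := middle_of_three Up ltN Ns.
  have [||ntu ntv s1u s2v /andP[s1t s2t]] := ends s1 t s2 Ds.
  - by apply: contraTneq s1x1 => ->.
  - by apply: contraTneq s2x3 => ->.
  have Bt : border t.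
    by move: Nt; rewrite !in_set (negbTE ntu) (negbTE ntv) => /andP[/andP[]].
  have Tt : t \in T by move: Nt; rewrite in_set => /andP[].
  exfalso; apply: (no_bypass s1 s2 t x1 x3 Ds Bt s1x1 s2x3).
  have avW a b : a \in W -> b != t -> b \notin D -> e a b -> avoid u v (t |: D) a b.
    move=> Wa nbt Db eab; have [Da Ta] := WN a Wa.
    rewrite /avoid !inE !negb_or Da Db nbt eab set2_eq /=.
    have -> : a != t by apply: contraNneq Ta => ->.
    have nau : a != u by apply: contraNneq Ta => ->; rewrite in_set Du eqxx.
    have nav : a != v by apply: contraNneq Ta => ->; rewrite in_set Dv eqxx orbT.
    by rewrite (negbTE nau) (negbTE nav).
  have avN x : x \in N -> x != t -> exists2 a, a \in W & avoid u v (t |: D) a x.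
    move=> Nx nxt; have Dx := notD x (Ns x Nx); move: Nx; rewrite in_set => /andP[_ /exists_inP[a Wa eax]].
    by exists a => //; apply: avW.
  have [||a Wa ax1] := avN x1; first exact: Nx1.
    by apply: contraNneq s1t => <-.
  have [||b Wb bx3] := avN x3; first exact: Nx3.
    by apply: contraNneq s2t => <-.
  rewrite avoid_sym in ax1; apply: connect_trans (connect1 ax1) _.
  apply: connect_trans (connect1 bx3).
  have := forall_inP (forall_inP cW a Wa) b Wb; apply: connect_sub => c d /and3P[Wc Wd ecd].
  have [Dd Td] := WN d Wd; apply/connect1/avW => //.
  by apply: contraNneq Td => ->.
have sD : ~: [set x in s] = D.
  apply/setP=> x; rewrite !inE -/s; apply/idP/idP=> [sx|Dx].
    by apply: contraR sx => /allT/Ts.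
  by apply/negP=> /notD; rewrite Dx.
have lt2s : (2 < size s)%N.
  rewrite /s /=; case: p pP Dv' {Up su sv s notD ends reach border_in no_bypass Ts allT sD conn_seq T} => [|y [|? ?]] //=.
    by move=> _ Dvu; rewrite Dvu eqxx in nuv.
  by rewrite andbT => /and4P[_ _ _ +] Dvy; rewrite -Dvy eqxx.
have cyc : cycle e s.
  rewrite /s /= rcons_path -Dv' e_sym euv andbT.
  by apply: sub_path pP => x y /and4P[].
have order x y : x \in s -> y \in s -> x != y ->
    exists s1 s2 s3, s = s1 ++ x :: s2 ++ y :: s3 \/ s = s1 ++ y :: s2 ++ x :: s3.
  move=> sx + nxy; case/splitPr: sx => s1 s2; rewrite mem_cat inE eq_sym (negbTE nxy) /=.
  case/orP=> /splitPr[q1 q2]; last by exists s1, q1, q2; left.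
  by exists q1, q2, s2; right; rewrite -catA.
have nextE s1 x y s3 : s = s1 ++ x :: y :: s3 -> next s x = y.
  move=> Ds; have sx : x \in s by rewrite Ds mem_cat inE eqxx orbT.
  rewrite next_nth sx /s -/s.
  have -> : index x s = size s1.
    move: Up; rewrite Ds cat_uniq => /and3P[_ + _] /=; rewrite negb_or => /andP[s1x _].
    by rewrite index_cat (negbTE s1x) /= eqxx addn0.
  have <- : nth u s (size s1).+1 = nth u p (size s1) by [].
  by rewrite Ds nth_cat ltnNge leqnSn /= subSnn.
have next_last : next s v = u.
  rewrite Dv' next_nth mem_last; move: (Up); rewrite /s.
  rewrite -[u :: p]/(u :: p) => Up'; have -> : index (last u p) (u :: p) = size p.
    by rewrite index_last.
  by rewrite nth_default.
have induced x y : x \in s -> y \in s -> e x y -> y = next s x \/ x = next s y.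
  move=> sx sy exy; have nxy : x != y by apply: contraTneq exy => ->; rewrite e_irr.
  (* A chord from [a] to [b] would bypass the vertex [t] after [a]; the only exception is the edge
     [uv], which closes the cycle. *)
  have main a b s1 s2 s3 : s = s1 ++ a :: s2 ++ b :: s3 -> e a b -> b = next s a \/ a = next s b.
    case: s2 => [|t s2] Ds eab; first by left; rewrite (nextE s1 a b s3).
    have Ds1 : s = (s1 ++ [:: a]) ++ t :: (s2 ++ b :: s3) by rewrite Ds -catA.
    have [||ntu ntv s1u s2v /andP[s1t s2t]] := ends _ _ _ Ds1; try by rewrite -size_eq0 size_cat addnC.
    have st : t \in s by rewrite Ds1 mem_cat inE eqxx orbT.
    have Bt : border t.
      have := allT t (notD t st); rewrite in_set (negbTE ntu) (negbTE ntv).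
      by case/andP.
    case: (eqVneq [set a; b] [set u; v]) => [/eqP Dab|nab].
      right; move: Dab; rewrite set2_eq => /orP[]/andP[/eqP Da /eqP Db].
        by rewrite Da Db next_last.
      have : uniq s by []; rewrite Ds cat_uniq Da Db /= => /and3P[_ _ /andP[_ /andP[_ +]]].
      move: s1u; rewrite mem_cat inE; have nuv' : (u == a) = false by rewrite Da; apply: negbTE.
      rewrite nuv' orbF => s1u; move: Up; rewrite Ds cat_uniq => /and3P[_ /hasPn + _].
      move=> /(_ b); rewrite !inE mem_cat inE eqxx !orbT => /(_ isT).
      by rewrite Db /= s1u.
    exfalso; apply: (no_bypass _ _ t a b Ds1 Bt).
    - by rewrite mem_cat inE eqxx orbT.
    - by rewrite mem_cat inE eqxx orbT.
    apply: connect1; rewrite /avoid !inE !negb_or eab nab !notD ?andbT.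
    + apply/andP; split; first by apply: contraNneq s1t => <-; rewrite mem_cat inE eqxx orbT.
      by apply: contraNneq s2t => <-; rewrite mem_cat inE eqxx orbT.
    + by rewrite Ds !(mem_cat, inE) eqxx !orbT.
    + by rewrite Ds mem_cat inE eqxx orbT.
  have [s1 [s2 [s3 [Ds|Ds]]]] := order x y sx sy nxy; first exact: main Ds exy.
  by rewrite e_sym in exy; case: (main y x s1 s2 s3 Ds exy); [right | left].
exists s; split=> //; last by apply/negP=> /notD; rewrite Dw.
split=> //; rewrite sD; split=> // x sx.
have [y exy Ny] : exists2 y, e x y & y \notin [:: next s x; prev s x].
  have := degree3 x; rewrite (cardsD1 (next s x)) (cardsD1 (prev s x)) => lt2.
  have /card_gt0P[y] : (0 < #|[set y | e x y] :\ next s x :\ prev s x|)%N.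
    exact: ltn_add_bools lt2.
  by rewrite !inE => /and3P[yp yn exy]; exists y; rewrite // !inE negb_or yn.
exists y => //; apply: contra Ny => sy; rewrite !inE.
have [->|Dx] := induced x y sx sy exy; first by rewrite eqxx.
by rewrite {2}Dx prev_next ?eqxx ?orbT.
Qed.

End ThreeConnected.

Lemma disjointP (T : finType) (A B : {set T}) :
  (forall x, x \in A -> x \in B -> False) -> [disjoint A & B].
Proof.
move=> AB; rewrite disjoint_subset; apply/subsetP=> x Ax; rewrite inE.
by apply/negP; apply: AB.
Qed.

(** * Bipartitions of the complement of a peripheral cycle *)

Section Bridges.
Variables (V : finType) (e : rel V).
Hypotheses (e_sym : symmetric e) (e_irr : irreflexive e).
Hypothesis V_gt3 : (3 < #|V|)%N.
Hypothesis conn3 : forall S : {set V}, (#|S| < 3)%N -> connected_on e (~: S).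
Hypothesis FPe : FP_rel e.
Implicit Types (Z D X Y S W : {set V}) (c : seq V) (p r x y z : V).

Definition attach c X := [set x in c | [exists y in X, e x y]].

(** Two connected parts in place of the bridges of a cycle: as the complement of a peripheral cycle
    is connected, they touch each other, which supplies one more contact in the models. *)
Definition bipart S X Y : Prop :=
  [/\ X != set0, Y != set0, connected_on e X, connected_on e Y &
      [disjoint X & Y] /\ X :|: Y = S].

Lemma bipartC S X Y : bipart S X Y -> bipart S Y X.
Proof. by case=> X0 Y0 cX cY [dXY SE]; split=> //; rewrite disjoint_sym setUC. Qed.

Lemma attachP c X x : reflect (x \in c /\ exists2 y, y \in X & e x y) (x \in attach c X).
Proof.
rewrite inE; apply: (iffP andP) => -[cx].
  by case/exists_inP=> y Xy exy; split; last exists y.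
by case=> y Xy exy; split; last by apply/exists_inP; exists y.
Qed.

Lemma touches1 x X c : x \in attach c X -> touches e [set x] X.
Proof.
by case/attachP=> _ [y Xy exy]; apply/touchesP; exists x, y; rewrite inE.
Qed.

Lemma bipart_touches S X Y : connected_on e S -> bipart S X Y -> touches e X Y.
Proof.
move=> /connP cS [/set0Pn[x Xx] /set0Pn[y Yy] _ _ [dXY SE]].
have Sx : x \in S by rewrite -SE inE Xx.
have Sy : y \in S by rewrite -SE inE Yy orbT.
have [u [v [_ + Xu Xv euv]]] := cS X x y Sx Sy Xx (negbT (disjointFl dXY Yy)).
by rewrite -SE inE (negbTE Xv) => Yv; apply/touchesP; exists u, v.
Qed.

Lemma peripheral_rot n c : peripheral e c -> peripheral e (rot n c).
Proof.
move=> [Uc ltc cyc ind [cK attK]]; split.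
- by rewrite rot_uniq.
- by rewrite size_rot.
- by rewrite rot_cycle.
- by move=> x y; rewrite !mem_rot !next_rot //; apply: ind.
split=> [|x]; last first.
  by rewrite mem_rot => /attK[y cy exy]; exists y; rewrite ?mem_rot.
by have -> : [set x in rot n c] = [set x in c] by apply/setP=> x; rewrite !inE mem_rot.
Qed.

Lemma peripheral_catC c1 c2 : peripheral e (c1 ++ c2) -> peripheral e (c2 ++ c1).
Proof. by move/(peripheral_rot (size c1)); rewrite rot_size_cat. Qed.

Lemma attach_mem c c' X : c =i c' -> attach c X = attach c' X.
Proof. by move=> cc'; apply/setP=> x; rewrite !inE cc'. Qed.

Lemma path_arc x a (A : seq V) y : path e x (rcons (a :: A) y) ->
  [/\ connected_on e [set z in a :: A], touches e [set x] [set z in a :: A] &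
      touches e [set y] [set z in a :: A]].
Proof.
rewrite /= rcons_path => /and3P[exa aA ely]; split.
- exact: conn_path.
- by apply/touchesP; exists x, a; rewrite !inE !eqxx.
apply/touchesP; exists y, (last a A).
by rewrite inE eqxx e_sym ely inE mem_last.
Qed.

Lemma arcs p (A : seq V) r (B : seq V) : cycle e (p :: A ++ r :: B) -> A != [::] -> B != [::] ->
  [/\ connected_on e [set z in A], connected_on e [set z in B],
      touches e [set p] [set z in A] /\ touches e [set r] [set z in A] &
      touches e [set p] [set z in B] /\ touches e [set r] [set z in B]].
Proof.
case: A B => [//|a A] [//|b B] cyc _ _.
have pA : path e p (rcons (a :: A) r).
  by move: cyc; rewrite /cycle rcons_cat -cat_rcons cat_path => /andP[].
have pB : path e r (rcons (b :: B) p).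
  by move: cyc; rewrite /cycle rcons_cat -cat_rcons cat_path last_rcons => /andP[].
have [cA tpA trA] := path_arc pA.
have [cB trB tpB] := path_arc pB.
by split.
Qed.

(** [Y], [p], [r] against the arc [B], [X] and the arc [A]: only [Y] and [B] are not known to touch,
    and they stand for the ends of the deleted edge. *)
Lemma no_cross p (A : seq V) r (B : seq V) X Y : peripheral e (p :: A ++ r :: B) -> A != [::] -> B != [::] ->
  bipart (~: [set x in p :: A ++ r :: B]) X Y ->
  p \in attach (p :: A ++ r :: B) X -> r \in attach (p :: A ++ r :: B) X ->
  touches e Y [set z in A] -> False.
Proof.
set c := p :: _; move=> [Uc _ cyc _ [cK _]] A0 B0 XY pX rX tYA.
have tXY := bipart_touches cK XY; have [_ _ cX cY [dXY SE]] := XY.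
have [cA cB [tpA trA] [tpB trB]] := arcs cyc A0 B0.
have [_ nK33] := FPe; apply: nK33.
have XYE x : (x \in X) || (x \in Y) = (x \notin c) by rewrite -in_setU SE in_setC in_set.
have XN x : x \in X -> x \notin c.
  by move=> Xx; rewrite -XYE Xx.
have YN x : x \in Y -> x \notin c.
  by move=> Yx; rewrite -XYE Yx orbT.
have Ac x : x \in A -> x \in c by move=> Ax; rewrite inE mem_cat Ax orbT.
have Bc x : x \in B -> x \in c by move=> Bx; rewrite inE mem_cat inE Bx !orbT.
have pc : p \in c by rewrite inE eqxx.
have rc : r \in c by rewrite inE mem_cat inE eqxx !orbT.
move: Uc; rewrite /c /= cat_uniq /= mem_cat inE !negb_or.
case/and4P=> /and3P[pA npr pB] _ /andP[rA /hasPn AB] /andP[rB _].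
apply: (@K33_model _ _ Y [set p] [set r] [set z in B] X [set z in A] e_sym).
- have dYB : [disjoint Y & [set z in B]].
    by apply: disjointP => x /YN + /[!inE] /Bc cx; rewrite cx.
  have dYA : [disjoint Y & [set z in A]].
    by apply: disjointP => x /YN + /[!inE] /Ac cx; rewrite cx.
  have dBX : [disjoint [set z in B] & X].
    by apply: disjointP => x /[!inE] /Bc cx /XN; rewrite cx.
  have dXA : [disjoint X & [set z in A]].
    by apply: disjointP => x /XN + /[!inE] /Ac cx; rewrite cx.
  have dBA : [disjoint [set z in B] & [set z in A]].
    by apply: disjointP => x /[!inE] /AB nAx Ax; case/negP: nAx.
  have [pX' pY] : p \notin X /\ p \notin Y.
    by split; [apply/negP=> /XN | apply/negP=> /YN]; rewrite pc.
  have [rX' rY] : r \notin X /\ r \notin Y.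
    by split; [apply/negP=> /XN | apply/negP=> /YN]; rewrite rc.
  rewrite /disjoint_list /= dYB dYA dBX dXA dBA [[disjoint Y & X]]disjoint_sym dXY.
  rewrite [[disjoint Y & [set p]]]disjoint_sym [[disjoint Y & [set r]]]disjoint_sym !disjoints1.
  by rewrite !inE npr pA pB rA rB pX' pY rX' rY.
- by rewrite /= !conn1 cX cY cA cB.
split=> //; first by rewrite touchesC.
split=> //; first exact: touches1 pX.
exact: touches1 rX.
Qed.

Lemma peripheral_attach c X Y x : peripheral e c -> bipart (~: [set x in c]) X Y ->
  x \in c -> x \in attach c X \/ x \in attach c Y.
Proof.
move=> [_ _ _ _ [_ att]] [_ _ _ _ [_ XYE]] cx; have [y cy exy] := att x cx.
have : y \in X :|: Y by rewrite XYE in_setC in_set.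
by case/setUP=> Hy; [left | right]; apply/attachP; split=> //; exists y.
Qed.

Lemma touches_arc p (A : seq V) r (B : seq V) Y x : x \in attach (p :: A ++ r :: B) Y ->
  x \in A -> touches e Y [set z in A].
Proof.
move=> /attachP[_ [y Yy exy]] Ax; apply/touchesP; exists y, x.
by rewrite inE e_sym.
Qed.

(* The attachments of X are pairwise consecutive on c as soon as Y has two. *)
Lemma attach_consecutive p (A : seq V) r (B : seq V) X Y :
  peripheral e (p :: A ++ r :: B) -> A != [::] -> B != [::] ->
  bipart (~: [set x in p :: A ++ r :: B]) X Y ->
  (1 < #|attach (p :: A ++ r :: B) Y|)%N ->
  p \in attach (p :: A ++ r :: B) X -> r \in attach (p :: A ++ r :: B) X -> False.
Proof.
have noA p' A' r' B' X' Y' : peripheral e (p' :: A' ++ r' :: B') -> A' != [::] -> B' != [::] ->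
    bipart (~: [set x in p' :: A' ++ r' :: B']) X' Y' ->
    p' \in attach (p' :: A' ++ r' :: B') X' -> r' \in attach (p' :: A' ++ r' :: B') X' ->
    forall x, x \in attach (p' :: A' ++ r' :: B') Y' -> x \in [:: p'; r'].
  move=> pc A0 B0 XY pX rX x xY; set c := p' :: _ in pc XY pX rX xY.
  have [cx _] := attachP _ _ _ xY.
  have : [|| x == p', x \in A', x == r' | x \in B'] by move: cx; rewrite /c inE mem_cat inE.
  case/or4P=> [/eqP->|Ax|/eqP->|Bx]; rewrite ?inE ?eqxx ?orbT //.
    by case: (no_cross pc A0 B0 XY pX rX); apply: touches_arc xY Ax.
  have cE : c =i r' :: B' ++ p' :: A' by move=> z; rewrite /c -cat_cons mem_cat orbC -mem_cat.
  have pc' : peripheral e (r' :: B' ++ p' :: A').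
    by move: pc; rewrite /c -cat_cons => /peripheral_catC.
  rewrite (attach_mem X' cE) in pX rX; rewrite (attach_mem Y' cE) in xY.
  have XY' : bipart (~: [set x in r' :: B' ++ p' :: A']) X' Y'.
    by move: XY; have -> : [set x in c] = [set x in r' :: B' ++ p' :: A'] by apply/setP=> z; rewrite !inE -!in_cons -cE.
  by case: (no_cross pc' B0 A0 XY' rX pX); apply: touches_arc xY Bx.
move=> pc A0 B0 XY lt1 pX rX; set c := p :: _ in pc XY lt1 pX rX.
have Ypr := noA _ _ _ _ _ _ pc A0 B0 XY pX rX.
have YE : attach c Y = [set p; r].
  apply/eqP; rewrite eqEcard cards2; apply/andP; split.
    by apply/subsetP=> x /Ypr; rewrite !inE.
  by apply: leq_trans lt1; case: (_ != _).
have Xpr := noA _ _ _ _ _ _ pc A0 B0 (bipartC XY).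
have {Xpr} : forall x, x \in attach c X -> x \in [:: p; r].
  by apply: Xpr; rewrite YE !inE eqxx ?orbT.
(* Both [X] and [Y] now attach at [p] and [r] only, so the vertex [a] of the first arc would have no
   neighbour off the cycle. *)
move=> Xpr; case: A A0 @c pc XY lt1 pX rX Ypr YE Xpr => [//|a A _] c pc XY lt1 pX rX Ypr YE Xpr.
have ca : a \in c by rewrite /c !inE eqxx !orbT.
have [Uc _ _ _ _] := pc; have : a \in [:: p; r].
  by case: (peripheral_attach pc XY ca); [apply: Xpr | apply: Ypr].
rewrite !inE => /orP[]/eqP Da; move: Uc; rewrite /c Da /= ?inE ?mem_cat ?inE ?eqxx ?orbT ?andbF //.
Qed.

Lemma bipart_eq c c' X Y : c =i c' -> bipart (~: [set x in c]) X Y -> bipart (~: [set x in c']) X Y.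
Proof. by move=> cc'; have -> : [set x in c] = [set x in c'] by apply/setP=> z; rewrite !inE. Qed.

(** Two attachments of [X] are consecutive, and a third vertex cannot be consecutive to both, so all
    other vertices attach to [Y] alone. The attachments of [Y] are pairwise consecutive as well,
    hence only two vertices are left. *)
Lemma four_cycle c X Y : peripheral e c -> (3 < size c)%N -> bipart (~: [set x in c]) X Y ->
  (1 < #|attach c X|)%N -> (1 < #|attach c Y|)%N ->
  exists c0 c1 c2 c3 : V, [/\ peripheral e [:: c0; c1; c2; c3], c =i [:: c0; c1; c2; c3],
    attach c X = [set c0; c1] & attach c Y = [set c2; c3]].
Proof.
move=> pc lt3 XY ltX ltY.
have [c0 [c1 [s [pc' cE sz X0 X1]]]] : exists (c0 c1 : V) s, [/\ peripheral e (c0 :: c1 :: s),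
    c =i c0 :: c1 :: s, size (c0 :: c1 :: s) = size c, c0 \in attach c X & c1 \in attach c X].
  have [p pX] : exists p, p \in attach c X by apply/card_gt0P; apply: ltnW ltX.
  have [cp _] := attachP _ _ _ pX; have [n s Dc] := rot_to cp.
  have : (3 < size (rot n c))%N by rewrite size_rot.
  rewrite Dc; case: s Dc => [|q s] // Dc; case/lastP: s Dc => [|m l] // Dc lt3m.
  have cE : c =i p :: q :: rcons m l by move=> x; rewrite -Dc mem_rot.
  have sz : size (p :: q :: rcons m l) = size c by rewrite -Dc size_rot.
  have pc' : peripheral e (p :: q :: rcons m l) by rewrite -Dc; apply: peripheral_rot.
  have [p2 p2X np2] : exists2 p2, p2 \in attach c X & p2 != p.
    by move: ltX; rewrite (cardsD1 p) pX => /card_gt0P[x]; rewrite in_setD1 => /andP[]; exists x.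
  have [Dq|nq] := eqVneq p2 q.
    by exists p, q, (rcons m l); split; rewrite // -Dq.
  have [Dl|nl] := eqVneq p2 l.
    have lX : l \in attach c X by rewrite -Dl.
    exists l, p, (q :: m); split=> //.
    - by move: pc'; rewrite -cats1 -!cat_cons => /peripheral_catC.
    - by move=> x; rewrite cE -cats1 -!cat_cons mem_cat orbC -mem_cat.
    - by rewrite -sz /= size_rcons.
  (* Anywhere else on the cycle [p2] would not be consecutive to [p]. *)
  have : p2 \in c by case/attachP: p2X.
  rewrite cE !inE (negbTE np2) (negbTE nq) mem_rcons inE (negbTE nl) /= => mp2.
  have XY' := bipart_eq cE XY.
  rewrite !(attach_mem _ cE) in p2X pX ltY.
  case/splitPr: mp2 pc' XY' p2X pX ltY {Dc cE sz lt3m} => m1 m2.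
  have -> : p :: q :: rcons (m1 ++ p2 :: m2) l = p :: (q :: m1) ++ p2 :: rcons m2 l.
    by rewrite /= rcons_cat.
  move=> pc' XY' p2X pX ltY'.
  have Bn : rcons m2 l != [::] by case: (m2).
  by case: (attach_consecutive pc' isT Bn XY' ltY' pX p2X).
have XY' := bipart_eq cE XY; rewrite -sz in lt3.
have [EX EY] := (attach_mem X cE, attach_mem Y cE).
rewrite EX in X0 X1 ltX; rewrite EY in ltY; rewrite EX EY.
have cons c1' c2 p A r B X' Y' : c0 :: c1 :: s = c1' ++ c2 -> c2 ++ c1' = p :: A ++ r :: B ->
    A != [::] -> B != [::] -> bipart (~: [set x in c0 :: c1 :: s]) X' Y' ->
    (1 < #|attach (c0 :: c1 :: s) Y'|)%N -> p \in attach (c0 :: c1 :: s) X' ->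
    r \in attach (c0 :: c1 :: s) X' -> False.
  move=> D1 D2 A0 B0 XY1; have mE : c0 :: c1 :: s =i p :: A ++ r :: B.
    by move=> x; rewrite D1 -D2 !mem_cat orbC.
  rewrite (attach_mem X' mE) (attach_mem Y' mE); apply: attach_consecutive => //.
    by rewrite -D2; apply: peripheral_catC; rewrite -D1.
  exact: bipart_eq mE XY1.
have inX t : t \in s -> t \notin attach (c0 :: c1 :: s) X.
  move=> st; apply/negP=> tX; case/splitPr: st cons pc' XY' X0 X1 ltX ltY tX lt3 {cE sz EX EY}.
  move=> s1 s2 cons pc' XY' X0 X1 ltX ltY tX lt3.
  case: s2 cons pc' XY' X0 X1 ltX ltY tX lt3 => [|h s2] cons pc' XY' X0 X1 ltX ltY tX lt3.
    have s1n : s1 != [::] by case: (s1) lt3.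
    by apply: (cons [:: c0] (c1 :: s1 ++ [:: t]) c1 s1 t [:: c0] X Y) => //=; rewrite -catA.
  by apply: (cons [::] (c0 :: c1 :: s1 ++ t :: h :: s2) c0 (c1 :: s1) t (h :: s2) X Y) => //=; rewrite cats0.
have inY t : t \in s -> t \in attach (c0 :: c1 :: s) Y.
  move=> st; have ct : t \in c0 :: c1 :: s by rewrite !inE st !orbT.
  by case: (peripheral_attach pc' XY' ct) => // tX; case/negP: (inX t st).
have attX : attach (c0 :: c1 :: s) X = [set c0; c1].
  apply/setP=> t; apply/idP/idP=> [tX|]; last by rewrite in_set2 => /orP[]/eqP->.
  have [ct _] := attachP _ _ _ tX; move: ct; rewrite !inE orbA => /orP[//|st].
  by case/negP: (inX t st).
have YX' := bipartC XY'.
case: s lt3 cons pc' cE sz X0 X1 XY' ltX ltY EX EY inX inY attX YX' => [|x [|y s]] // lt3 cons pc' cE sz X0 X1 XY' ltX ltY EX EY inX inY attX YX'.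
have Yx : x \in attach [:: c0, c1, x, y & s] Y by apply: inY; rewrite inE eqxx.
have Yy : y \in attach [:: c0, c1, x, y & s] Y by apply: inY; rewrite !inE eqxx orbT.
case: s lt3 cons pc' cE sz X0 X1 XY' ltX ltY EX EY inX inY attX YX' Yx Yy => [|h s] lt3 cons pc' cE sz X0 X1 XY' ltX ltY EX EY inX inY attX YX' Yx Yy; last first.
  have Yh : h \in attach [:: c0, c1, x, y, h & s] Y by apply: inY; rewrite !inE eqxx !orbT.
  case: (cons [:: c0; c1] [:: x, y, h & s] x [:: y] h (s ++ [:: c0; c1]) Y X) => //=.
  by case: (s).
exists c0, c1, x, y; split=> //.
apply/setP=> t; apply/idP/idP=> [tY|]; last by rewrite in_set2 => /orP[]/eqP->.
have [ct _] := attachP _ _ _ tY; move: ct; rewrite !inE => /or4P[]/eqP Dt; rewrite ?Dt ?eqxx ?orbT //.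
  rewrite Dt in tY; case: (cons [::] [:: c0; c1; x; y] c0 [:: c1] x [:: y] Y X) => //.
rewrite Dt in tY; case: (cons [:: c0] [:: c1; x; y] c1 [:: x] y [:: c0] Y X) => //.
Qed.

(* If every bipartition of K = ~: c had a side with at most one attachment, take
   such a side A maximal: the components of K :\: A minus a neighbour of A are
   all small, and three small parts cannot attach to more than three vertices. *)
Lemma big_bipart c : peripheral e c -> (3 < size c)%N -> (1 < #|~: [set x in c]|)%N ->
  exists X Y, [/\ bipart (~: [set x in c]) X Y, (1 < #|attach c X|)%N & (1 < #|attach c Y|)%N].
Proof.
move=> pc lt3 ltK; set K := ~: [set x in c] in ltK *.
pose sides A := [&& A != set0, A \subset K, connected_on e A, K :\: A != set0 & connected_on e (K :\: A)].
have sidesP A : sides A -> bipart K A (K :\: A).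
  case/and5P=> A0 AK cA B0 cB; split=> //; split; last by rewrite setDE setUIr setUCr setIT; apply/setUidPr.
  by apply: disjointP => x Ax; rewrite in_setD Ax.
have sidesC A : sides A -> sides (K :\: A).
  case/and5P=> A0 AK cA B0 cB; rewrite /sides B0 subsetDl cB /= setDDr setDv set0U.
  by rewrite (setIidPr AK) A0.
case: (pickP (fun A => [&& sides A, 1 < #|attach c A| & 1 < #|attach c (K :\: A)|]%N)) => [A|noA].
  by case/and3P=> /sidesP XY ltA ltB; exists A, (K :\: A).
exfalso.
have small A : sides A -> (#|attach c A| <= 1)%N \/ (#|attach c (K :\: A)| <= 1)%N.
  move=> sA; have := noA A; rewrite /= sA /= => /negbT; rewrite negb_and -!leqNgt.
  by case/orP; [left | right].
have [Uc _ _ _ [cK att]] := pc; rewrite -/K in cK.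
pose minor_side A := sides A && (#|attach c A| <= 1)%N.
have [A0 smallA0] : exists A, minor_side A.
  have [k0 Kk0] : exists k, k \in K by apply/card_gt0P; apply: ltnW.
  (* A maximal connected proper subset of [K] has a connected complement: otherwise a component of
     the complement could be added to it. *)
  pose good A := [&& A != set0, A \proper K & connected_on e A].
  have good1 : good [set k0].
    rewrite /good conn1 andbT; apply/andP; split; first by apply/set0Pn; exists k0; rewrite inE.
    by rewrite properEcard sub1set Kk0 cards1.
  have [A /maxsetP[/and3P[A0 AK cA] maxA] _] := maxset_exists good1.
  have [/subsetP AsubK [k Kk Ak]] := properP AK.
  have sA : sides A.
    rewrite /sides A0 cA (proper_sub AK) /=; apply/andP; split.
      by apply/set0Pn; exists k; rewrite inE Ak.
    apply/negPn/negP=> /(disconnected_component e_sym)[W [W0 /properP[/subsetP WK [w Kw Ww]] cW clW]].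
    have [x Ax] := set0Pn _ A0; have [z Wz] := set0Pn _ W0.
    have zKA := WK z Wz; rewrite inE in zKA; have /andP[Az Kz] := zKA.
    have /connP/(_ W z x Kz (AsubK x Ax) Wz) := cK.
    have Wx : x \notin W by apply/negP=> /WK; rewrite inE Ax.
    case/(_ Wx)=> a [b [Ka Kb Wa Wb eab]]; have Ab : b \in A.
      by apply: contraR Wb => Ab; apply: clW Wa _ eab; rewrite inE Ab.
    have goodAW : good (A :|: W).
      apply/and3P; split.
      - by apply/set0Pn; exists x; rewrite inE Ax.
      - apply/properP; split.
          by apply/subsetP=> y /setUP[/AsubK//|/WK]; rewrite inE => /andP[].
        move: Kw; rewrite inE => /andP[Aw Kw]; exists w => //.
        by rewrite inE negb_or Aw.
      - by rewrite e_sym in eab; apply: (connU e_sym cA cW Ab Wa); rewrite eab orbT.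
    by case/negP: Az; rewrite -(maxA _ goodAW) ?subsetUl // inE Wz orbT.
  by have [leA|leB] := small A sA; [exists A | exists (K :\: A)]; rewrite /minor_side ?sA ?sidesC.
have [A /maxsetP[/andP[sA smallA] maxA] _] := maxset_exists smallA0.
have /and5P[A_neq0 /subsetP AK cA _ cX] := sA; set X := K :\: A in cX.
have cc : #|[set x in c]| = size c by rewrite cardsE; apply/card_uniqP.
have other (S : {set V}) : (#|attach c S| <= 1)%N -> exists2 y, y \in c & y \notin attach c S.
  move=> le1; have sub : attach c S \subset [set x in c].
    by apply/subsetP=> x /attachP[cx _]; rewrite inE.
  have /card_gt0P[y] : (0 < #|[set x in c] :\: attach c S|)%N.
    rewrite cardsD (setIidPr sub) cc subn_gt0.
    by apply: leq_ltn_trans le1 _; apply: ltn_trans lt3.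
  by rewrite !inE => /andP[Sy cy]; exists y; rewrite // inE.
have cK' x : x \in c -> x \notin K by rewrite !inE negbK.
pose N := [set v in X | [exists a in A, e v a]].
have NX v : v \in N -> v \in X by rewrite inE => /andP[].
(* With only one neighbour in [X], this neighbour and the at most one attachment would separate [A]
   from the rest of the graph. *)
have ltN : (1 < #|N|)%N.
  rewrite ltnNge; apply/negP=> leN; have [y cy Sy] := other A smallA.
  have ltZ : (#|attach c A :|: N| < 3)%N.
    by apply: leq_ltn_trans (leq_card_setU _ _) _; rewrite ltnS -[2]/(1 + 1)%N leq_add.
  have [a0 Aa0] := set0Pn _ A_neq0.
  have [|||u [v [Au _ Av + euv]]] := sep3 conn3 (A := A) (x := a0) (y := y) ltZ Aa0.
  - rewrite in_setU negb_or; apply/andP; split.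
      by apply/negP=> /attachP[/cK']; rewrite AK.
    by apply/negP=> /NX; rewrite in_setD Aa0.
  - by apply/negP=> /AK; apply/negP/cK'.
  - by rewrite in_setU negb_or Sy; apply/negP=> /NX; rewrite in_setD (negbTE (cK' y cy)) andbF.
  rewrite in_setU negb_or => /andP[nAv nNv]; have [cv|cv] := boolP (v \in c).
    by case/negP: nAv; apply/attachP; split=> //; exists u; rewrite // e_sym.
  case/negP: nNv; rewrite inE in_setD Av in_setC inE cv /=.
  by apply/exists_inP; exists u; rewrite // e_sym.
(* The complement of [W] in [K] is connected, through [v], and strictly contains [A]; by maximality
   it is not small, so [W] is. *)
have small_comp v (W : {set V}) : v \in N -> W != set0 -> W \subset X :\ v -> connected_on e W ->
    (forall y z, y \in W -> z \in X :\ v -> e y z -> z \in W) -> (#|attach c W| <= 1)%N.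
  move=> Nv W0 /subsetP WX cW clW; have Xv := NX v Nv.
  have Wv : v \notin W by apply/negP=> /WX; rewrite !inE eqxx.
  have WsubX : W \subset X by apply/subsetP=> y /WX; rewrite in_setD1 => /andP[].
  have AE : K :\: W = A :|: (X :\: W).
    apply/setP=> z; rewrite in_setD in_setU in_setD [z \in X]in_setD.
    have [Az|Az] /= := boolP (z \in A); last by [].
    rewrite AK // andbT; apply/negP=> /(subsetP WsubX).
    by rewrite in_setD Az.
  have sW : sides W.
    rewrite /sides W0 cW (subset_trans WsubX) ?subsetDl //= AE; apply/andP; split.
      by have [a0 Aa0] := set0Pn _ A_neq0; apply/set0Pn; exists a0; rewrite inE Aa0.
    move: Nv; rewrite inE => /andP[_ /exists_inP[a Aa eva]]; rewrite e_sym in eva.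
    apply: (connU e_sym cA _ Aa (v := v)); rewrite ?eva ?orbT ?inE ?Wv //.
      exact: conn_setD_component cX Xv Wv WsubX clW.
    by move: Xv; rewrite !inE.
  have [//|smallKW] := small W sW; have goodKW : minor_side (K :\: W).
    by rewrite /minor_side sidesC.
  have : v \in A.
    rewrite -(maxA _ goodKW) ?AE ?subsetUl //.
    by rewrite in_setU in_setD Wv Xv orbT.
  by move=> Av; move: Xv; rewrite in_setD Av.
have /card_gt0P[v Nv] := ltnW ltN.
have [v' Nv' nv'v] : exists2 v', v' \in N & v' != v.
  by move: ltN; rewrite (cardsD1 v) Nv => /card_gt0P[x]; rewrite in_setD1 => /andP[]; exists x.
have Xv'v : v' \in X :\ v by rewrite in_setD1 nv'v NX.
have [W [Wv' WX cW clW]] := component e_sym Xv'v.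
have smallW : (#|attach c W| <= 1)%N by apply: small_comp WX cW clW => //; apply/set0Pn; exists v'.
have Wv : v \notin W by apply/negP=> /(subsetP WX); rewrite !inE eqxx.
have cXW : connected_on e (X :\: W).
  apply: conn_setD_component cX (NX v Nv) Wv _ clW => //.
  by apply: subset_trans WX (subD1set _ _).
have Xvv' : v \in X :\ v' by rewrite in_setD1 eq_sym nv'v NX.
have [W' [Wv'' WX' cW' clW']] := component e_sym Xvv'.
have smallW' : (#|attach c W'| <= 1)%N by apply: small_comp WX' cW' clW' => //; apply/set0Pn; exists v.
have XW' : X :\: W \subset W'.
  apply/subsetP=> z XWz; apply: contraT => Wz.
  have XWv : v \in X :\: W by rewrite in_setD Wv NX.
  have /connP/(_ W' v z XWv XWz Wv'' Wz)[a [b [_ XWb Wa Wb eab]]] := cXW.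
  case/negP: Wb; apply: clW' Wa _ eab; move: XWb; rewrite in_setD in_setD1 => /andP[Wb ->].
  by rewrite andbT; apply: contraNneq Wb => ->.
(* [A], [W] and [W'] cover the complement of the cycle with at most one attachment each, but each of
   the four or more cycle vertices attaches somewhere. *)
have cover : [set x in c] \subset attach c A :|: (attach c W :|: attach c W').
  apply/subsetP=> x; rewrite inE => cx; have [y cy exy] := att x cx.
  have inat (S : {set V}) : y \in S -> x \in attach c S by move=> Sy; apply/attachP; split; last exists y.
  rewrite !in_setU; have [/inat->//|Ay] := boolP (y \in A).
  have [/inat->|Wy] := boolP (y \in W); first by rewrite orbT.
  rewrite (inat W') ?orbT //; apply: (subsetP XW'); rewrite !inE Wy Ay cy.
  by [].
have := subset_leq_card cover; rewrite cc leqNgt => /negP[].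
apply: leq_ltn_trans lt3; apply: leq_trans (leq_card_setU _ _) _.
rewrite -[3]/(1 + 2)%N; apply: leq_add smallA _; apply: leq_trans (leq_card_setU _ _) _.
by rewrite -[2]/(1 + 1)%N leq_add.
Qed.

End Bridges.

Lemma conn_sub_component (T : finType) (r : rel T) (S R W : {set T}) x :
  connected_on r S -> S \subset R -> x \in S -> x \in W ->
  (forall y z, y \in W -> z \in R -> r y z -> z \in W) -> S \subset W.
Proof.
move=> /connP cS /subsetP SR Sx Wx clW; apply/subsetP=> y Sy; apply: contraT => Wy.
have [u [v [_ Sv Wu Wv ruv]]] := cS W x y Sx Sy Wx Wy.
by case/negP: Wv; apply: clW Wu (SR v Sv) ruv.
Qed.

Lemma touches_component (T : finType) (r : rel T) (S W : {set T}) x z : symmetric r ->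
  connected_on r S -> z \in S -> x \in W -> W \subset S :\ z ->
  (forall y z', y \in W -> z' \in S :\ z -> r y z' -> z' \in W) -> touches r [set z] W.
Proof.
move=> r_sym /connP cS Sz Wx /subsetP WS clW.
have Wz : z \notin W by apply/negP=> /WS; rewrite in_setD1 eqxx.
have Sx : x \in S by have := WS x Wx; rewrite in_setD1 => /andP[].
have [u [v [_ Sv Wu Wv ruv]]] := cS W x z Sx Sz Wx Wz.
apply/touchesP; exists z, u; split; rewrite ?set11 // r_sym.
have [<-//|nvz] := eqVneq v z; case/negP: Wv; apply: clW Wu _ ruv.
by rewrite in_setD1 nvz.
Qed.

Lemma card_gt1_exists (T : finType) (A : {set T}) x : (1 < #|A|)%N -> exists2 y, y \in A & y != x.
Proof.
move=> lt1; have /card_gt0P[y] : (0 < #|A :\ x|)%N.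
  by move: lt1; rewrite (cardsD1 x); case: (x \in A) => // /ltnW.
by rewrite in_setD1 => /andP[]; exists y.
Qed.

(** * A peripheral cycle of length at least four *)

Section LongCycle.
Variables (V : finType) (e : rel V).
Hypotheses (e_sym : symmetric e) (e_irr : irreflexive e).
Hypothesis V_gt3 : (3 < #|V|)%N.
Hypothesis conn3 : forall S : {set V}, (#|S| < 3)%N -> connected_on e (~: S).
Hypothesis FPe : FP_rel e.
Implicit Types (Z D X Y S W : {set V}) (c : seq V) (p r x y z : V).

Lemma edge_neq x y : e x y -> x != y.
Proof. by apply: contraTneq => ->; rewrite e_irr. Qed.

Lemma touches11 x y : touches e [set x] [set y] = e x y.
Proof.
apply/touchesP/idP=> [[u [v [/set1P-> /set1P->]]]//|exy].
by exists x, y; rewrite !inE.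
Qed.

(** The singletons of [p], [q], [r] together with [X] and [Y]: only [r] and [Y] need not touch. *)
Lemma triangle_K5 p q r X Y : e p q -> e q r -> e p r -> connected_on e X -> connected_on e Y ->
  [disjoint X & Y] -> (forall z, z \in [:: p; q; r] -> z \notin X) -> (forall z, z \in [:: p; q; r] -> z \notin Y) ->
  touches e X Y -> (forall z, z \in [:: p; q; r] -> touches e [set z] X) ->
  touches e [set p] Y -> touches e [set q] Y -> False.
Proof.
move=> epq eqr epr cX cY dXY Xc Yc tXY tX tpY tqY.
have [nK5 _] := FPe; apply: nK5.
apply: (@K5_model _ _ [set r] [set p] [set q] X Y e_sym).
- rewrite /disjoint_list /= dXY !disjoints1 !inE ![r == _]eq_sym (negbTE (edge_neq epq)).
  by rewrite (negbTE (edge_neq eqr)) (negbTE (edge_neq epr)) !Xc ?Yc ?inE ?eqxx ?orbT.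
- by rewrite /= !conn1 cX cY.
- by rewrite touches11 !tX ?inE ?eqxx ?orbT.
- by rewrite !touches11 ![e r _]e_sym tX ?inE ?eqxx ?orbT.
- by rewrite ![touches e Y _]touchesC // ![touches e _ X]touchesC.
Qed.

(** K4 is the exception that the bound excludes. If all peripheral cycles are triangles, every edge
    lies in a triangle avoiding any given further vertex; around one peripheral triangle this
    produces enough contacts for [triangle_K5]. *)
Lemma long_peripheral : (4 < #|V|)%N -> exists c, peripheral e c /\ (3 < size c)%N.
Proof.
move=> V_gt4; apply: NNPP => noc.
have sz3 c : peripheral e c -> size c = 3.
  move=> pc; have [_ lt2 _ _ _] := pc; apply/eqP; rewrite eqn_leq lt2 andbT leqNgt.
  by apply/negP=> lt3; apply: noc; exists c.
have third u v w : e u v -> w != u -> w != v -> exists d, [/\ e u d, e v d & d != w].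
  move=> euv nwu nwv; have [c [pc uc vc wc]] := peripheral_cycle e_sym e_irr V_gt3 conn3 euv nwu nwv.
  have := sz3 c pc; have [_ _ cyc _ _] := pc.
  case: c pc uc vc wc cyc => [|x [|y [|z []]]] //= _ + + + /and4P[exy eyz ezx _] _.
  have [eyx ezy exz] : [/\ e y x, e z y & e x z] by rewrite ![e y x]e_sym ![e z y]e_sym ![e x z]e_sym.
  rewrite !inE !negb_or => ux vx /and3P[nwx nwy nwz].
  have := edge_neq euv.
  case/or3P: ux => /eqP Du; case/or3P: vx => /eqP Dv; rewrite Du Dv ?eqxx // => _;
    first [by exists x; rewrite [x == w]eq_sym | by exists y; rewrite [y == w]eq_sym | by exists z; rewrite [z == w]eq_sym].
have [u] : exists u : V, u \notin [::] by apply: ltV_notin; rewrite /= (leq_trans _ V_gt3).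
have /card_gt0P[v] : (0 < #|[set y | e u y]|)%N by rewrite (leq_trans _ (degree3 e_irr V_gt3 conn3 u)).
rewrite inE => euv _.
have [w] : exists w, w \notin [:: u; v] by apply: ltV_notin; rewrite /= (leq_trans _ V_gt3).
rewrite !inE negb_or => /andP[nwu nwv].
have [c [pc _ _ _]] := peripheral_cycle e_sym e_irr V_gt3 conn3 euv nwu nwv.
have {u v w euv nwu nwv} := sz3 c pc; have [Uc _ cyc _ [cK _]] := pc.
case: c pc Uc cyc cK => [|c0 [|c1 [|c2 []]]] // pc Uc cyc cK _.
have [e01 e12 e20] : [/\ e c0 c1, e c1 c2 & e c2 c0] by case/and4P: cyc.
set c := [:: c0; c1; c2] in pc Uc cyc cK; set K := ~: _ in cK.
have KE z : (z \in K) = (z \notin c) by rewrite in_setC in_set.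
have [c0c c1c c2c] : [/\ c0 \in c, c1 \in c & c2 \in c] by rewrite !inE !eqxx ?orbT.
have rule X Y : X \subset K -> Y \subset K -> connected_on e X -> connected_on e Y -> [disjoint X & Y] ->
    touches e X Y -> (forall z, z \in c -> z \in attach e c X) -> (1 < #|attach e c Y|)%N -> False.
  move=> /subsetP XK /subsetP YK cX cY dXY tXY attX lt1.
  have [p pY] : exists p, p \in attach e c Y by apply/card_gt0P; apply: ltnW.
  have [q qY nqp] := card_gt1_exists p lt1.
  have [[cp _] [cq _]] := (attachP _ _ _ _ pY, attachP _ _ _ _ qY).
  have NX z : z \in c -> z \notin X by apply: contraL => /XK; rewrite KE.
  have NY z : z \in c -> z \notin Y by apply: contraL => /YK; rewrite KE.
  have tX z : z \in c -> touches e [set z] X by move/attX/touches1.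
  have {pY} tpY := touches1 pY; have {qY} tqY := touches1 qY.
  have fin r : e p q -> e q r -> e p r -> {subset [:: p; q; r] <= c} -> False.
    move=> epq eqr epr sub; apply: (triangle_K5 epq eqr epr cX cY dXY) => // z /sub; auto.
  have [e10 e21 e02] : [/\ e c1 c0, e c2 c1 & e c0 c2] by rewrite ![e c1 c0]e_sym ![e c2 c1]e_sym ![e c0 c2]e_sym.
  move: cp cq nqp fin {tpY tqY}; rewrite !inE => /or3P[]/eqP-> /or3P[]/eqP->; rewrite ?eqxx // => _ fin;
    first [by apply: (fin c0) => // z; rewrite !inE => /or3P[]->; rewrite ?orbT |
      by apply: (fin c1) => // z; rewrite !inE => /or3P[]->; rewrite ?orbT |
      by apply: (fin c2) => // z; rewrite !inE => /or3P[]->; rewrite ?orbT].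
(* With fewer than two attachments, these and [z] would separate [W] from a vertex of the
   triangle. *)
have attach_comp z y W : z \in K -> y \in W -> W \subset K :\ z ->
    (forall y z', y \in W -> z' \in K :\ z -> e y z' -> z' \in W) -> (1 < #|attach e c W|)%N.
  move=> Kz Wy /subsetP WK clW; rewrite ltnNge; apply/negP=> le1.
  have WK' t : t \in W -> t != z /\ t \in K by move/WK; rewrite in_setD1 => /andP[].
  have [x cx nx] : exists2 x, x \in c & x \notin attach e c W.
    have [[]|] := boolP ((c0 \in attach e c W) && (c1 \in attach e c W)); last first.
      by rewrite negb_and => /orP[]; [exists c0 | exists c1].
    case/andP=> a0 a1; move: le1; rewrite leqNgt => /negP[].
    have <- : #|[set c0; c1]| = 2 by rewrite cards2 (edge_neq e01).
    by apply/subset_leq_card/subsetP=> t; rewrite in_set2 => /orP[]/eqP->.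
  have [|||||a [b [Wa _ Wb]]] := sep3 conn3 (A := W) (Z := z |: attach e c W) (x := y) (y := x).
  - by rewrite cardsU1; apply: (leq_ltn_trans _ (isT : (1 + 1 < 3)%N)); rewrite leq_add // leq_b1.
  - exact: Wy.
  - rewrite in_setU1 negb_or (WK' y Wy).1 /=; apply/negP=> /attachP[cy _].
    by have := (WK' y Wy).2; rewrite KE cy.
  - by apply/negP=> /WK'[_]; rewrite KE cx.
  - rewrite in_setU1 negb_or nx andbT; apply: contraTneq cx => ->.
    by rewrite -KE.
  rewrite in_setU1 negb_or => /andP[nbz nb] eab; have [cb|cb] := boolP (b \in c).
    by case/negP: nb; apply/attachP; split=> //; exists a; rewrite // e_sym.
  by case/negP: Wb; apply: clW Wa _ eab; rewrite in_setD1 nbz KE.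
have attE z d : z \in c -> e z d -> forall X, d \in X -> z \in attach e c X.
  by move=> cz ezd X Xd; apply/attachP; split=> //; exists d.
have cP t : t \in c -> [\/ t = c0, t = c1 | t = c2].
  by rewrite /c !inE => /or3P[]/eqP; [constructor 1 | constructor 2 | constructor 3].
(* If one vertex [z] is adjacent to all three corners, it serves as [X], and any component of [K]
   minus [z] as [Y]. *)
case: (pickP (fun z => [&& z \in K, e c0 z, e c1 z & e c2 z])) => [z /and4P[Kz e0z e1z e2z]|noz].
  have [k nk] : exists k, k \notin z :: c by apply: ltV_notin.
  have Kkz : k \in K :\ z by move: nk; rewrite inE negb_or in_setD1 KE.
  have [W [Wk WK cW clW]] := component e_sym Kkz.
  have tzW := touches_component e_sym cK Kz Wk WK clW.
  apply: (rule [set z] W) => //.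
  - by rewrite sub1set.
  - by apply: subset_trans WK _; apply: subD1set.
  - exact: conn1.
  - by rewrite disjoints1; apply/negP=> /(subsetP WK); rewrite in_setD1 eqxx.
  - move=> t /cP[]->; apply: (attE _ z) => //; exact: set11.
  - exact: attach_comp Kz Wk WK clW.
have e02 : e c0 c2 by rewrite e_sym.
have [n01 [n12 n02]] := (edge_neq e01, (edge_neq e12, edge_neq e02)).
(* Otherwise the apices [a], [b], [d] of triangles on the three edges are distinct, and any two of
   them together reach all three corners. *)
have [|||a [a0 a1 na2]] := third c0 c1 c2; rewrite // 1?eq_sym //.
have [||b [b0 b2 nb1]] := third c0 c2 c1 e02; rewrite // 1?eq_sym //.
have [||d [d1 d2 nd0]] := third c1 c2 c0 e12; rewrite // ?[c0 == _]eq_sym // 1?eq_sym //.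
have inK x : x != c0 -> x != c1 -> x != c2 -> x \in K by move=> *; rewrite KE !inE !negb_or; apply/and3P.
have Ka : a \in K by apply: inK => //; rewrite eq_sym edge_neq.
have Kb : b \in K by apply: inK => //; rewrite eq_sym edge_neq.
have Kd : d \in K by apply: inK => //; rewrite eq_sym edge_neq.
have nad : a != d by apply: contraFneq (noz a) => Dad; rewrite Ka a0 a1 Dad d2.
have nab : a != b by apply: contraFneq (noz a) => Dab; rewrite Ka a0 a1 Dab b2.
have nbd : b != d by apply: contraFneq (noz b) => Dbd; rewrite Kb b0 b2 Dbd d1.
have attX X : a \in X -> (b \in X) || (d \in X) -> forall z, z \in c -> z \in attach e c X.
  move=> Xa Xbd z /cP[]->; [exact: attE a0 _ Xa | exact: attE a1 _ Xa|].
  by case/orP: Xbd => [Xb|Xd]; [apply: attE b2 _ Xb | apply: attE d2 _ Xd].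
have two x y z : x \in c -> y \in c -> x != y -> e x z -> e y z -> (1 < #|attach e c [set z]|)%N.
  move=> cx cy nxy exz eyz; have <- : #|[set x; y]| = 2 by rewrite cards2 nxy.
  apply/subset_leq_card/subsetP=> t; rewrite in_set2 => /orP[]/eqP->; apply: (attE _ z) => //; exact: set11.
have finish z W : z \in K -> a \in W -> W \subset K :\ z -> connected_on e W ->
    (forall y z', y \in W -> z' \in K :\ z -> e y z' -> z' \in W) -> (b \in W) || (d \in W) ->
    (1 < #|attach e c [set z]|)%N -> False.
  move=> Kz Wa WK cW clW Wbd lt1.
  apply: (rule W [set z]) => //.
  - by apply: subset_trans WK _; apply: subD1set.
  - by rewrite sub1set.
  - exact: conn1.
  - by rewrite disjoint_sym disjoints1; apply/negP=> /(subsetP WK); rewrite in_setD1 eqxx.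
  - by rewrite touchesC //; apply: touches_component Wa WK clW.
  - exact: attX.
have Kad : a \in K :\ d by rewrite in_setD1 nad.
have [X [Xa XK cX clX]] := component e_sym Kad.
have [Xb|Xb] := boolP (b \in X); first by apply: (finish d X); rewrite ?Xb //; apply: two d1 d2.
have Kab : a \in K :\ b by rewrite in_setD1 nab.
have [W [Wa WK cW clW]] := component e_sym Kab.
apply: (finish b W); rewrite // ?orbT; last by apply: two b0 b2.
(* [X] misses [b], so [X] with [d] is a connected set avoiding [b], and the component [W] of [a]
   without [b] contains [d]. *)
apply/orP; right.
have /touchesP[d' [x [/set1P-> Xx edx]]] := touches_component e_sym cK Kd Xa XK clX.
have cXd : connected_on e (X :|: [set d]).
  by apply: (connU e_sym cX (conn1 e d) Xx (set11 d)); rewrite e_sym edx orbT.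
have /subsetP -> // : X :|: [set d] \subset W.
  apply: (conn_sub_component cXd _ _ Wa clW); last by rewrite in_setU Xa.
  apply/subsetP=> t; rewrite in_setU in_set1 in_setD1 => /orP[Xt|/eqP->]; last by rewrite eq_sym nbd.
  have := subsetP XK t Xt; rewrite in_setD1 => /andP[_ ->]; rewrite andbT.
  by apply: contraNneq Xb => <-.
by rewrite in_setU set11 orbT.
Qed.

End LongCycle.

(** * Wheels and prisms *)

Section Shapes.
Variables (V : finType) (e : rel V).
Hypotheses (e_sym : symmetric e) (e_irr : irreflexive e).
Hypothesis V_gt3 : (3 < #|V|)%N.
Hypothesis conn3 : forall S : {set V}, (#|S| < 3)%N -> connected_on e (~: S).
Hypothesis FPe : FP_rel e.
Implicit Types (Z D X Y S W : {set V}) (c : seq V) (p r x y z : V).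

Lemma four_no_chord (c0 c1 c2 c3 : V) : peripheral e [:: c0; c1; c2; c3] -> ~~ e c0 c2 /\ ~~ e c1 c3.
Proof.
move=> [Uc _ _ ind _].
have [n01 n02 n12] : [/\ c1 != c0, c2 != c0 & c2 != c1].
  by move: Uc; rewrite /= !inE !negb_or => /and4P[/and3P[+ + _] /andP[+ _] _ _]; rewrite ![_ == c0]eq_sym [c2 == _]eq_sym => -> -> ->.
have [n03 n13 n23] : [/\ c3 != c0, c3 != c1 & c3 != c2].
  by move: Uc; rewrite /= !inE !negb_or => /and4P[/and3P[_ _ +] /andP[_ +] + _]; rewrite ![c3 == _]eq_sym => -> -> ->.
have [N0 N1 N2 N3] : [/\ next [:: c0; c1; c2; c3] c0 = c1, next [:: c0; c1; c2; c3] c1 = c2,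
    next [:: c0; c1; c2; c3] c2 = c3 & next [:: c0; c1; c2; c3] c3 = c0].
  by rewrite /= !eqxx (negbTE n01) (negbTE n02) (negbTE n12) (negbTE n03) (negbTE n13) (negbTE n23).
split; apply/negP=> exy.
  have := ind c0 c2; rewrite !inE !eqxx ?orbT N0 N2 => -[] // D.
    by rewrite D eqxx in n12.
  by rewrite D eqxx in n03.
have := ind c1 c3; rewrite !inE !eqxx ?orbT N1 N3 => -[] // D.
  by rewrite D eqxx in n23.
by rewrite D eqxx in n01.
Qed.

Lemma disjoints1r (T : finType) (A : {set T}) (x : T) : [disjoint A & [set x]] = (x \notin A).
Proof. by rewrite disjoint_sym disjoints1. Qed.

(* The branch sets {q}, X1, {t} against {p}, Y + s, {x}; only t and x are not joined. *)
Lemma fan_K33 (p q s t : V) X1 Y x : uniq [:: p; q; s; t; x] ->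
  e p q -> e q s -> e s t -> e t p -> e x p -> e x q -> connected_on e X1 -> connected_on e Y ->
  [disjoint X1 & Y] -> {in [:: p; q; s; t; x], forall z, (z \notin X1) && (z \notin Y)} ->
  touches e X1 Y -> touches e [set p] X1 -> touches e [set x] X1 -> touches e [set s] Y -> False.
Proof.
move=> U epq eqs est etp exp exq cX cY dXY N tXY tpX txX tsY.
have [_ nK33] := FPe; apply: nK33.
have touchesU A B C : touches e A C -> touches e A (C :|: B).
  by move=> /touchesP[u [v [Au Cv euv]]]; apply/touchesP; exists u, v; rewrite inE Cv.
have tY z : e z s -> touches e [set z] (Y :|: [set s]).
  by move=> ezs; apply/touchesP; exists z, s; rewrite !inE !eqxx orbT.
move: U; rewrite /= !inE !negb_or => /and5P[/and4P[npq nps npt npx] /and3P[nqs nqt nqx] /andP[nst nsx] ntx _].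
have cYs : connected_on e (Y :|: [set s]).
  have /touchesP[u [v [/set1P-> Yv esv]]] := tsY.
  by apply: (connU e_sym cY (conn1 e s) Yv (set11 s)); rewrite e_sym esv orbT.
have NN z : z \in [:: p; q; s; t; x] -> ((z \in X1) = false) * ((z \in Y) = false).
  by move/N => /andP[/negbTE-> /negbTE->].
have mem : [/\ p \in [:: p; q; s; t; x], q \in [:: p; q; s; t; x], s \in [:: p; q; s; t; x],
    t \in [:: p; q; s; t; x] & x \in [:: p; q; s; t; x]] by rewrite !inE !eqxx !orbT.
have [/NN[pX pY] /NN[qX qY] /NN[sX sY] /NN[tX tY'] /NN[xX xY]] := mem.
apply: (@K33_model _ _ [set t] [set q] X1 [set x] [set p] (Y :|: [set s]) e_sym).
- have dXYs : [disjoint X1 & Y :|: [set s]].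
    apply: disjointP => z X1z; rewrite in_setU in_set1 (disjointFr dXY) //= => /eqP Dz.
    by rewrite -Dz X1z in sX.
  rewrite /disjoint_list /= dXYs !disjoints1 !disjoints1r !in_setU !in_set1.
  rewrite pX pY qX qY tX tY' xX xY ![t == _]eq_sym [q == p]eq_sym ![x == _]eq_sym.
  by rewrite npq nps npt npx nqs nqt nqx nst nsx ntx.
- by rewrite /= !conn1 cX cYs.
rewrite !touches11 [e q x]e_sym [e q p]e_sym [touches e X1 [set x]]touchesC // [touches e X1 [set p]]touchesC //.
by split=> //; [apply: tY; rewrite e_sym | split=> //; [apply: tY | apply: touchesU]].
Qed.

(** A peripheral cycle through [c0 c1] that avoids [c2] singles out the contact of [X]. If it is a
    triangle on [c0], [c1], [x], a second contact would give [fan_K33]; a 4-cycle is refuted by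
    [big]. *)
Lemma side (c0 c1 c2 c3 : V) X Y :
  (forall c, peripheral e c -> (size c <= 4)%N) ->
  peripheral e [:: c0; c1; c2; c3] -> bipart e (~: [set x in [:: c0; c1; c2; c3]]) X Y ->
  attach e [:: c0; c1; c2; c3] X = [set c0; c1] -> attach e [:: c0; c1; c2; c3] Y = [set c2; c3] ->
  exists2 x, x \in X & forall z w, z \in X -> w \in [:: c0; c1; c2; c3] -> e w z -> z = x.
Proof.
move=> le4 pc XY aX aY; set c := [:: c0; c1; c2; c3] in pc XY aX aY *.
have [n02 n13] := four_no_chord pc; have [Uc _ cyc _ [cK _]] := pc.
have [e01 e12 e23 e30] : [/\ e c0 c1, e c1 c2, e c2 c3 & e c3 c0] by case/and5P: cyc.
have [_ _ cX cY [dXY XYE]] := XY.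
have tXY := bipart_touches cK XY.
have inXY z : (z \in X) || (z \in Y) = (z \notin c) by rewrite -in_setU XYE in_setC in_set.
have XN z : z \in X -> z \notin c by move=> Xz; rewrite -inXY Xz.
have YN z : z \in Y -> z \notin c by move=> Yz; rewrite -inXY Yz orbT.
have XnY z : z \in X -> z \notin Y by move=> Xz; rewrite (disjointFr dXY).
have [cc0 cc1 cc2 cc3] : [/\ c0 \in c, c1 \in c, c2 \in c & c3 \in c] by rewrite !inE !eqxx !orbT.
move: (Uc); rewrite /= !inE !negb_or => /and4P[/and3P[d01 d02 d03] /andP[d12 d13] d23 _].
have Xatt w z : w \in c -> z \in X -> e w z -> (w == c0) || (w == c1).
  by move=> cw Xz ewz; rewrite -in_set2 -aX; apply/attachP; split=> //; exists z.
have Yatt w z : w \in c -> z \in Y -> e w z -> (w == c2) || (w == c3).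
  by move=> cw Yz ewz; rewrite -in_set2 -aY; apply/attachP; split=> //; exists z.
have inX w z : (w == c0) || (w == c1) -> z \notin c -> e w z -> z \in X.
  move=> w01 cz ewz; have := inXY z; rewrite cz => /orP[//|Yz].
  have cw : w \in c by case/orP: w01 => /eqP->.
  case/orP: w01 (Yatt w z cw Yz ewz) => /eqP->; rewrite ?(negbTE d02) ?(negbTE d03) ?(negbTE d12) ?(negbTE d13) //.
have tY2 : touches e [set c2] Y by apply: (@touches1 _ _ c2 Y c); rewrite aY set21.
have tY3 : touches e [set c3] Y by apply: (@touches1 _ _ c3 Y c); rewrite aY set22.
have [c' [pc' c'0 c'1 c'2]] : exists c', [/\ peripheral e c', c0 \in c', c1 \in c' & c2 \notin c'].
  by apply: (peripheral_cycle e_sym e_irr V_gt3 conn3 e01); rewrite eq_sym.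
have le4' := le4 c' pc'; have [i s Ds] := rot_to c'0.
have pr := peripheral_rot i pc'; rewrite Ds in pr.
have mE z : (z \in c0 :: s) = (z \in c') by rewrite -Ds mem_rot.
have {Ds le4'} le4' : (size (c0 :: s) <= 4)%N by rewrite -Ds size_rot.
have [_ lt2 _ _ _] := pr.
have [_ _ _ _ [cK' att']] := pr.
have c'c z : z \in c0 :: s -> z != c0 -> z != c1 -> z != c3 -> z \notin c.
  move=> c'z nz0 nz1 nz3; rewrite !inE !negb_or nz0 nz1 nz3 andbT.
  by apply: contraNneq c'2 => <-; rewrite -mE.
(* The only vertices of [c] adjacent to [X] are [c0] and [c1], both on [c']; so a neighbour of [X]
   that is off [c'] is off [c] too. *)
have stay u v : u \in X -> e u v -> v \notin c0 :: s -> v \notin c.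
  move=> Xu euv c'v; apply/negP=> cv; rewrite e_sym in euv.
  by case/orP: (Xatt v u cv Xu euv) => /eqP Dv; rewrite Dv mE ?c'0 ?c'1 in c'v.
have big x x' : e c0 x -> e c1 x' -> e x x' -> uniq [:: c0; c1; x; x'] -> c0 :: s =i [:: c0; c1; x; x'] -> False.
  move=> ex0 ex1' exx' U sE.
  have [sx sx'] : x \in c0 :: s /\ x' \in c0 :: s by rewrite !sE !inE !eqxx !orbT.
  move: U; rewrite /= !inE !negb_or => /and4P[/and3P[_ d0x d0x'] /andP[d1x d1x'] dxx' _].
  have nx'3 : x' != c3 by apply: contraNneq n13 => <-.
  have cx' : x' \notin c by apply: c'c; rewrite // eq_sym.
  have Xx' : x' \in X by apply: (inX c1); rewrite // eqxx orbT.
  have nx3 : x != c3.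
    apply/eqP=> Dx; have e3x' : e c3 x' by rewrite -Dx.
    by case/orP: (Xatt c3 x' cc3 Xx' e3x'); rewrite eq_sym ?(negbTE d03) ?(negbTE d13).
  have cx : x \notin c by apply: c'c; rewrite // eq_sym.
  have Xx : x \in X by apply: (inX c0); rewrite // eqxx.
  pose S := (X :|: Y) :\: [set x; x'].
  have SE z : (z \in S) = (z \notin c0 :: s) && (z \notin c).
    rewrite in_setD in_set2 in_setU inXY; apply: andb_id2r => cz; congr negb.
    rewrite sE !inE; have [-> ->] : z == c0 = false /\ z == c1 = false.
      by split; apply/negP=> /eqP Dz; rewrite Dz ?cc0 ?cc1 in cz.
    by [].
  have YS z : z \in Y -> z \in S.
    move=> Yz; rewrite in_setD in_set2 in_setU Yz orbT andbT.
    by apply/negP=> /orP[]/eqP Dz; move: (XnY z); rewrite Dz -{2}Dz Yz => /(_ _)/negP; rewrite ?Xx ?Xx' => /(_ isT).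
  (* A cut that meets [Y] is crossed inside [Y]. One that misses [Y] is crossed by an edge off [c']
     starting in [X], and [stay] keeps that edge in [S]. *)
  have cS : connected_on e S.
    have /touchesP[_ [y0 [_ Yy0 _]]] := tXY.
    apply: (conn_root e_sym (YS _ Yy0)) => A z Sz Az Ay0.
    have [/exists_inP[y Yy Ay]|/exists_inPn noY] := boolP [exists y in Y, y \in A].
      have /connP/(_ A y y0 Yy Yy0 Ay Ay0)[u [v [Yu Yv Au Av euv]]] := cY.
      by exists u, v; split; auto.
    have Ky0 : y0 \in ~: [set x in c0 :: s] by rewrite in_setC in_set; have := YS _ Yy0; rewrite SE => /andP[].
    have Kz : z \in ~: [set x in c0 :: s] by rewrite in_setC in_set; move: Sz; rewrite SE => /andP[].
    have SAz : z \in A :&: S by rewrite in_setI Az.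
    have SAy0 : y0 \notin A :&: S by rewrite in_setI (negbTE Ay0).
    have /connP/(_ (A :&: S) z y0 Kz Ky0 SAz SAy0)[u [v [_ Kv]]] := cK'.
    rewrite !in_setI => /andP[Au Su] nASv euv.
    have Xu : u \in X.
      move: (Su); rewrite SE -inXY => /andP[_ /orP[//|Yu]].
      by have := noY u Yu; rewrite Au.
    rewrite in_setC in_set in Kv; have Sv : v \in S by rewrite SE Kv (stay u).
    by exists u, v; split=> //; rewrite Sv andbT in nASv.
  have reach z : z \in c0 :: s -> z \in X -> exists2 v, v \in S & e z v.
    by move=> c'z Xz; have [v c'v ezv] := att' z c'z; exists v; rewrite // SE c'v (stay z).
  have tSx : touches e S [set x].
    by have [v Sv exv] := reach x sx Xx; apply/touchesP; exists v, x; rewrite Sv set11 e_sym.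
  have tSx' : touches e S [set c1; x'].
    by have [v Sv exv] := reach x' sx' Xx'; apply/touchesP; exists v, x'; rewrite Sv set22 e_sym.
  have tS3 : touches e S [set c3].
    have /touchesP[u [v [/set1P-> Yv euv]]] := tY3; apply/touchesP; exists v, c3.
    by rewrite YS // set11 e_sym.
  have nS z : z \in c -> (z \in S) = false by move=> cz; rewrite SE cz andbF.
  have nxS : ((x \in S) = false) * ((x' \in S) = false) by rewrite !SE sx sx'.
  have [nx2 nx'2] : x != c2 /\ x' != c2.
    by split; [apply: contraNneq cx => -> | apply: contraNneq cx' => ->].
  (* [c2], [c0], [S] against [x], the edge [c1 x'] and [c3]; only [c2] and [x] need not touch. *)
  have [_ nK33] := FPe; apply: nK33.
  apply: (@K33_model _ _ [set c2] [set c0] S [set x] [set c1; x'] [set c3] e_sym).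
  - have dS1 : [disjoint S & [set c1; x']].
      by apply: disjointP => z Sz; rewrite in_set2 => /orP[]/eqP Dz; rewrite Dz ?(nS c1) ?nxS in Sz.
    rewrite /disjoint_list /= dS1 !disjoints1 !disjoints1r !in_set2 !in_set1 nxS !(nS c0, nS c2, nS c3) //.
    rewrite !negb_or ![c2 == _]eq_sym ![c3 == _]eq_sym [x == c1]eq_sym.
    by rewrite d02 nx2 d12 nx'2 d23 d0x d01 d0x' d03 d1x dxx' nx3 d13 nx'3.
  - rewrite /= !conn1 cS /= andbT; apply: (connU e_sym (conn1 e c1) (conn1 e x') (set11 c1) (set11 x')).
    by rewrite ex1' orbT.
  have t2 z : e z c1 -> touches e [set z] [set c1; x'].
    by move=> ez1; apply/touchesP; exists z, c1; rewrite !inE !eqxx.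
  rewrite !touches11 ex0 e23 [e c0 c3]e_sym e30 tSx tSx' tS3 !t2 // e_sym //.
(* The component [W] of a second contact [z] in [X] minus [x] touches [x], and it touches [Y]
   because the triangle is nonseparating; it is the set [X1] of [fan_K33]. *)
have small x : x \in X -> e c0 x -> e c1 x -> c0 :: s =i [:: c0; c1; x] ->
    forall z w, z \in X -> w \in c -> e w z -> z = x.
  move=> Xx ex0 ex1 sE z w Xz cw ewz; apply/eqP; apply: contraT => nzx.
  have Xzx : z \in X :\ x by rewrite in_setD1 nzx.
  have [W [Wz WX cW clW]] := component e_sym Xzx.
  have txW := touches_component e_sym cX Xx Wz WX clW.
  have WX' u : u \in W -> u != x /\ u \in X by move/(subsetP WX); rewrite in_setD1 => /andP[].
  have c'N u : u \in W -> u \notin c0 :: s.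
    case/WX'=> nux Xu; rewrite sE; have := XN u Xu; rewrite !inE !negb_or nux andbT.
    by case/andP=> -> /andP[->].
  have tWY : touches e W Y.
    have /touchesP[_ [y0 [_ Yy0 _]]] := tXY.
    have Wy0 : y0 \notin W by apply/negP=> /WX'[_ /XnY]; rewrite Yy0.
    have Kz : z \in ~: [set x in c0 :: s] by rewrite in_setC in_set c'N.
    have Ky0 : y0 \in ~: [set x in c0 :: s].
      rewrite in_setC in_set sE; have := YN y0 Yy0; rewrite !inE !negb_or => /andP[-> /andP[-> _]].
      by apply: contraTneq Yy0 => ->; apply: XnY.
    have /connP/(_ W z y0 Kz Ky0 Wz Wy0)[u [v [_ Kv Wu Wv euv]]] := cK'.
    rewrite in_setC in_set in Kv; have [_ Xu] := WX' u Wu.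
    apply/touchesP; exists u, v; split=> //; have := stay u v Xu euv Kv.
    rewrite -inXY => /orP[Xv|//]; case/negP: Wv; apply: clW Wu _ euv.
    by rewrite in_setD1 Xv andbT; apply: contraNneq Kv => ->; rewrite sE !inE eqxx !orbT.
  have dWY : [disjoint W & Y] by apply: disjointP => u /WX'[_ /XnY/negP].
  have N u : u \in c ++ [:: x] -> (u \notin W) && (u \notin Y).
    rewrite mem_cat => /orP[cu|].
      apply/andP; split; last by apply: contraTN cu; apply: YN.
      by apply: contraTN cu => /WX'[_]; apply: XN.
    by rewrite inE => /eqP->; rewrite XnY // andbT; apply/negP=> /WX'[]; rewrite eqxx.
  have nxc := XN x Xx.
  have tw : touches e [set w] W by apply/touchesP; exists w, z; rewrite set11.
  case/orP: (Xatt w z cw Xz ewz) => /eqP Dw; rewrite Dw in tw; exfalso.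
    apply: (@fan_K33 c0 c1 c2 c3 W Y x) => //; try by rewrite e_sym.
    by rewrite -[[:: c0; c1; c2; c3; x]]/(rcons c x) rcons_uniq nxc.
  apply: (@fan_K33 c1 c0 c3 c2 W Y x) => //; try by rewrite e_sym.
    rewrite -[[:: c1; c0; c3; c2; x]]/(rcons [:: c1; c0; c3; c2] x) rcons_uniq.
    have pE : perm_eq [:: c1; c0; c3; c2] c by apply/permP=> P /=; rewrite !addn0 !addnA [in RHS]addnAC [(P c1 + _)%N]addnC -!addnA [(P c3 + _)%N]addnC.
    by rewrite (perm_uniq pE) Uc (perm_mem pE) nxc.
  move=> u; rewrite !inE => D; apply: N; rewrite !inE; move: D.
  by do 5!case: (u == _).
have find x : e c0 x -> e c1 x -> c0 :: s =i [:: c0; c1; x] -> exists2 x, x \in X &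
    forall z w, z \in X -> w \in c -> e w z -> z = x.
  move=> ex0 ex1 sE; have sx : x \in c0 :: s by rewrite sE !inE eqxx !orbT.
  have Xx : x \in X.
    apply: (inX c0); rewrite ?eqxx //; apply: c'c; rewrite // 1?eq_sym ?(edge_neq e_irr ex0) ?(edge_neq e_irr ex1) //.
    by apply: contraNneq n13 => ->.
  by exists x; last exact: small.
have [Us _ cycs _ _] := pr; move: c'1; rewrite -mE inE eq_sym (negbTE d01) /=.
case: s pr mE le4' lt2 big find Us cycs {cK' att' c'c stay small} => [|a [|b [|d []]]] // pr mE _ _ big find Us cycs.
  case/and4P: cycs => e0a eab eb0 _; rewrite !inE => /orP[]/eqP Da; rewrite -Da in e0a eab eb0 find.
    by apply: (find b) => //; rewrite e_sym.
  apply: (find a) => //; first by rewrite e_sym.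
  by move=> z; rewrite !inE [(z == a) || _]orbC.
have [nb _] := four_no_chord pr.
case/and5P: cycs => e0a eab ebd ed0 _; rewrite !inE => /or3P[]/eqP Da; rewrite -Da in e0a eab ebd ed0 big nb Us.
- case: (big d b) => //; try by rewrite e_sym.
    by move: Us; rewrite /= !inE ![b == d]eq_sym !negb_or !andbT -!andbA => /and5P[-> -> -> -> /andP[-> ->]].
  by move=> z; rewrite !inE [(z == b) || _]orbC.
- by rewrite e01 in nb.
case: (big a b) => //; try by rewrite e_sym.
  move: Us; rewrite /= !inE ![c1 == _]eq_sym !negb_or !andbT -!andbA.
  by case/and5P=> [-> -> -> -> /andP[-> ->]].
by move=> z; rewrite !inE; do 4!case: (z == _).
Qed.

Lemma peripheral_complement c : peripheral e c -> (0 < #|~: [set x in c]|)%N.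
Proof.
move=> [_ lt2 _ _ [_ att]]; case: c lt2 att => // c0 c _ /(_ c0)[]; first by rewrite inE eqxx.
by move=> y cy _; apply/card_gt0P; exists y; rewrite in_setC in_set.
Qed.

Lemma exists_peripheral : exists c, peripheral e c.
Proof.
have [u _] : exists u : V, u \notin [::] by apply: ltV_notin; rewrite /= (leq_trans _ V_gt3).
have /card_gt0P[v] : (0 < #|[set y | e u y]|)%N by rewrite (leq_trans _ (degree3 e_irr V_gt3 conn3 u)).
rewrite inE => euv; have [w] : exists w, w \notin [:: u; v].
  by apply: ltV_notin; rewrite /= (leq_trans _ V_gt3).
rewrite !inE negb_or => /andP[nwu nwv].
by have [c [pc _ _ _]] := peripheral_cycle e_sym e_irr V_gt3 conn3 euv nwu nwv; exists c.
Qed.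

Lemma wheel_or_prism :
  (exists c h, peripheral e c /\ ~: [set x in c] = [set h]) \/
  (exists c0 c1 c2 c3 x y : V, [/\ peripheral e [:: c0; c1; c2; c3],
     ~: [set x in [:: c0; c1; c2; c3]] = [set x; y], x != y, e x y &
     attach e [:: c0; c1; c2; c3] [set x] = [set c0; c1] /\
     attach e [:: c0; c1; c2; c3] [set y] = [set c2; c3]]).
Proof.
case: (classic (exists c, peripheral e c /\ (#|~: [set x in c]| <= 1)%N)) => [[c [pc le1]]|nowheel].
  left; have /cards1P[h Dh] : #|~: [set x in c]| == 1 by rewrite eqn_leq le1 peripheral_complement.
  by exists c, h.
right; have gt1 c : peripheral e c -> (1 < #|~: [set x in c]|)%N.
  by move=> pc; rewrite ltnNge; apply/negP=> le1; apply: nowheel; exists c.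
have split4 c : peripheral e c -> (3 < size c)%N -> exists (c0 c1 c2 c3 : V) X Y,
  [/\ peripheral e [:: c0; c1; c2; c3], c =i [:: c0; c1; c2; c3], bipart e (~: [set x in [:: c0; c1; c2; c3]]) X Y,
    attach e [:: c0; c1; c2; c3] X = [set c0; c1] & attach e [:: c0; c1; c2; c3] Y = [set c2; c3]].
  move=> pc lt3; have [X [Y [XY ltX ltY]]] := big_bipart e_sym conn3 pc lt3 (gt1 c pc).
  have [c0 [c1 [c2 [c3 [pc' cE aX aY]]]]] := four_cycle e_sym FPe pc lt3 XY ltX ltY.
  exists c0, c1, c2, c3, X, Y; rewrite -!(attach_mem e _ cE); split=> //.
  exact: bipart_eq cE XY.
(* By [four_cycle] a peripheral cycle with more than three vertices has exactly four. *)
have le4 c : peripheral e c -> (size c <= 4)%N.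
  move=> pc; rewrite leqNgt; apply/negP=> lt4.
  have [c0 [c1 [c2 [c3 [X [Y [pc' cE _ _ _]]]]]]] := split4 c pc (ltnW lt4).
  have [[Uc _ _ _ _] [Uc' _ _ _ _]] := (pc, pc').
  have := eq_card cE; rewrite (card_uniqP Uc) (card_uniqP Uc') => D.
  by rewrite D in lt4.
have V_gt4 : (4 < #|V|)%N.
  have [c pc] := exists_peripheral; have [Uc lt2 _ _ _] := pc.
  rewrite -(cardsC [set x in c]) cardsE (card_uniqP Uc).
  exact: leq_add lt2 (gt1 c pc).
have [c [pc lt3]] := long_peripheral e_sym e_irr V_gt3 conn3 FPe V_gt4.
have [c0 [c1 [c2 [c3 [X [Y [pc4 _ XY aX aY]]]]]]] := split4 c pc lt3.
have [x Xx xE] := side le4 pc4 XY aX aY.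
have mE : [:: c0; c1; c2; c3] =i [:: c2; c3; c0; c1].
  by move=> z; rewrite !inE; do 4!case: (z == _).
have pc4' : peripheral e [:: c2; c3; c0; c1] by apply: (peripheral_rot 2 pc4).
have YX := bipart_eq mE (bipartC XY).
have [aY' aX'] : attach e [:: c2; c3; c0; c1] Y = [set c2; c3] /\ attach e [:: c2; c3; c0; c1] X = [set c0; c1].
  by rewrite -!(attach_mem e _ mE).
have [y Yy yE] := side le4 pc4' YX aY' aX'.
have [_ _ _ _ [dXY XYE]] := XY.
have inXY z : (z \in X) || (z \in Y) = (z \notin [:: c0; c1; c2; c3]).
  by rewrite -in_setU XYE in_setC in_set.
have nyX : y \notin X by rewrite (disjointFl dXY).
have nxY : x \notin Y by rewrite (disjointFr dXY).
(* [x] and [y] would separate any further vertex of [X] or [Y] from the cycle. *)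
have none z : z \in X :\ x :|: Y :\ y -> False.
  move=> Az.
  have [|||||u [v [+ _ + + euv]]] := sep3 conn3 (A := X :\ x :|: Y :\ y) (Z := [set x; y]) (x := z) (y := c0).
  - by rewrite cards2; case: (_ != _).
  - by [].
  - move: Az; rewrite in_setU !in_setD1 in_set2 => /orP[]/andP[nz]; rewrite (negbTE nz) ?orbF.
      by move=> Xz; apply: contraNneq nyX => <-.
    by move=> Yz; apply: contraNneq nxY => <-.
  - rewrite in_setU !in_setD1; apply/negP=> D.
    have : (c0 \in X) || (c0 \in Y) by case/orP: D => /andP[_ ->]; rewrite ?orbT.
    by rewrite inXY !inE eqxx.
  - rewrite in_set2 negb_or; apply/andP; split; apply/eqP=> Dz.
      by have := inXY x; rewrite Xx -Dz !inE eqxx.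
    by have := inXY y; rewrite Yy orbT -Dz !inE eqxx.
  rewrite !in_setU !in_setD1 !in_set1 => Au nAv nZv.
  have cv : v \in [:: c0; c1; c2; c3].
    rewrite -[_ \in _]negbK -inXY; apply: contra nAv; move: nZv; rewrite negb_or => /andP[-> ->].
    by [].
  rewrite e_sym in euv; case/orP: Au => /andP[nu Wu].
    by rewrite (xE u v Wu cv euv) eqxx in nu.
  by rewrite mE in cv; rewrite (yE u v Wu cv euv) eqxx in nu.
have DX : X = [set x].
  apply/setP=> z; rewrite in_set1; apply/idP/eqP=> [Xz|->//]; apply/eqP; apply: contraT => nzx.
  by case: (none z); rewrite in_setU in_setD1 nzx Xz.
have DY : Y = [set y].
  apply/setP=> z; rewrite in_set1; apply/idP/eqP=> [Yz|->//]; apply/eqP; apply: contraT => nzy.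
  by case: (none z); rewrite in_setU !in_setD1 nzy Yz orbT.
exists c0, c1, c2, c3, x, y; rewrite -DX -DY; split=> //.
- by apply: contraNneq nyX => <-.
have [_ _ _ _ [cK _]] := pc4.
by have := bipart_touches cK XY; rewrite DX DY touches11.
Qed.

End Shapes.

(** * Virtual edges *)

Lemma madj_sym (M : mgraph) : symmetric (@madj M).
Proof. by move=> x y; rewrite /madj eq_sym setUC. Qed.

Lemma madj_irr (M : mgraph) : irreflexive (@madj M).
Proof. by move=> x; rewrite /madj eqxx. Qed.

Section Underlying.
Variables (G : sgraph) (N : nat) (C : piece G).
Hypotheses (wfC : wf_piece N C) (inj_ends : injective (@ends (piece_mgraph C))).
Let M := piece_mgraph C.
Local Notation V := (mvertex M).
Implicit Types (x y : V) (A : {set V}) (K : {set {set V}}).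

Definition virtual_pairs : {set {set mvertex (piece_mgraph C)}} :=
  [set A | [exists f : medge (piece_mgraph C), virtual f && (ends f == A)]].

Lemma ends_pair (f : medge M) : exists x y, [/\ x != y, ends f = [set x; y] & madj x y].
Proof.
have [card2 _ _] := wfC; have /eqP/cards2P[a [b [nab fE]]] := card2 _ (fsvalP f).
have suppf z : z \in [set a; b] -> z \in piece_support C.
  by rewrite -fE; apply: in_support (fsvalP f).
have endsE : ends f = [set Sub a (suppf a (set21 a b)); Sub b (suppf b (set22 a b))].
  by apply/setP=> z; rewrite inE fE !inE -!val_eqE.
exists (Sub a (suppf a (set21 a b))), (Sub b (suppf b (set22 a b))).
split=> //; rewrite /madj -val_eqE nab /=; apply/existsP; exists f; exact/eqP.
Qed.

Lemma madjP x y : reflect (exists f : medge M, ends f = [set x; y]) (madj x y).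
Proof.
apply: (iffP idP) => [/andP[_ /existsP[f /eqP fE]]|[f fE]]; first by exists f.
have [u [v [nuv fE' uv]]] := ends_pair f.
have /eqP := fE; rewrite fE' set2_eq => /orP[]/andP[/eqP<- /eqP<-] //.
by rewrite madj_sym.
Qed.

(* The vertex subdividing a virtual edge is its pair of ends, as a 3-connected
   piece has no parallel edges. *)
Definition subdivided K : rel (V + {set V})%type := fun z w =>
  match z, w with
  | inl x, inl y => madj x y && ([set x; y] \notin K)
  | inl x, inr A | inr A, inl x => (A \in K) && (x \in A)
  | _, _ => false
  end.

Lemma subdivided_sym K : symmetric (subdivided K).
Proof. by move=> [x|A] [y|B] //=; rewrite madj_sym setUC. Qed.

(** A virtual edge outside [K] is restored by contracting its label vertex into one of its two
    ends. *)
Lemma subdivided_rminor K : K \subset virtual_pairs -> rminor (subdivided K) (@hat G N C).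
Proof.
move=> /subsetP KV; have [card2 lab ltN] := wfC.
pose lset (k : 'I_N) : {set V} := [set x | [exists A : {set G}, (val x \in A) && ((A, Some (val k)) \in C)]].
have lsetE (A : {set G}) (k : 'I_N) x : (A, Some (val k)) \in C -> (x \in lset k) = (val x \in A).
  move=> CA; rewrite inE; apply/existsP/idP=> [[B /andP[xB CB]]|xA]; last by exists A; rewrite xA.
  by rewrite (lab _ _ _ CA CB).
have lset_edge k x : x \in lset k -> exists2 f : medge M, (val f).2 = Some (val k) & ends f = lset k.
  rewrite inE => /existsP[A /andP[_ CA]]; exists [` CA]%fset => //.
  by apply/setP=> y; rewrite (lsetE A) // inE.
pose g (z : G + 'I_N) : option (V + {set V}) := match z with
  | inl a => omap inl (insub a : option V)
  | inr k => if lset k \in K then Some (inr (lset k)) else omap inl [pick x in lset k]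
  end.
have gin x : g (inl (val x)) = Some (inl x) by rewrite /= valK.
have hatl x (k : 'I_N) : x \in lset k -> @hat G N C (inl (val x)) (inr k) by rewrite inE.
have ginl z x : g z = Some (inl x) -> z = inl (val x) \/ exists2 k, z = inr k & x \in lset k.
  case: z => [a|k] /=; first by case: insubP => //= y _ <- [->]; left.
  case: ifP => // _; case: pickP => //= y ky [<-]; right; by exists k.
have labelK A : A \in K -> exists k : 'I_N, lset k = A.
  move=> /KV; rewrite inE => /existsP[f /andP[]]; rewrite /virtual.
  case Df: (val f) => [B [k|]] //= _ /eqP<-.
  have CB : (B, Some k) \in C by rewrite -Df; apply: fsvalP.
  exists (Ordinal (ltN _ _ CB)); apply/setP=> x.
  by rewrite (lsetE B) // [RHS]inE Df.
exists g; split=> [[x|A]|[x|A] [y|B] //=].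
- apply: (conn_root (@hat_sym G N C) (a := inl (val x))); first by rewrite inE gin.
  move=> B z; rewrite inE => /eqP /[dup] gz /ginl[->|[k Dz xk]] Bz Bx.
    by rewrite Bz in Bx.
  exists z, (inl (val x)); rewrite !inE gz gin eqxx; split=> //.
  by rewrite hat_sym Dz; apply: hatl.
- apply/connP=> B z w; rewrite !inE.
  have gr u : g u == Some (inr A) -> exists2 k, u = inr k & lset k = A /\ A \in K.
    case: u => [a|k] /=; first by case: insubP.
    case: ifP => [Kk /eqP[<-]|_]; first by exists k.
    by case: pickP.
  case/gr=> k -> [kA KA] /gr[l -> [lA _]] Bk Bl; exfalso; case/negP: Bl.
  (* Distinct labels have distinct pairs of ends, since parallel edges are excluded; so the bag of
     [A] is a single label. *)
  suff -> : l = k by [].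
  have : A \in virtual_pairs by apply: KV.
  rewrite inE => /existsP[f /andP[_ /eqP fA]].
  have [x [y [_ fE _]]] := ends_pair f; have Ax : x \in A by rewrite -fA fE set21.
  have [|f1 f1k f1E] := lset_edge k x; first by rewrite kA.
  have [|f2 f2l f2E] := lset_edge l x; first by rewrite lA.
  have Df : f1 = f2 by apply: inj_ends; rewrite f1E f2E kA lA.
  by apply/val_inj/esym; move: f1k; rewrite Df f2l => -[].
- case/andP=> xy Kxy; have [f fE] := madjP x y xy.
  have fV : (val f).1 = [set val x; val y].
    apply/setP=> z; apply/idP/idP=> [zf|].
      have zS := in_support (fsvalP f) zf.
      have : (Sub z zS : V) \in ends f by rewrite inE.
      by rewrite fE !inE -!val_eqE.
    rewrite !inE => /orP[]/eqP->.
      by have : x \in ends f; [rewrite fE !inE eqxx | rewrite inE].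
    by have : y \in ends f; [rewrite fE !inE eqxx orbT | rewrite inE].
  have Cf : ([set val x; val y], (val f).2) \in C by rewrite -fV -surjective_pairing; apply: fsvalP.
  case Df: (val f).2 Cf => [k|] Cf; last by exists (inl (val x)), (inl (val y)); rewrite !gin.
  pose k' := Ordinal (ltN _ _ Cf).
  have kE : lset k' = [set x; y] by apply/setP=> z; rewrite (lsetE _ k' z Cf) !inE -!val_eqE.
  have [hx hy] : hat C (inl (val x)) (inr k') /\ hat C (inr k') (inl (val y)).
    by split; apply: hatl; rewrite kE !inE eqxx ?orbT.
  have : g (inr k') = omap inl [pick x in lset k'] by rewrite /= kE (negbTE Kxy).
  case: pickP => [z|/(_ x)]; last by rewrite kE set21.
  rewrite kE in_set2 => /orP[]/eqP-> gk.
    by exists (inr k'), (inl (val y)); rewrite gin.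
  by exists (inl (val x)), (inr k'); rewrite gin.
- case/andP=> KB xB; have [k Dk] := labelK B KB.
  exists (inl (val x)), (inr k); rewrite gin /= Dk KB; split=> //.
  by apply: hatl; rewrite Dk.
case/andP=> KA yA; have [k Dk] := labelK A KA.
exists (inr k), (inl (val y)); rewrite gin /= Dk KA; split=> //.
by apply: hatl; rewrite Dk.
Qed.
End Underlying.

Lemma wheel_ends_inj k : (2 < k)%N -> injective (@ends (wheel k)).
Proof.
move=> lt2.
have modS (i : 'I_k) : i.+1 %% k = if i.+1 == k then 0 else i.+1.
  by case: eqP (ltn_ord i) => [->|/eqP nk lti]; rewrite ?modnn // modn_small // ltn_neqAle nk.
move=> [i|i] [j|j] /= /eqP; rewrite set2_eq ?(inj_eq Some_inj) //=.
- case/orP=> /andP[/eqP Di /eqP Dj]; first by rewrite Di.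
  exfalso; move: (congr1 val Di) (congr1 val Dj); rewrite /= !modS.
  have arith (a b : nat) : a = (if b.+1 == k then 0 else b.+1) -> (if a.+1 == k then 0 else a.+1) = b -> False.
    by move: lt2; case: eqP; case: eqP; lia.
  exact: arith.
- by rewrite andbF.
- by rewrite orbF => /eqP[->].
Qed.

(** * Isomorphisms onto the standard graphs *)

Section Copies.
Variables (G : sgraph) (N : nat) (C : piece G).
Hypotheses (wfC : wf_piece N C) (inj_ends : injective (@ends (piece_mgraph C))).
Let M := piece_mgraph C.
Local Notation V := (mvertex M).
Implicit Types (x y : V) (A : {set V}) (K : {set {set V}}).

(** On both sides an edge is determined by its ends, so a bijection of vertices that preserves
    adjacency dictates the map of edges. [phi] goes from the standard graph to the piece because the
    vertices of the former are the numbered ones. *)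
Lemma copy_of_inverse (H : mgraph) (ok : pred (medge H)) (phi : mvertex H -> V) :
  injective (@ends H) -> injective phi -> (forall x, exists i, phi i = x) ->
  (forall g : medge H, exists i j, ends g = [set i; j] /\ madj (phi i) (phi j)) ->
  (forall i j, madj (phi i) (phi j) -> exists g : medge H, ends g = [set i; j]) ->
  (forall (g : medge H) i j, ends g = [set i; j] -> [set phi i; phi j] \in virtual_pairs C -> ok g) ->
  @copy_of M H (@virtual G C) ok.
Proof.
move=> inj_H inj_phi surj_phi gE adjE okE.
have [f [phiK fK]] := surj_inv inj_phi surj_phi.
have inj_f := can_inj fK.
have /fin_all_exists[g gP] (d : medge M) : exists g : medge H, ends g = f @: ends d.
  have [x [y [nxy dE xy]]] := ends_pair wfC d.
  have [|g gE'] := adjE (f x) (f y); first by rewrite !fK.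
  by exists g; rewrite gE' dE imsetU !imset_set1.
have inj_g : injective g.
  move=> d d' gdd'; apply: inj_ends; apply: (imset_inj inj_f).
  by rewrite -!gP gdd'.
have surj_g h : exists d, g d = h.
  have [i [j [hE /(madjP wfC)[d dE]]]] := gE h.
  by exists d; apply: inj_H; rewrite gP hE dE imsetU !imset_set1 !phiK.
have [g' [gK g'K]] := surj_inv inj_g surj_g.
exists f, g; split=> //; first by exists phi.
  by exists g'.
move=> d vd; have [x [y [nxy dE _]]] := ends_pair wfC d.
apply: (okE (g d) (f x) (f y)); first by rewrite gP dE imsetU !imset_set1.
by rewrite !fK inE; apply/existsP; exists d; rewrite vd dE /=.
Qed.

Lemma next_nth_mod (T : eqType) (x0 : T) (c : seq T) i : uniq c -> (i < size c)%N ->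
  next c (nth x0 c i) = nth x0 c (i.+1 %% size c).
Proof.
move=> Uc lti; rewrite next_nth mem_nth // index_uniq //.
case: c Uc lti => //= y c Uc; rewrite ltnS leq_eqVlt => /predU1P[->|lti].
  by rewrite modnn nth_default.
by rewrite modn_small //= (set_nth_default x0).
Qed.

Section Wheel.
Variables (c : seq V) (h : V).
Hypotheses (Uc : uniq c) (lt2 : (2 < size c)%N) (hc : h \notin c).
Hypotheses (cover : forall x, x \in h :: c) (spokes : forall x, x \in c -> madj h x).
Hypothesis cyc : cycle (@madj M) c.
Hypothesis induced : {in c &, forall x y, madj x y -> y = next c x \/ x = next c y}.

Lemma wheel_copy (ok : pred (medge (wheel (size c)))) :
  (forall (g : medge (wheel (size c))) (i j : option 'I_(size c)), ends g = [set i; j] ->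
     [set oapp (nth h c) h (omap val i); oapp (nth h c) h (omap val j)] \in virtual_pairs C -> ok g) ->
  @copy_of M (wheel (size c)) (@virtual G C) ok.
Proof.
set phi : option 'I_(size c) -> V := fun i => oapp (nth h c) h (omap val i).
have nthc (i : 'I_(size c)) : nth h c i \in c by rewrite mem_nth.
have nthS (i : 'I_(size c)) : nth h c (ordS i) = next c (nth h c i) by rewrite next_nth_mod.
apply: (@copy_of_inverse (wheel (size c)) ok phi).
- exact: wheel_ends_inj.
- move=> [i|] [j|] //.
  + by rewrite /phi /= => /eqP; rewrite nth_uniq // => /eqP/val_inj->.
  + by move=> Dh; case/negP: hc; rewrite -[h]/(phi None) -Dh; apply: nthc.
  by move=> Dh; case/negP: hc; rewrite -[h]/(phi None) Dh; apply: nthc.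
- move=> x; have := cover x; rewrite inE => /predU1P[->|cx]; first by exists None.
  have lti : (index x c < size c)%N by rewrite index_mem.
  by exists (Some (Ordinal lti)); rewrite /phi /= nth_index.
- case=> i.
    exists (Some i), (Some (ordS i)); split=> //.
    by rewrite /phi [omap _ _]/= [omap _ (Some (ordS i))]/= /oapp nthS; apply: next_cycle.
  by exists None, (Some i); split=> //; apply: (spokes (nthc i)).
move=> [i|] [j|].
- move/(induced (nthc i) (nthc j)); rewrite -!nthS => -[/eqP|/eqP];
    rewrite nth_uniq // => /eqP/val_inj->; first by exists (inl i).
  by exists (inl j); rewrite setUC.
- by move=> _; exists (inr i); rewrite /= setUC.
- by move=> _; exists (inr j).
- by rewrite madj_irr.
Qed.

Lemma wheel_rim : (forall x, x \in c -> [set h; x] \notin virtual_pairs C) ->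
  @copy_of M (wheel (size c)) (@virtual G C) (@is_rim (size c)).
Proof.
move=> nv; apply: wheel_copy => -[//|i] u v /eqP.
rewrite [ends _]/= set2_eq => /orP[]/andP[/eqP<- /eqP<-] /=.
  by rewrite (negbTE (nv _ _)) // mem_nth.
by rewrite setUC (negbTE (nv _ _)) // mem_nth.
Qed.

Lemma wheel_spokes : (forall x y, x \in c -> y \in c -> [set x; y] \notin virtual_pairs C) ->
  @copy_of M (wheel (size c)) (@virtual G C) (@is_spoke (size c)).
Proof.
move=> nv; apply: wheel_copy => -[i|//] u v /eqP.
have nvi := negbTE (nv _ _ (mem_nth h (ltn_ord i)) (mem_nth h (ltn_ord (ordS i)))).
by rewrite [ends _]/= set2_eq => /orP[]/andP[/eqP<- /eqP<-]; rewrite ?[[set _; oapp _ _ (omap _ (Some i))]]setUC /= nvi.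
Qed.
End Wheel.
End Copies.

(** * Which edges may be virtual *)

Section Recognition.
Variables (G : sgraph) (N : nat) (C : piece G).
Hypotheses (wfC : wf_piece N C) (C3 : simple_3connected (piece_mgraph C)).
Hypothesis FPh : FP_rel (@hat G N C).
Let M := piece_mgraph C.
Local Notation V := (mvertex M).
Local Notation e := (@madj M).
Local Notation vp := (virtual_pairs C).
Implicit Types (x y : V) (A : {set V}) (K : {set {set V}}) (c : seq V).

Let inj_ends : injective (@ends M). Proof. by case: C3. Qed.
Let V_gt3 : (3 < #|V|)%N. Proof. by case: C3. Qed.
Let conn3 : forall S : {set V}, (#|S| < 3)%N -> connected_on e (~: S). Proof. by case: C3. Qed.
Let e_sym : symmetric e. Proof. exact: madj_sym. Qed.
Let e_irr : irreflexive e. Proof. exact: madj_irr. Qed.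

Lemma subdivided_FP K : K \subset vp -> FP_rel (@subdivided G C K).
Proof.
move=> /(subdivided_rminor wfC inj_ends) KC.
by have [nK5 nK33] := FPh; split=> /rminor_trans/(_ KC).
Qed.

Lemma madj_FP : FP_rel e.
Proof.
have KC : rminor e (@subdivided G C set0).
  by apply: (@inj_rminor _ _ _ _ inl) => [x y []|x y exy] //=; rewrite exy inE.
have [nK5 nK33] := subdivided_FP (sub0set vp).
by split=> /rminor_trans/(_ KC).
Qed.

Lemma conn_inl K (S : {set V}) : connected_on e S -> (forall x y, x \in S -> y \in S -> [set x; y] \notin K) ->
  connected_on (@subdivided G C K) [set inl x | x in S].
Proof.
move=> /connP cS SK; apply/connP=> A _ _ /imsetP[x Sx ->] /imsetP[y Sy ->] Ax Ay.
have [||u [v [Su Sv]]] := cS [set z | inl z \in A] x y Sx Sy; rewrite ?inE //.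
move=> Au Av euv; exists (inl u), (inl v); split; rewrite ?imset_f //=.
by rewrite euv SK.
Qed.

Lemma inl_eq x y : ((inl x : V + {set V}) == inl y) = (x == y).
Proof. by []. Qed.

(** The subdividing vertex, [a] and [b] against the rest [m] of the rim, [h] and [x]; only the
    subdividing vertex and [m] need not touch. A nonempty [m] means a rim of length at least 4, so
    K4 escapes. *)
Lemma no_virtual_spoke h x a m b : peripheral e (x :: a :: rcons m b) -> m != [::] ->
  h \notin x :: a :: rcons m b -> (forall y, y \in x :: a :: rcons m b -> e h y) ->
  [set h; x] \notin vp.
Proof.
move=> [Uc _ cyc _ _] m0 hc spokes; apply/negP=> hx.
pose K := [set [set h; x]].
have [_ nK33] : FP_rel (@subdivided G C K) by apply: subdivided_FP; rewrite sub1set.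
apply: nK33; have KE u v : ([set u; v] \in K) = (u == h) && (v == x) || (u == x) && (v == h).
  by rewrite in_set1 set2_eq.
move: hc; rewrite !inE mem_rcons inE !negb_or => /and4P[nhx nha nhb hm].
move: Uc; rewrite /= !inE mem_rcons inE rcons_uniq !negb_or mem_rcons inE negb_or.
case/and4P=> /and3P[nxa nxb xm] /andP[nab am] bm _.
have [eha ehb] : e h a /\ e h b by split; apply: spokes; rewrite !inE mem_rcons inE eqxx ?orbT.
have [exa eam ebm ebx cm] : [/\ e x a, touches e [set a] [set z in m], touches e [set b] [set z in m], e b x &
    connected_on e [set z in m]].
  move: cyc; rewrite /= rcons_path last_rcons => /and3P[exa pm ebx].
  case: m m0 pm {spokes hm xm am bm} => // t m _ pm.
  by have [cm tam tbm] := path_arc e_sym pm; split.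
have t1 u v : e u v -> [set u; v] \notin K -> touches (@subdivided G C K) [set inl u] [set inl v].
  by move=> euv Kuv; apply/touchesP; exists (inl u), (inl v); rewrite !inE !eqxx /= euv.
have tm u : touches e [set u] [set z in m] -> u != h -> touches (@subdivided G C K) [set inl u] [set inl z | z in [set z in m]].
  case/touchesP=> _ [v [/set1P-> mv euv]] nuh; apply/touchesP; exists (inl u), (inl v).
  rewrite set11 imset_f //= euv KE (negbTE nuh) /=; split=> //.
  by rewrite negb_and orbC; apply/orP; left; apply: contraNneq hm => <-; rewrite inE in mv.
apply: (@K33_model _ _ [set inr [set h; x]] [set inl a] [set inl b] [set inl z | z in [set z in m]] [set inl h] [set inl x] (@subdivided_sym G C K)).
- have nm u : u \notin m -> inl u \notin [set (inl z : V + {set V}) | z in [set z in m]].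
    by move=> mu; apply/negP=> /imsetP[v]; rewrite inE => mv [Du]; rewrite Du mv in mu.
  have nmr A : inr A \notin [set (inl z : V + {set V}) | z in [set z in m]] by apply/negP=> /imsetP[].
  rewrite /disjoint_list /= !disjoints1 !disjoints1r !in_set1 !inl_eq !nm // nmr /=.
  by rewrite nab ![_ == h]eq_sym nha nhb ![_ == x]eq_sym nxa nxb eq_sym nhx.
- rewrite /= !conn1 conn_inl //= => u v mu mv; rewrite inE in mu; rewrite inE in mv.
  have [/negbTE nuh /negbTE nvh] : u != h /\ v != h.
    by split; apply: contraNneq hm => <-.
  by rewrite KE nuh nvh andbF.
- have ts u : u \in [set h; x] -> touches (@subdivided G C K) [set inr [set h; x]] [set inl u].
    by move=> uhx; apply/touchesP; exists (inr [set h; x]), (inl u); rewrite !set11 /= set11 uhx.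
  rewrite !ts ?set21 ?set22 // !tm 1?eq_sym //; split=> //.
  have nK u v : u != h -> u != x -> [set u; v] \notin K.
    by move=> /negbTE nuh /negbTE nux; rewrite KE nuh nux.
  by split; apply: t1; rewrite ?nK // 1?e_sym // eq_sym.
Qed.

(** The vertex subdividing [rs] joins the side of [p] and [q], the vertex subdividing [pq] the side
    of [r] and [s]; these two new vertices are the nonadjacent pair of [K33_minus]. *)
Lemma K4_no_disjoint p q r s : uniq [:: p; q; r; s] -> {in [:: p; q] & [:: r; s], forall x y, e x y} ->
  [set p; q] \in vp -> [set r; s] \notin vp.
Proof.
move=> U adj_pr vpq; apply/negP=> vrs; pose K := [set [set p; q]; [set r; s]].
have [_ nK33] : FP_rel (@subdivided G C K) by apply: subdivided_FP; rewrite subUset !sub1set vpq.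
move: U; rewrite /= !inE !negb_or !andbT => /and3P[/and3P[npq npr nps] /andP[nqr nqs] nrs].
have [rp sp rq sq] : [/\ (r == p) = false, (s == p) = false, (r == q) = false & (s == q) = false].
  by rewrite ![r == _]eq_sym ![s == _]eq_sym !(negbTE npr, negbTE nps, negbTE nqr, negbTE nqs).
have t1 u v : u \in [:: p; q] -> v \in [:: r; s] -> touches (@subdivided G C K) [set inl u] [set inl v].
  move=> pu rv; apply/touchesP; exists (inl u), (inl v); rewrite !set11 /= adj_pr //=; split=> //.
  move: pu rv; rewrite in_set2 !set2_eq !inE => /orP[]/eqP-> /orP[]/eqP->; rewrite ?eqxx ?(negbTE npr) ?(negbTE nps) ?(negbTE nqr) ?(negbTE nqs) ?andbF //=;
   by rewrite ?rp ?sp ?rq ?sq ?andbF.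
have tl (A : {set V}) u : A \in K -> u \in A -> touches (@subdivided G C K) [set inr A] [set inl u].
  by move=> KA Au; apply/touchesP; exists (inr A), (inl u); rewrite !set11 /= KA.
have tl' (A : {set V}) u : A \in K -> u \in A -> touches (@subdivided G C K) [set inl u] [set inr A].
  by move=> KA Au; rewrite touchesC; [apply: tl | apply: subdivided_sym].
apply: nK33; apply: (@K33_model _ _ [set inr [set r; s]] [set inl p] [set inl q] [set inr [set p; q]] [set inl r] [set inl s] (@subdivided_sym G C K)).
- rewrite /disjoint_list /= !disjoints1 !in_set1 !inl_eq npq npr nps nqr nqs nrs !andbT /=.
  by apply/negP=> /eqP[] /eqP; rewrite set2_eq rp sp rq sq.
- by rewrite /= !conn1.
- by rewrite !tl ?tl' ?t1 ?in_set2 ?inE ?eqxx ?orbT.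
Qed.

Lemma in3 (T : eqType) (w x y z : T) : w \in [:: x; y; z] -> [\/ w = x, w = y | w = z].
Proof. by rewrite !inE => /or3P[]/eqP; [constructor 1 | constructor 2 | constructor 3]. Qed.

(** Pairwise intersecting edges of K4 lie in a star or in a triangle. In a star they are spokes at
    its centre; in a triangle they are the rim around the fourth vertex. *)
Lemma K4_typed p q r s : uniq [:: p; q; r; s] -> (forall x, x \in [:: p; q; r; s]) ->
  (forall x y, x != y -> e x y) -> type1 C \/ type2 C.
Proof.
move=> U cover adjE.
have disj p' q' r' s' : perm_eq [:: p'; q'; r'; s'] [:: p; q; r; s] -> [set p'; q'] \in vp -> [set r'; s'] \notin vp.
  move=> pE; have U' : uniq [:: p'; q'; r'; s'] by rewrite (perm_uniq pE).
  apply: K4_no_disjoint => // x y.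
  move: U'; rewrite /= !inE !negb_or !andbT => /and3P[/and3P[_ npr nps] /andP[nqr nqs] _].
  by move=> /orP[]/eqP-> /orP[]/eqP->; apply: adjE.
have tri h c : perm_eq (h :: c) [:: p; q; r; s] ->
    [/\ uniq c, size c = 3, h \notin c & forall x, x \in h :: c] /\
    [/\ forall x, x \in c -> e h x, cycle e c & {in c &, forall x y, e x y -> y = next c x \/ x = next c y}].
  move=> pE; have U' : uniq (h :: c) by rewrite (perm_uniq pE).
  have sz : size (h :: c) = 4 by rewrite (perm_size pE).
  case/andP: U' => hc Uc; split; split=> //.
  - by case: sz.
  - by move=> x; rewrite (perm_mem pE).
  - by move=> x cx; apply: adjE; apply: contraNneq hc => ->.
  - case: c sz hc Uc {pE} => [|x [|y [|z []]]] // _ _; rewrite /= !inE !negb_or !andbT => /andP[/andP[nxy nxz] nyz].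
    by rewrite !adjE // eq_sym.
  case: c sz hc Uc {pE} => [|x [|y [|z []]]] // _ _; rewrite /= !inE !negb_or !andbT => /andP[/andP[nxy nxz] nyz].
  move=> u v; rewrite !inE => /or3P[]/eqP-> /or3P[]/eqP->; rewrite ?e_irr // => _;
    rewrite ?eqxx ?[y == x]eq_sym ?[z == x]eq_sym ?[z == y]eq_sym ?(negbTE nxy) ?(negbTE nxz) ?(negbTE nyz) ?eqxx; auto.
have t2 h x y z : perm_eq [:: h; x; y; z] [:: p; q; r; s] ->
    [set h; x] \notin vp -> [set h; y] \notin vp -> [set h; z] \notin vp -> type2 C.
  move=> /tri[[Uc _ hc cov] [spk cyc ind]] nx ny nz; exists 3 => //.
  apply: (wheel_rim wfC inj_ends Uc _ hc cov spk cyc ind) => // w.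
  by case/in3=> ->.
have vp1 w : [set w; w] \notin vp.
  rewrite inE; apply/existsP=> -[f /andP[_ /eqP fE]].
  have [u [v [nuv fE' _]]] := ends_pair wfC f; move: nuv; have /eqP := fE.
  by rewrite fE' set2_eq => /orP[]/andP[/eqP-> /eqP->]; rewrite eqxx.
have t1 h x y z : perm_eq [:: h; x; y; z] [:: p; q; r; s] ->
    [set x; y] \notin vp -> [set x; z] \notin vp -> [set y; z] \notin vp -> type1 C.
  move=> /tri[[Uc _ hc cov] [spk cyc ind]] nxy nxz nyz.
  apply: (wheel_spokes wfC inj_ends Uc _ hc cov spk cyc ind) => // u v.
  by case/in3=> -> /in3[] ->; rewrite // setUC.
have E : [/\ perm_eq [:: p; q; r; s] [:: p; q; r; s], perm_eq [:: q; p; r; s] [:: p; q; r; s],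
    perm_eq [:: r; p; q; s] [:: p; q; r; s] & perm_eq [:: s; p; q; r] [:: p; q; r; s]].
  by split; apply/permP=> P /=; lia.
have [Ep Eq Er Es] := E.
have Eq2 : perm_eq [:: p; r; q; s] [:: p; q; r; s] by apply/permP=> P /=; lia.
have Er2 : perm_eq [:: p; s; q; r] [:: p; q; r; s] by apply/permP=> P /=; lia.
have := disj _ _ _ _ Ep; have := disj _ _ _ _ Eq2; have := disj _ _ _ _ Er2.
have := t1 _ _ _ _ Ep; have := t1 _ _ _ _ Eq; have := t1 _ _ _ _ Er; have := t1 _ _ _ _ Es.
have := t2 _ _ _ _ Ep; have := t2 _ _ _ _ Eq; have := t2 _ _ _ _ Er; have := t2 _ _ _ _ Es.
rewrite ![[set q; p]]setUC ![[set r; p]]setUC ![[set r; q]]setUC ![[set s; p]]setUC ![[set s; q]]setUC ![[set s; r]]setUC.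
case: (_ \in vp); case: (_ \in vp); case: (_ \in vp); case: (_ \in vp); case: (_ \in vp); case: (_ \in vp); 
  move=> /= *; solve [left; auto | right; auto |
    match goal with H : is_true true -> is_true false |- _ => by have := H isT end].
Qed.

(** In the complement of the 6-cycle the triangles are the even and the odd numbers, and the
    matching joins [i] to [i + 3] modulo 6. *)
Let opp (i : 'I_6) : 'I_6 := ordS (ordS (ordS i)).

Let co_cycle6_triangle (i j z : 'I_6) : co_cycle_adj z i -> co_cycle_adj z j -> co_cycle_adj i j ->
  uniq [:: opp z; i; j; z; opp i; opp j] /\
  [/\ co_cycle_adj (opp z) z, co_cycle_adj (opp z) (opp i), co_cycle_adj i (opp i),
     co_cycle_adj j (opp j) & co_cycle_adj (opp i) (opp j)].
Proof.
by case: i j z => [[|[|[|[|[|[|?]]]]]] ?] [[|[|[|[|[|[|?]]]]]] ?] [[|[|[|[|[|[|?]]]]]] ?].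
Qed.

(** The order of the list puts one triangle, [c0], [c1], [x], on the even positions and the other on
    the odd ones, matched vertices three places apart. A virtual triangle edge is refuted by
    [opp z], [i], [j] against its subdividing vertex, [z] and the pair [opp i], [opp j], where [z]
    is the third corner. *)
Lemma prism_typed (c0 c1 c2 c3 x y : V) : uniq [:: c0; y; c1; c3; x; c2] ->
  (forall z, z \in [:: c0; y; c1; c3; x; c2]) ->
  (forall i j : 'I_6, e (nth c0 [:: c0; y; c1; c3; x; c2] i) (nth c0 [:: c0; y; c1; c3; x; c2] j) = co_cycle_adj i j) ->
  type3 C.
Proof.
set s := [:: c0; _; _; _; _; _] => Us cover adjE.
pose phi (i : co_cycle 6) : V := nth c0 s (i : 'I_6).
have inj_phi : injective phi.
  by move=> i j /eqP; rewrite nth_uniq // => /eqP/val_inj.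
have edgeE (i j : co_cycle 6) : adj i j -> [set i; j] \in edge_set (co_cycle 6).
  by move=> ij; apply/imsetP; exists (i, j); rewrite ?inE.
have K_tri (i j z : co_cycle 6) : adj z i -> adj z j -> adj i j -> [set phi i; phi j] \notin vp.
  move=> zi zj ij; apply/negP=> vij; have [Uo [ozz ozi ioi joj oij]] := co_cycle6_triangle zi zj ij.
  move: Uo; rewrite /= !inE !negb_or !andbT => /and5P[/and5P[ozi' ozj' ozz' ozoi ozoj] /and4P[nij niz nioi nioj] /and3P[njz njoi njoj] /andP[nzoi nzoj] _].
  have notij u : u \in [:: opp z; z; opp i; opp j] -> u \notin [:: i; j].
    rewrite !inE !negb_or => /or4P[]/eqP->; rewrite ?ozi' ?ozj' // ![_ == i]eq_sym ![_ == j]eq_sym.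
    - by rewrite niz njz.
    - by rewrite nioi njoi.
    by rewrite nioj njoj.
  pose K := [set [set phi i; phi j]].
  have [_ nK33] : FP_rel (@subdivided G C K) by apply: subdivided_FP; rewrite sub1set.
  have KE u v : ([set phi u; phi v] \in K) = (u == i) && (v == j) || (u == j) && (v == i).
    by rewrite in_set1 set2_eq !(inj_eq inj_phi).
  have t1 (u v : 'I_6) : co_cycle_adj u v -> (u \notin [:: i; j]) || (v \notin [:: i; j]) ->
      subdivided K (inl (phi u)) (inl (phi v)).
    move=> uv nuv; rewrite /= adjE uv KE /=; apply: contraL nuv.
    by case/orP=> /andP[/eqP-> /eqP->]; rewrite !inE !eqxx ?orbT.
  have tt (u v : V + {set V}) (B : {set (V + {set V})%type}) : subdivided K u v -> v \in B -> touches (subdivided K) [set u] B.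
    by move=> uv vB; apply/touchesP; exists u, v; rewrite set11.
  pose l u : V + {set V} := inl (phi u).
  have lE u v : (l u == l v) = (u == v) by rewrite inl_eq (inj_eq inj_phi).
  apply: nK33; apply: (@K33_model _ _ [set l (opp z)] [set l i] [set l j] [set inr [set phi i; phi j]]
    [set l z] [set l (opp i); l (opp j)] (@subdivided_sym G C K)).
  - rewrite /disjoint_list /= !disjoints1 !in_set2 !in_set1 !lE !negb_or.
    by rewrite ozi' ozj' ozz' ozoi ozoj nij niz nioi nioj njz njoi njoj nzoi nzoj.
  - rewrite /= !conn1 /= andbT; apply: (connU (@subdivided_sym G C K) (conn1 _ _) (conn1 _ _) (set11 _) (set11 _)).
    by rewrite t1 ?orbT // notij // !inE eqxx ?orbT.
  have jz : co_cycle_adj j z by rewrite co_cycle_sym.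
  have iz : co_cycle_adj i z by rewrite co_cycle_sym.
  have Kij : [set phi i; phi j] \in K by rewrite set11.
  have t1' u v (B : {set (V + {set V})%type}) : co_cycle_adj u v -> u \notin [:: i; j] -> l v \in B -> touches (subdivided K) [set l u] B.
    by move=> uv nu; apply: tt; apply: t1; rewrite // nu.
  have t1r u v (B : {set (V + {set V})%type}) : co_cycle_adj u v -> v \notin [:: i; j] -> l v \in B -> touches (subdivided K) [set l u] B.
    by move=> uv nv; apply: tt; apply: t1; rewrite // nv orbT.
  have ts u : u \in [set phi i; phi j] -> touches (subdivided K) [set inl u] [set inr [set phi i; phi j]].
    by move=> uA; apply: tt (set11 _); rewrite /= Kij.
  split.
  - by apply: t1' ozz (notij _ _) (set11 _); rewrite !inE eqxx.
  - by apply: t1' ozi (notij _ _) (set21 _ _); rewrite !inE eqxx.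
  - exact/ts/set21.
  - exact/ts/set22.
  split.
  - by apply: t1r iz (notij _ _) (set11 _); rewrite !inE eqxx orbT.
  - by apply: t1r ioi (notij _ _) (set21 _ _); rewrite !inE eqxx !orbT.
  - by apply: t1r jz (notij _ _) (set11 _); rewrite !inE eqxx orbT.
  - by apply: t1r joj (notij _ _) (set22 _ _); rewrite !inE eqxx !orbT.
apply: (@copy_of_inverse _ _ _ wfC inj_ends prism _ phi).
- exact: val_inj.
- exact: inj_phi.
- move=> z; have lt6 : (index z s < 6)%N by rewrite -[6]/(size s) index_mem.
  by exists (Ordinal lt6); rewrite /phi /= nth_index.
- case=> A /= /imsetP[[i j]]; rewrite inE /= => ij DA.
  by exists i, j; rewrite DA; split=> //; rewrite adjE.
- by move=> i j; rewrite adjE => ij; exists (exist _ [set i; j] (edgeE i j ij)).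
move=> g i j gE vij; apply/negP=> /existsP[z /forall_inP zg].
have [zi zj] : adj z i /\ adj z j.
  by split; rewrite adj_sym; apply: zg; rewrite -[val g]/(@ends prism g) gE !inE eqxx ?orbT.
have ij : adj i j.
  have : [set i; j] \in edge_set (co_cycle 6) by rewrite -gE; apply: (valP g).
  case/imsetP=> -[u v]; rewrite inE => /= uv /eqP; rewrite set2_eq.
  case/orP=> /andP[/eqP-> /eqP->]; first exact: uv.
  by move: uv; rewrite -co_cycle_sym.
by have := K_tri i j z zi zj ij; rewrite vij.
Qed.

Lemma simple_3connected_typed : [\/ type1 C, type2 C | type3 C].
Proof.
have [[c [h [pc cE]]]|] := wheel_or_prism e_sym e_irr V_gt3 conn3 madj_FP.
  have [Uc lt2 cyc ind [_ att]] := pc.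
  have notc z : (z \notin c) = (z == h) by rewrite -in_set1 -cE in_setC in_set.
  have hc : h \notin c by rewrite notc.
  have cover z : z \in h :: c by rewrite inE -notc orNb.
  have spokes z : z \in c -> e h z.
    by move/att=> [y]; rewrite notc => /eqP-> ezh; rewrite e_sym.
  have [lt3|le3] := ltnP 3 (size c).
    constructor 2; exists (size c) => //.
    apply: (wheel_rim wfC inj_ends Uc lt2 hc cover spokes cyc ind) => z cz.
    have [i s Ds] := rot_to cz; have pr := peripheral_rot i pc; rewrite Ds in pr.
    have sE w : (w \in z :: s) = (w \in c) by rewrite -Ds mem_rot.
    have : (3 < size (z :: s))%N by rewrite -Ds size_rot.
    case: s {Ds} pr sE => [|a s] //; case/lastP: s => [|s b] // pr sE; rewrite /= size_rcons !ltnS => lt0.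
    apply: (no_virtual_spoke pr); rewrite ?sE //; first by case: (s) lt0.
    by move=> w; rewrite sE; apply: spokes.
  (* A rim of length 3 means K4, where the choice of the hub has to depend on the virtual edges. *)
  have sz : size c = 3 by apply/eqP; rewrite eqn_leq le3.
  case: c sz pc cE Uc lt2 cyc ind att notc hc cover spokes le3 => [|c0 [|c1 [|c2 []]]] // _ pc cE Uc _ cyc ind att notc hc cover spokes _.
  case: (@K4_typed h c0 c1 c2); [by rewrite cons_uniq hc|exact: cover| |by constructor 1|by constructor 2].
  have adj_c u v : u \in [:: c0; c1; c2] -> v \in [:: c0; c1; c2] -> u != v -> e u v.
    case/and4P: cyc => e01 e12 e20 _.
    by case/in3=> -> /in3[] ->; rewrite ?eqxx // e_sym.
  move=> u v; have := cover u; have := cover v; rewrite inE => /predU1P[->|cv]; rewrite inE => /predU1P[->|cu].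
  - by rewrite eqxx.
  - by move=> _; rewrite e_sym; apply: spokes.
  - by move=> _; apply: spokes.
  - exact: adj_c.
case=> c0 [c1 [c2 [c3 [x [y [pc KE nxy exy [ax ay]]]]]]]; constructor 3.
have [n02 n13] := four_no_chord pc; have [Uc _ cyc _ _] := pc.
have [e01 e12 e23 e30] : [/\ e c0 c1, e c1 c2, e c2 c3 & e c3 c0] by case/and5P: cyc.
set c := [:: c0; c1; c2; c3] in pc KE ax ay Uc cyc.
have notc z : (z \notin c) = (z == x) || (z == y) by rewrite -in_set2 -KE in_setC in_set.
have [xc yc] : x \notin c /\ y \notin c by rewrite !notc !eqxx orbT.
have attE w z : w \in c -> (w \in attach e c [set z]) = e w z.
  move=> cw; apply/attachP/idP=> [[_ [_ /set1P->]]|ewz] //.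
  by split=> //; exists z; rewrite ?set11.
have [cc0 cc1 cc2 cc3] : [/\ c0 \in c, c1 \in c, c2 \in c & c3 \in c] by rewrite !inE !eqxx !orbT.
move: (Uc); rewrite /= !inE !negb_or !andbT => /and3P[/and3P[d01 d02 d03] /andP[d12 d13] d23].
have ex w : w \in c -> e w x = (w == c0) || (w == c1) by move=> cw; rewrite -attE // ax in_set2.
have ey w : w \in c -> e w y = (w == c2) || (w == c3) by move=> cw; rewrite -attE // ay in_set2.
have pE : perm_eq [:: c0; y; c1; c3; x; c2] [:: x, y & c].
  rewrite /c; clear; apply/permP=> P /=; move: (P _) (P _) (P _) (P _) (P _) (P _) => b1 b2 b3 b4 b5 b6.
  by case: b1 b2 b3 b4 b5 b6 => [] [] [] [] [] [].
have [[x0 x1] [x2 x3]] : (e c0 x = true /\ e c1 x = true) /\ (e c2 x = false /\ e c3 x = false).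
  by rewrite !ex // !eqxx !orbT ![_ == c0]eq_sym ![_ == c1]eq_sym !(negbTE d02, negbTE d12, negbTE d03, negbTE d13).
have [[y0 y1] [y2 y3]] : (e c0 y = false /\ e c1 y = false) /\ (e c2 y = true /\ e c3 y = true).
  by rewrite !ey // !eqxx !orbT !(negbTE d02, negbTE d12, negbTE d03, negbTE d13).
apply: (@prism_typed c0 c1 c2 c3 x y).
- by rewrite (perm_uniq pE) 2!cons_uniq in_cons negb_or nxy xc yc Uc.
- by move=> z; rewrite (perm_mem pE) 2!in_cons orbA -notc orNb.
move=> [[|[|[|[|[|[|?]]]]]] ?] [[|[|[|[|[|[|?]]]]]] ?] //=; try exact: e_irr;
  rewrite ?x0 ?x1 ?x2 ?x3 ?y0 ?y1 ?y2 ?y3; try (by []);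
  try (rewrite e_sym; by rewrite ?x0 ?x1 ?x2 ?x3 ?y0 ?y1 ?y2 ?y3 ?e01 ?e12 ?e23 ?e30 ?exy ?(negbTE n02) ?(negbTE n13)).
  by rewrite (negbTE n02).
by rewrite (negbTE n13).
Qed.

End Recognition.

(** * The equivalence *)

Lemma FP_rel_rminor (T T' : finType) (r : rel T) (r' : rel T') :
  rminor r r' -> FP_rel r' -> FP_rel r.
Proof. by move=> rr' [nK5 nK33]; split=> /rminor_trans/(_ rr'). Qed.

Lemma component_good (G : sgraph) (C : piece G) : component_3connected C ->
  exists N, [/\ good_piece N C, rminor (@hat G N C) (@adj G) &
    [\/ is_cycle (piece_mgraph C), is_multiedge (piece_mgraph C) | simple_3connected (piece_mgraph C)]].
Proof.
case=> S [D [blockS S_gt2 [spl shapes _] DC]].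
have baseS := base_block blockS S_gt2; have [_ _ _ noV] := baseS.
have [N ltN] := splitting_labels noV spl; exists N.
have [goodC minC] := splitting_good spl baseS ltN DC; split=> //; last exact: shapes.
exact: rminor_trans minC (rminor_induced N S).
Qed.

(** Here the existence of a canonical decomposition enters: without it the condition on components
    could hold vacuously. *)
Lemma component_with_minor (G H : sgraph) : nearly_3connected H -> (2 < #|H|)%N ->
  rminor (@adj H) (@adj G) ->
  exists2 C : piece G, component_3connected C & exists N, wf_piece N C /\ rminor (@adj H) (@hat G N C).
Proof.
move=> H3 H_gt2 /(rminor_block H3 H_gt2)[S [blockS S_gt2 HS]].
have baseS := base_block blockS S_gt2; have [_ _ _ noV] := baseS.
have [D tutteD] := tutte_exists baseS; have [spl _ _] := tutteD.
have [N ltN] := splitting_labels noV spl.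
have [C DC HC] := splitting_rminor H3 spl baseS ltN (rminor_to_induced N HS).
have [[wfC _ _] _] := splitting_good spl baseS ltN DC.
by exists C; [exists S, D | exists N].
Qed.

Theorem corollary11 :
  forall G : sgraph,
    FP G <->
    (forall C : piece G, component_3connected C ->
       [\/ type0 C, type1 C, type2 C | type3 C]).
Proof.
move=> G; split=> [[nK5 nK33] C /component_good[N [[wfC _ _] minC shapeC]]|typed].
  have FPG : FP_rel (@adj G).
    split=> /rminor_minor-/(_ _); [apply: contra_not nK5 | apply: contra_not nK33]; apply.
      exact: K5_nearly_3connected.1.
    exact: K33_nearly_3connected.1.
  case: shapeC => [[n lt2n [f [g [bf bg fg _]]]]|[n lt2n [f [g [bf bg fg _]]]]|C3].
  - by constructor 1; exists n => //; left; exists f, g.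
  - by constructor 1; exists n => //; right; exists f, g.
  have [] := simple_3connected_typed wfC C3 (FP_rel_rminor minC FPG);
    [constructor 2 | constructor 3 | constructor 4]; assumption.
have no_minor (H : sgraph) : nearly_3connected H -> (2 < #|H|)%N ->
    (forall (T : finType) (r : rel T), FP_rel r -> ~ rminor (@adj H) r) -> ~ minor H G.
  move=> H3 H_gt2 nH /minor_rminor/(component_with_minor H3 H_gt2)[C /typed tC [N [wfC HC]]].
  exact: nH (typed_FP wfC tC) HC.
split; apply: no_minor.
- exact: K5_nearly_3connected.
- by rewrite card_ord.
- by move=> T r [].
- exact: K33_nearly_3connected.
- by rewrite card_prod card_bool card_ord.
- by move=> T r [].
Qed.
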